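(* Let $X$ be an affine complex variety. Then $\mathcal{K}^0(X(\mathbb{C}))$ is the integral closure of $\mathbb{C}[X]$ in $\mathcal{C}^0(X(\mathbb{C}),\mathbb{C})$.
   Context: An affine complex variety is $X=\operatorname{Spec}(\mathbb{C}[X])$ with $\mathbb{C}[X]$ a reduced finitely generated $\mathbb{C}$-algebra ($X$ need not be irreducible). $X(\mathbb{C})$ is the set of closed points of $X$, identified with a Zariski closed subset of some $\mathbb{C}^n$; elements of $\mathbb{C}[X]$ are identified with polynomial functions on $X(\mathbb{C})$. $\mathcal{C}^0(X(\mathbb{C}),\mathbb{C})$ is the ring of functions $X(\mathbb{C})\to\mathbb{C}$ continuous for the Euclidean topology. A function $f:X(\mathbb{C})\to\mathbb{C}$ is rational if it is regular on some Zariski dense Zariski open subset of $X(\mathbb{C})$. $\mathcal{K}^0(X(\mathbb{C}))$ is the ring of functions $f:X(\mathbb{C})\to\mathbb{C}$ that are rational and continuous on all of $X(\mathbb{C})$ for the Euclidean topology. For an extension of rings $A\hookrightarrow B$, the integral closure of $A$ in $B$ is the ring of all $b\in B$ that are roots of a monic polynomial with coefficients in $A$. *)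

(* Defs.v *)
From mathcomp Require Import all_boot all_order all_algebra.
From mathcomp Require Import all_classical all_reals all_analysis.
From mathcomp Require Export complex.
From mathcomp Require mpoly.

Set Implicit Arguments.
Unset Strict Implicit.
Unset Printing Implicit Defensive.

Import Order.TTheory GRing.Theory Num.Theory.
Import numFieldNormedType.Exports.

Local Open Scope classical_set_scope.
Local Open Scope ring_scope.

(* The monic equation is spelled out because {poly S} and integralOver require
   a nontrivial ring, while the ring of functions on an empty set is zero. *)
Definition integral_closure (S : comPzRingType) (A B : set S) : set S :=
  [set b | B b /\ exists (d : nat) (a : 'I_d -> S),
    (forall i, A (a i)) /\ b ^+ d + \sum_(i < d) a i * b ^+ i = 0].

(* The type of this constant lets the canonical topology and norm of a numeric
   field be inferred; they are keyed on the structure and are not found on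
   the carrier R[i]. *)
Definition Cplx (R : realType) : numClosedFieldType := R[i].

Section AffineVariety.
Variables (R : realType) (n : nat).
Local Notation C := (Cplx R).

Definition peval (p : mpoly.mpoly n C) (x : 'rV[C]_n) : C :=
  mpoly.meval (fun i => x ord0 i) p.

Definition zero_locus (I : set (mpoly.mpoly n C)) : set 'rV[C]_n :=
  [set x | forall p, I p -> peval p x = 0].

Definition zariski_closed (Z : set 'rV[C]_n) : Prop :=
  exists I : set (mpoly.mpoly n C), Z = zero_locus I.

Variable X : set 'rV[C]_n.

Definition zariski_open_in (U : set X) : Prop :=
  exists I : set (mpoly.mpoly n C), U = ~` (set_val @^-1` zero_locus I).

Definition zariski_dense_in (U : set X) : Prop :=
  forall V : set X, zariski_open_in V -> V !=set0 -> (U `&` V) !=set0.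

Definition coordinate_ring : set (X -> C) :=
  [set f | exists p : mpoly.mpoly n C, forall x : X, f x = peval p (set_val x)].

(* X carries the library's set_type topology, induced by the Euclidean topology
   of C^n; the Zariski topology is never declared as an instance. *)
Definition continuous_functions : set (X -> C) :=
  [set f | continuous f].

Definition regular_on (U : set X) (f : X -> C) : Prop :=
  forall x : X, U x -> exists V : set X,
    [/\ zariski_open_in V, V x, V `<=` U &
      exists p q : mpoly.mpoly n C, forall y : X, V y ->
        peval q (set_val y) != 0 /\
        f y = peval p (set_val y) / peval q (set_val y)].

Definition rational_function (f : X -> C) : Prop :=
  exists U : set X,
    [/\ zariski_open_in U, zariski_dense_in U & regular_on U f].

Definition continuous_rational_functions : set (X -> C) :=
  [set f | rational_function f /\ continuous_functions f].

End AffineVariety.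

(* Main.v *)
(** Induction on the dimension [d] of a finite projection [X -> C^d] (Noether
    normalization).  By the primitive element theorem, the part of [X] lying over a
    Zariski dense open subset of [C^d] is a covering [F (z, t) = 0] of it, whose sheets
    depend holomorphically on [z].  Let [f] be continuous on [X], and integral or
    rational, so that it is algebraic over the functions of [z] and its values on the
    sheets are also holomorphic.  A symmetric function of these values is then holomorphic
    in [z] outside a hypersurface, locally bounded and of polynomial growth; Liouville's
    theorem on lines, followed by interpolation, makes it a polynomial in [z].
    Lagrange interpolation in the sheet coordinate turns such symmetric functions into an
    identity [a f = p] with polynomials [a], [p]: integral functions are rational.  The
    characteristic polynomial of the values of [f] over [z] is monic with polynomial
    coefficients and kills [f], also on the Euclidean closure of this part of [X]: rational
    functions are integral.  The part of [X] where the construction degenerates is finite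
    over a space of smaller dimension.

    Holomorphy is replaced by Taylor expansions of every order at a point; such functions
    satisfy the maximum principle, which gives Liouville's theorem without integration. *)

From HB Require Import structures.
Require Import Defs.
From mathcomp Require Import all_boot all_order all_algebra.
From mathcomp Require Import all_classical all_reals all_analysis.
From mathcomp Require Import ring lra.
Import -(notations) mpoly.

Set Implicit Arguments.
Unset Strict Implicit.
Unset Printing Implicit Defensive.

Import Order.TTheory GRing.Theory Num.Theory.
Import numFieldNormedType.Exports.

Local Open Scope classical_set_scope.
Local Open Scope ring_scope.

(** * Taylor expansions and the maximum principle *)

(** [X] may be reducible, with components of several dimensions, so there is no function field to
    work in. Its place is taken by the polynomials over [C[z]] that vanish at every point of [X]:
    one of least degree divides the others up to factors in [C[z]] and has simple roots over a dense
    open set. This is the origin of the nonzero polynomials [q], [delta], [a] in the base variables;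
    multiplying an identity by them extends it to all of [X]. Continuity of [f] enters three times:
    it makes the values of [f] on the sheets expandable, it bounds [f] over bounded sets of the
    base, since a finite projection is proper, and it carries the integral equation to the closure.
    On a line, the bound is what is known at the finitely many exceptional points; a polynomial
    vanishing there, times a power of the function, is continuous. A denominator may vanish on a
    whole component. Rationality is therefore phrased with all the denominators of [f], in a form
    that passes to the pieces on which the inductions on dimension run. *)

Section ComplexModulus.
Variable R : realType.
Local Notation C := (Cplx R).

(** The norm of [C] takes its values in [C]; a real-valued modulus gives [lra] and [nra] a totally
    ordered field to work in. *)
Definition nm (z : C) : R := ComplexField.Normc.normc (z : R[i]).

Definition rc (x : R) : C := x%:C%C.

Lemma normE (z : C) : `|z| = rc (nm z).
Proof. by []. Qed.

Lemma rcD x y : rc (x + y) = rc x + rc y. Proof. exact: (rmorphD (real_complex R)). Qed.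
Lemma rcM x y : rc (x * y) = rc x * rc y. Proof. exact: (rmorphM (real_complex R)). Qed.
Lemma rcX x n : rc (x ^+ n) = rc x ^+ n. Proof. exact: (rmorphXn (real_complex R)). Qed.
Lemma rc_inj : injective rc. Proof. exact: (@complexI R). Qed.
Lemma ler_rc x y : (rc x <= rc y) = (x <= y). Proof. exact: lecR. Qed.
Lemma ltr_rc x y : (rc x < rc y) = (x < y). Proof. exact: ltcR. Qed.

Lemma nm_ge0 z : 0 <= nm z.
Proof. by rewrite -ler_rc -normE normr_ge0. Qed.

Lemma nmD x y : nm (x + y) <= nm x + nm y.
Proof. by rewrite -ler_rc rcD -!normE ler_normD. Qed.

Lemma nmM x y : nm (x * y) = nm x * nm y.
Proof. by apply: rc_inj; rewrite rcM -!normE normrM. Qed.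

Lemma nmX x n : nm (x ^+ n) = nm x ^+ n.
Proof. by apply: rc_inj; rewrite rcX -!normE normrX. Qed.

Lemma nmN x : nm (- x) = nm x.
Proof. by apply: rc_inj; rewrite -!normE normrN. Qed.

Lemma nmBC x y : nm (x - y) = nm (y - x).
Proof. by rewrite -nmN opprB. Qed.

Lemma nm_eq0 x : (nm x == 0) = (x == 0).
Proof. by rewrite -(inj_eq rc_inj) -normE normr_eq0. Qed.

Lemma nm0 : nm 0 = 0. Proof. by apply/eqP; rewrite nm_eq0. Qed.
Lemma nm1 : nm 1 = 1. Proof. by apply: rc_inj; rewrite -normE normr1. Qed.

Lemma nm_gt0 x : (0 < nm x) = (x != 0).
Proof. by rewrite lt_def nm_ge0 andbT nm_eq0. Qed.

Lemma nmV x : nm (x^-1) = (nm x)^-1.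
Proof.
have [->|x0] := eqVneq x 0; first by rewrite invr0 nm0 invr0.
apply: (mulfI (x := nm x)); first by rewrite nm_eq0.
by rewrite -nmM !divff ?nm_eq0 // nm1.
Qed.

Lemma nm_rc x : nm (rc x) = `|x|.
Proof.
by rewrite /nm/=; rewrite expr0n addr0 sqrtr_sqr.
Qed.

Lemma nm_nat k : nm k%:R = k%:R.
Proof.
by apply: rc_inj; rewrite -normE normr_nat -[RHS]/(real_complex R k%:R) rmorph_nat.
Qed.

Lemma nm_sub x y : nm x - nm y <= nm (x - y).
Proof. by rewrite lerBlDr; have := nmD (x - y) y; rewrite subrK. Qed.

Lemma nm_sum (I : Type) (r : seq I) (F : I -> C) :
  nm (\sum_(i <- r) F i) <= \sum_(i <- r) nm (F i).
Proof.
elim: r => [|i r IH]; first by rewrite !big_nil nm0.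
by rewrite !big_cons (le_trans (nmD _ _)) ?lerD2l.
Qed.

Lemma nm_prod (I : Type) (r : seq I) (F : I -> C) :
  nm (\prod_(i <- r) F i) = \prod_(i <- r) nm (F i).
Proof.
elim: r => [|i r IH]; first by rewrite !big_nil nm1.
by rewrite !big_cons nmM IH.
Qed.

Lemma parallelogram (a w : C) :
  nm (a + w) ^+ 2 + nm (a - w) ^+ 2 = nm a ^+ 2 *+ 2 + nm w ^+ 2 *+ 2.
Proof.
have sq (z : C) : nm z ^+ 2 = complex.Re (z : R[i]) ^+ 2 + complex.Im (z : R[i]) ^+ 2.
  by case: z => x y; rewrite /nm/= sqr_sqrtr// addr_ge0 ?sqr_ge0.
by rewrite !sq; case: a w => x y [u v] /=; ring.
Qed.

Lemma inj_notin (f : nat -> C) (s : seq C) : injective f -> exists k, f k \notin s.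
Proof.
move=> finj; pose t := [seq f k | k <- iota 0 (size s).+1].
have [/allP ts|/allPn[c /mapP[k _ ->] cs]] := boolP (all (mem s) t); last by exists k.
have := uniq_leq_size _ ts; rewrite map_inj_uniq// iota_uniq size_map size_iota.
by move=> /(_ isT); rewrite ltnn.
Qed.

Lemma exists_notin (s : seq C) : exists c : C, c \notin s.
Proof.
have [|k hk] := @inj_notin (fun k => k%:R) s; last by exists k%:R.
by move=> i j /eqP; rewrite eqr_nat => /eqP.
Qed.

Lemma poly_nonroot (p : {poly C}) (s : seq C) : p != 0 -> exists2 c, p.[c] != 0 & c \notin s.
Proof.
have [r ->] := closed_field_poly_normal p => p0.
have [c] := exists_notin (r ++ s); rewrite mem_cat negb_or => /andP[cr cs].
exists c => //; rewrite hornerZ mulf_neq0//.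
  by apply: contra p0 => /eqP->; rewrite scale0r.
rewrite horner_prod prodf_seq_neq0; apply/allP => x xr /=.
by rewrite hornerXsubC subr_eq0; apply: contra cr => /eqP->.
Qed.

Lemma poly_small_nonroot (p : {poly C}) (e : R) : p != 0 -> 0 < e ->
  exists2 t, nm t < e & p.[t] != 0.
Proof.
have [r ->] := closed_field_poly_normal p => p0 e0.
(* The shift by two keeps every candidate strictly below [e]. *)
have [|k hk] := @inj_notin (fun k => rc (e / k.+2%:R)) r.
  move=> i j /rc_inj/(mulfI (lt0r_neq0 e0))/invr_inj/eqP.
  by rewrite eqr_nat => /eqP[].
exists (rc (e / k.+2%:R)).
  rewrite nm_rc gtr0_norm ?divr_gt0// ltr_pdivrMr// ltr_pMr//.
  by rewrite ltr1n.
rewrite hornerZ mulf_neq0//; first by apply: contra p0 => /eqP->; rewrite scale0r.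
by rewrite -[_ == _]/(root _ _) root_prod_XsubC.
Qed.

Lemma poly_eq0 (p : {poly C}) : (forall c, p.[c] = 0) -> p = 0.
Proof.
move=> h; apply/eqP; apply: contraT => /(poly_nonroot [::])[c].
by rewrite h eqxx.
Qed.

(** Beyond [1] plus the sum of the moduli of the roots, each factor [t - x] has modulus at least
    [1], which leaves the leading coefficient as lower bound. *)
Lemma poly_large (p : {poly C}) : p != 0 ->
  exists2 c, 0 < c & exists rho, forall t, rho <= nm t -> c <= nm p.[t].
Proof.
move=> p0; have [r E] := closed_field_poly_normal p.
exists (nm (lead_coef p)); first by rewrite nm_gt0 lead_coef_eq0.
exists (1 + \sum_(x <- r) nm x) => t ht.
rewrite {2}E hornerZ nmM ler_peMr ?nm_ge0// horner_prod nm_prod.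
elim: r t ht {E} => [|x r IH] t; first by rewrite !big_nil.
rewrite !big_cons => ht.
have s0 : 0 <= \sum_(x <- r) nm x by apply: sumr_ge0 => ? _; exact: nm_ge0.
rewrite hornerXsubC mulr_ege1 ?IH//.
  by have := nm_sub t x; have := nm_ge0 x; lra.
by have := nm_ge0 x; lra.
Qed.

End ComplexModulus.

(** * Finite Taylor expansions at a point *)

Section LocalExpansion.
Variable R : realType.
Local Notation C := (Cplx R).

Lemma gt0_rc (e : C) : 0 < e -> e = rc (nm e) /\ 0 < nm e.
Proof.
move=> e0; split; first by rewrite -normE gtr0_norm.
by rewrite lt_def nm_ge0 nm_eq0 (gt_eqF e0).
Qed.

Lemma nearCP (a : C) (P : C -> Prop) :
  (\forall t \near a, P t) <-> exists2 d : R, 0 < d & forall t, nm (t - a) < d -> P t.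
Proof.
split=> [/nbhs_normP[e /= /gt0_rc[eE e0] h]|[d d0 h]].
  by exists (nm e) => // t ta; apply: h => /=; rewrite distrC normE eE ltr_rc.
apply/nbhs_normP; exists (rc d) => /=; first by rewrite -[0]/(rc 0) ltr_rc.
by move=> t /=; rewrite distrC normE ltr_rc => /h.
Qed.

Lemma near_self (a : C) (P : C -> Prop) : (\forall t \near a, P t) -> P a.
Proof. by move=> /nearCP[d d0]; apply; rewrite subrr nm0. Qed.

Lemma cvg_nmP (T : Type) (F : set_system T) (f : T -> C) (y : C) : Filter F ->
  (f @ F --> y) <-> forall e : R, 0 < e -> \forall t \near F, nm (f t - y) < e.
Proof.
move=> FF; rewrite cvgrPdist_lt; split=> h e e0.
  have /h : 0 < rc e :> C by rewrite -[0]/(rc 0) ltr_rc.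
  by apply: filterS => t; rewrite distrC normE ltr_rc.
have [eE /h] := gt0_rc e0.
by apply: filterS => t; rewrite distrC normE {2}eE ltr_rc.
Qed.

Lemma cont_nmP (f : C -> C) (a : C) : (f t @[t --> a] --> f a) <->
  forall e : R, 0 < e -> exists2 d : R, 0 < d & forall t, nm (t - a) < d -> nm (f t - f a) < e.
Proof.
split=> [/cvg_nmP h e /h/nearCP//|h].
by apply/(cvg_nmP f (f a) (F := nbhs a)) => e /h/nearCP.
Qed.

Lemma near_neq0 (f : C -> C) (a : C) : f t @[t --> a] --> f a -> f a != 0 ->
  \forall t \near a, f t != 0.
Proof.
move=> /cont_nmP h fa0.
have /h[d d0 hd] : 0 < nm (f a) by rewrite nm_gt0.
apply/nearCP; exists d => // t /hd; apply: contraTneq => ->.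
by rewrite sub0r nmN ltxx.
Qed.

(* Pointwise notion: nothing is asked of [y] at points other than [a] *)
Fixpoint taylor (k : nat) (a : C) (y : C -> C) : Prop :=
  if k is k'.+1 then
    exists c w, taylor k' a w /\ \forall t \near a, y t = c + (t - a) * w t
  else (y t @[t --> a] --> y a).

Lemma taylor_near k a y z : (\forall t \near a, y t = z t) -> taylor k a y -> taylor k a z.
Proof.
case: k => [|k] /= yz.
  move=> cy; have yza := near_self yz; rewrite -yza.
  exact: cvg_trans (near_eq_cvg yz) cy.
move=> [c [w [hw h]]]; exists c, w; split => //.
by near=> t; rewrite -(near yz t)//; near: t.
Unshelve. all: by end_near. Qed.

Let lim_cst (a c : C) : c @[t --> a] --> c.
Proof. exact: (@cvg_cst _ _ _ _ (nbhs_filter a)). Qed.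

Let limD (a : C) (y z : C -> C) (b c : C) : y t @[t --> a] --> b -> z t @[t --> a] --> c ->
  (y t + z t) @[t --> a] --> b + c.
Proof. exact: (@cvgD _ _ _ (nbhs a)). Qed.

Let limM (a : C) (y z : C -> C) (b c : C) : y t @[t --> a] --> b -> z t @[t --> a] --> c ->
  (y t * z t) @[t --> a] --> b * c.
Proof. exact: (@cvgM _ _ (nbhs a)). Qed.

Let limV (a : C) (y : C -> C) (b : C) : b != 0 -> y t @[t --> a] --> b ->
  (y t)^-1 @[t --> a] --> b^-1.
Proof. exact: (@cvgV _ _ (nbhs a)). Qed.

Lemma taylorW k a y : taylor k.+1 a y -> taylor k a y.
Proof.
elim: k y => [|k IH] y /= [c [w [hw h]]].
  apply: (@taylor_near 0 a (fun t => c + (t - a) * w t)).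
    by near do symmetry.
  apply: limD; first exact: lim_cst.
  apply: limM; last exact: hw.
  by apply: limD; [exact: cvg_id|exact: lim_cst].
by exists c, w; split => //; exact: IH.
Unshelve. all: by end_near. Qed.

Lemma taylor_cont k a y : taylor k a y -> (y t @[t --> a] --> y a).
Proof. by elim: k y => [|k IH] y // /taylorW/IH. Qed.

Lemma taylor_cst k a c : taylor k a (fun=> c).
Proof.
elim: k c => [|k IH] c /=; first exact: lim_cst.
by exists c, (fun=> 0); split => //; near=> t; rewrite mulr0 addr0.
Unshelve. all: by end_near. Qed.

Lemma taylorD k a y z : taylor k a y -> taylor k a z -> taylor k a (fun t => y t + z t).
Proof.
elim: k y z => [|k IH] y z; first exact: limD.
move=> [c [w [hw h]]] [c' [w' [hw' h']]].
exists (c + c'), (fun t => w t + w' t); split; first exact: IH.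
by near=> t; rewrite (near h t)// (near h' t)//; ring.
Unshelve. all: by end_near. Qed.

Lemma taylor_id k a : taylor k a id.
Proof.
case: k => [|k]; first exact: cvg_id.
exists a, (fun=> 1); split; first exact: taylor_cst.
by near=> t; rewrite mulr1 addrC subrK.
Unshelve. all: by end_near. Qed.

Lemma taylor_sub k (a b : C) : taylor k b (fun t : C => t - a).
Proof. by apply: taylorD; [exact: taylor_id|exact: taylor_cst]. Qed.

Lemma taylorM k a y z : taylor k a y -> taylor k a z -> taylor k a (fun t => y t * z t).
Proof.
elim: k y z => [|k IH] y z; first exact: limM.
move=> ty tz; have ty' := taylorW ty; move: ty tz.
move=> [c [w [hw h]]] [c' [w' [hw' h']]].
exists (c * c'), (fun t => w t * c' + y t * w' t); split.
  by apply: taylorD; apply: IH => //; exact: taylor_cst.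
by near=> t; rewrite (near h' t)// [in LHS](near h t)// [in RHS](near h t)//; ring.
Unshelve. all: by end_near. Qed.

Lemma taylorN k a y : taylor k a y -> taylor k a (fun t => - y t).
Proof.
move=> hy; rewrite (_ : (fun t => - y t) = (fun t => (-1) * y t)); last first.
  by apply/funext => t; rewrite mulN1r.
by apply: taylorM => //; exact: taylor_cst.
Qed.

Lemma taylorB k a y z : taylor k a y -> taylor k a z -> taylor k a (fun t => y t - z t).
Proof. by move=> hy hz; apply: taylorD => //; exact: taylorN. Qed.

Lemma taylor_value k (a : C) (y : C -> C) c (w : C -> C) : (\forall t \near a, y t = c + (t - a) * w t) ->
  taylor k a w -> c = y a.
Proof. by move=> /near_self ->; rewrite subrr mul0r addr0. Qed.

Lemma taylorV k a y : y a != 0 -> taylor k a y -> taylor k a (fun t => (y t)^-1).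
Proof.
move=> ya; elim: k => [|k IH] ty; first exact: (limV ya ty).
have ty' := taylorW ty; have tV := IH ty'.
have yn0 := near_neq0 (taylor_cont ty') ya.
move: ty => [c [w [hw h]]]; have cE := taylor_value h hw.
exists c^-1, (fun t => - (c^-1 * w t) * (y t)^-1); split.
  apply: taylorM => //; apply: taylorN; apply: taylorM => //; exact: taylor_cst.
near=> t.
have yt0 : y t != 0 by near: t.
have yE : y t = c + (t - a) * w t by near: t.
have c0 : c != 0 by rewrite cE.
have e : (t - a) * w t = y t - c by rewrite yE addrAC subrr add0r.
rewrite (_ : (t - a) * _ = - (c^-1 * ((t - a) * w t) / y t)); last by ring.
by rewrite e; field; rewrite yt0 c0.
Unshelve. all: by end_near. Qed.

Lemma taylorX k a y n : taylor k a y -> taylor k a (fun t => y t ^+ n).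
Proof.
move=> hy; elim: n => [|n IH].
  by rewrite (_ : (fun _ => _) = (fun=> 1))//; exact: taylor_cst.
rewrite (_ : (fun _ => _) = (fun t => y t * y t ^+ n)); first exact: taylorM.
by apply/funext => t; rewrite exprS.
Qed.

Lemma taylor_bigsum (I : Type) (r : seq I) (F : I -> C -> C) k a :
  (forall i, taylor k a (F i)) -> taylor k a (fun t => \sum_(i <- r) F i t).
Proof.
move=> h; elim: r => [|i r IH].
  by rewrite (_ : (fun _ => _) = (fun=> 0)); [exact: taylor_cst|apply/funext => t; rewrite big_nil].
rewrite (_ : (fun _ => _) = (fun t => F i t + \sum_(j <- r) F j t)); first exact: taylorD.
by apply/funext => t; rewrite big_cons.
Qed.

Lemma taylor_horner (p : {poly C}) k a y : taylor k a y -> taylor k a (fun t => p.[y t]).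
Proof.
move=> hy; rewrite (_ : (fun _ => _) = (fun t => \sum_(i < size p) p`_i * y t ^+ i)).
  by apply: taylor_bigsum => i; apply: taylorM; [exact: taylor_cst|exact: taylorX].
by apply/funext => t; rewrite horner_coef.
Qed.

Lemma taylor_poly (p : {poly C}) k a : taylor k a (fun t => p.[t]).
Proof. by apply: taylor_horner; exact: taylor_id. Qed.

End LocalExpansion.

(** * Implicit functions and a four-point mean value inequality *)

Section MaximumPrinciple.
Variable R : realType.
Local Notation C := (Cplx R).

(** The outer variable of [P] receives [y t], the inner one [t]. *)
Lemma taylor_horner2 (P : {poly {poly C}}) k a y : taylor k a y ->
  taylor k a (fun t => P.[(y t)%:P].[t]).
Proof.
move=> hy; rewrite (_ : (fun _ => _) = (fun t => \sum_(i < size P) (P`_i).[t] * y t ^+ i)).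
  by apply: taylor_bigsum => i; apply: taylorM; [exact: taylor_poly|exact: taylorX].
apply/funext => t; rewrite (horner_coef P) horner_sum; apply: eq_bigr => i _.
by rewrite hornerM horner_exp hornerC.
Qed.

(* [y - y a = - (t - a) phi / Psi (t, y)], so a simple root gains one order at each step *)
Lemma taylor_implicit (P : {poly {poly C}}) k (a : C) (y : C -> C) :
  y t @[t --> a] --> y a -> (\forall t \near a, P.[(y t)%:P].[t] = 0) ->
  P^`().[(y a)%:P].[a] != 0 -> taylor k a y.
Proof.
move=> cy Py P'y; set b := y a in P'y.
(* [Q] and [f] are the [Psi] and [phi] above: [Q] is the divided difference of [P] at [b] in the
   outer variable, so its value at the base point is the derivative of [P] there. *)
have /factor_theorem[Q PQ] : root (P - P.[b%:P]%:P) b%:P.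
  by rewrite /root hornerD hornerN hornerC subrr.
have {}PQ : P = Q * ('X - b%:P%:P) + P.[b%:P]%:P by rewrite -PQ subrK.
have /factor_theorem[f fE] : root P.[b%:P] a.
  by rewrite /root; have /= <- := near_self Py.
have Qb : Q.[b%:P].[a] != 0.
  move: P'y; rewrite PQ derivD derivC addr0 derivM derivXsubC mulr1.
  by rewrite hornerD hornerM hornerXsubC subrr mulr0 add0r.
elim: k => [//|k IH].
pose w t := - f.[t] * (Q.[(y t)%:P].[t])^-1.
exists b, w; split.
  apply: taylorM; first by apply: taylorN; exact: taylor_poly.
  by apply: taylorV => //; exact: taylor_horner2.
have Qn : \forall t \near a, Q.[(y t)%:P].[t] != 0.
  exact: near_neq0 (taylor_cont (@taylor_horner2 Q 0 a y cy)) Qb.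
near=> t.
have Qt : Q.[(y t)%:P].[t] != 0 by near: t.
have : P.[(y t)%:P].[t] = 0 by near: t.
rewrite PQ fE !(hornerD, hornerM, hornerXsubC, hornerC, hornerN, hornerX) => e.
have {}e : y t - b = (t - a) * (- f.[t] / Q.[(y t)%:P].[t]).
  apply: (mulfI Qt); rewrite -[RHS](_ : (t - a) * (- f.[t]) = _).
    by move/eqP: e; rewrite addr_eq0 => /eqP->; ring.
  by field.
by rewrite /w -e addrC subrK.
Unshelve. all: by end_near. Qed.

(** The sums of [u] and of [u ^+ 2] over the fourth roots of unity vanish, so the terms of orders
    one and two cancel, up to the variation of the coefficient [w'] near [a]. *)
Lemma four_point (h : C -> C) (a : C) : taylor 2 a h -> forall e : R, 0 < e ->
  exists2 d : R, 0 < d & forall r : R, 0 < r < d ->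
  4 * nm (h a) <= nm (h (a + rc r)) + nm (h (a - rc r))
   + (nm (h (a + 'i * rc r)) + nm (h (a - 'i * rc r))) + e * r ^+ 2.
Proof.
move=> [c [w [[c' [w' [cw']]]]]] nw nh e e0.
have cE : c = h a by have /= -> := near_self nh; rewrite subrr mul0r addr0.
have {nw} : \forall t \near a, h t = h a + (t - a) * (c' + (t - a) * w' t).
  by near=> t; rewrite (near nh t)// cE (near nw t).
move=> /nearCP[d1 d10 hE].
have e40 : 0 < e / 4 by lra.
move/cont_nmP : cw' => /(_ _ e40)[d2 d20 hw].
exists (Num.min d1 d2); first by rewrite lt_min d10.
move=> r /andP[r0]; rewrite lt_min => /andP[rd1 rd2].
have nmr (u : C) : nm u = 1 -> nm (u * rc r) = r.
  by move=> u1; rewrite nmM u1 mul1r nm_rc gtr0_norm.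
have nmi : nm ('i : C) = 1 by apply: rc_inj; rewrite -normE normCi.
have key (u : C) : nm u = 1 ->
    h (a + u * rc r) = h a + u * rc r * (c' + u * rc r * w' (a + u * rc r)) /\
    nm (w' (a + u * rc r) - w' a) < e / 4.
  move=> u1; have ua : a + u * rc r - a = u * rc r by rewrite addrAC subrr add0r.
  by split; [rewrite hE ua// nmr|apply: hw; rewrite ua nmr].
have [h1 w1] := key 1 (nm1 R); have [h2 w2] := key (- 1) (etrans (nmN _) (nm1 R)).
have [h3 w3] := key 'i nmi; have [h4 w4] := key (- 'i) (etrans (nmN _) nmi).
rewrite !mulNr !mul1r in h1 h2 h3 h4 w1 w2 w3 w4.
set h1' := h (a + rc r) in h1 *; set h2' := h (a - rc r) in h2 *.
set h3' := h (a + 'i * rc r) in h3 *; set h4' := h (a - 'i * rc r) in h4 *.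
set W1 := w' (a + rc r) in h1 w1; set W2 := w' (a - rc r) in h2 w2.
set W3 := w' (a + 'i * rc r) in h3 w3; set W4 := w' (a - 'i * rc r) in h4 w4.
have E : 4 * h a = (h1' + h2' + (h3' + h4')) -
    rc r ^+ 2 * (((W1 - w' a) + (W2 - w' a)) - ((W3 - w' a) + (W4 - w' a))).
  have i2 : 'i * 'i = -1 :> C by rewrite -expr2 sqrCi.
  rewrite h1 h2 h3 h4; set I := 'i : C in i2 *.
  transitivity (4 * h a + rc r ^+ 2 * (W1 + W2 + (I * I) * (W3 + W4)) -
    rc r ^+ 2 * (((W1 - w' a) + (W2 - w' a)) - ((W3 - w' a) + (W4 - w' a)))).
    by rewrite i2; ring.
  by ring.
have -> : 4 * nm (h a) = nm (4 * h a).
  by rewrite nmM nm_nat.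
rewrite E; apply: (le_trans (nmD _ _)); rewrite nmN nmM nmX nm_rc gtr0_norm//.
have H1 := nmD (h1' + h2') (h3' + h4'); have H2 := nmD h1' h2'; have H3 := nmD h3' h4'.
have K1 := nmD ((W1 - w' a) + (W2 - w' a)) (- ((W3 - w' a) + (W4 - w' a))).
have K2 := nmD (W1 - w' a) (W2 - w' a); have K3 := nmD (W3 - w' a) (W4 - w' a).
rewrite nmN in K1.
have K : nm (W1 - w' a + (W2 - w' a) - (W3 - w' a + (W4 - w' a))) <= e by lra.
have : r ^+ 2 * nm (W1 - w' a + (W2 - w' a) - (W3 - w' a + (W4 - w' a))) <= r ^+ 2 * e.
  by rewrite ler_wpM2l// sqr_ge0.
lra.
Unshelve. all: by end_near. Qed.

End MaximumPrinciple.

(** * Liouville's theorem *)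

Section Liouville.
Variable R : realType.
Local Notation C := (Cplx R).

Definition mkC (p : R * R) : C := Complex p.1 p.2.

Lemma nm_mkC p : nm (mkC p) ^+ 2 = p.1 ^+ 2 + p.2 ^+ 2.
Proof. by rewrite /nm /= sqr_sqrtr// addr_ge0 ?sqr_ge0. Qed.

Lemma nm_mkC_le p : nm (mkC p) <= `|p.1| + `|p.2|.
Proof.
rewrite -(ler_pXn2r (n := 2))// ?nnegrE ?nm_ge0 ?addr_ge0//.
rewrite nm_mkC -(real_normK (num_real p.1)) -(real_normK (num_real p.2)).
by have := normr_ge0 p.1; have := normr_ge0 p.2; nra.
Qed.

Lemma nm_mkC_ge p : `|p.1| <= nm (mkC p) /\ `|p.2| <= nm (mkC p).
Proof.
by split; rewrite -(ler_pXn2r (n := 2))// ?nnegrE ?nm_ge0 ?addr_ge0// nm_mkC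
  real_normK ?num_real// ?lerDl ?lerDr ?sqr_ge0.
Qed.

Lemma mkC_surj (z : C) : exists p, z = mkC p.
Proof. by case: z => x y; exists (x, y). Qed.

Lemma mkCB p q : mkC p - mkC q = mkC (p.1 - q.1, p.2 - q.2).
Proof. by []. Qed.

Lemma cont_mkC (g : C -> R) :
  (forall a (e : R), 0 < e -> exists2 d : R, 0 < d &
     forall t, nm (t - a) < d -> `|g t - g a| < e) ->
  continuous (g \o mkC).
Proof.
move=> gc p; apply/cvgrPdist_lt => e e0 /=.
have [d d0 hd] := gc (mkC p) e e0.
have d20 : 0 < d / 2 by lra.
have := nbhsx_ballx p (d / 2) d20; apply: filterS => q [/= k1 k2].
rewrite /ball /= in k1 k2; rewrite distrC; apply: hd; rewrite mkCB.
apply: le_lt_trans (nm_mkC_le _) _ => /=.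
by rewrite distrC [`|q.2 - _|]distrC; lra.
Qed.

(** The maximum is taken over the square of half-side [rho], which contains the disc of radius [rho]
    and whose points have modulus at most [2 * rho]. *)
Lemma square_max (g : C -> R) (rho : R) : 0 <= rho ->
  (forall a (e : R), 0 < e -> exists2 d : R, 0 < d &
     forall t, nm (t - a) < d -> `|g t - g a| < e) ->
  exists2 a, nm a <= 2 * rho & forall z, nm z <= rho -> g z <= g a.
Proof.
move=> rho0 gc.
have cpt : compact (`[- rho, rho]%classic `*` `[- rho, rho]%classic : set (R * R)).
  by apply: compact_setX; exact: segment_compact.
have [||c] := @compact_EVT_max _ R (g \o mkC) _ _ cpt.
- by exists (0, 0); split => /=; rewrite in_itv/= oppr_le0 rho0.
- exact/continuous_subspaceT/cont_mkC.
rewrite inE => -[/= + +] hc; rewrite !in_itv/= -!ler_norml => c1 c2.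
exists (mkC c); first by apply: le_trans (nm_mkC_le _) _; lra.
move=> z; have [p ->] := mkC_surj z; have [p1 p2] := nm_mkC_ge p => zr.
by apply: hc; rewrite inE; split => /=; rewrite in_itv/= -ler_norml; lra.
Qed.

(** At an interior maximum [a] of [nm (E z) + eps * nm z ^+ 2], the four-point inequality for [E]
    and the parallelogram law together would make the four values around [a] sum to more than four
    times the value at [a]. *)
Lemma max_principle (E : C -> C) (S : seq C) :
  (forall z, E t @[t --> z] --> E z) ->
  (forall z, z \notin S -> taylor 2 z E) ->
  (forall z, z \in S -> E z = 0) ->
  (forall e : R, 0 < e -> exists rho : R, forall z, rho <= nm z -> nm (E z) < e) ->
  forall z, E z = 0.
Proof.
move=> Ec ET ES Einf z1; apply/eqP; apply: contraT; rewrite -nm_gt0 => e0.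
set e := nm (E z1) in e0.
have e20 : 0 < e / 2 by lra.
have [rho0 hrho0] := Einf _ e20.
pose rho := 1 + nm z1 + `|rho0|.
have rho_gt0 : 0 < rho by rewrite /rho; have := nm_ge0 z1; have := normr_ge0 rho0; lra.
have hrho z : rho <= nm z -> nm (E z) < e / 2.
  move=> h; apply: hrho0; apply: le_trans h; rewrite /rho.
  by have := nm_ge0 z1; have := ler_norm rho0; lra.
(* On the square the perturbation is at most [e / 4]: too small to carry the maximum to [S], where
   [E] is zero, or beyond [rho], where [nm (E z) < e / 2]. *)
have [eps eps0 epsE] : exists2 eps, 0 < eps & eps * (2 * rho) ^+ 2 = e / 4.
  exists (e / (16 * rho ^+ 2)); last by field; rewrite gt_eqF.
  by rewrite divr_gt0// mulr_gt0// exprn_gt0.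
pose g z := nm (E z) + eps * nm z ^+ 2.
have gc a (d : R) : 0 < d -> exists2 d' : R, 0 < d' &
    forall t, nm (t - a) < d' -> `|g t - g a| < d.
  move=> d0.
  have k0 : 0 < 2 * nm a + 1 by have := nm_ge0 a; lra.
  have q0 : 0 < d / (2 * (eps * (2 * nm a + 1))) by apply: divr_gt0 => //; apply: mulr_gt0 => //; apply: mulr_gt0.
  have d20 : 0 < d / 2 by lra.
  have [d1 d10 h1] := (cont_nmP _ _).1 (Ec a) _ d20.
  exists (Num.min 1 (Num.min d1 (d / (2 * (eps * (2 * nm a + 1)))))).
    by rewrite !lt_min d10 q0 ltr01.
  move=> t; rewrite !lt_min => /and3P[t1 /h1 hE tq].
  have nta : `|nm t - nm a| <= nm (t - a).
    by rewrite ler_norml -[nm (t - a) as X in - X]nmBC lerNl opprB !nm_sub.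
  have Ea : `|nm (E t) - nm (E a)| <= nm (E t - E a).
    by rewrite ler_norml -[nm (E t - E a) as X in - X]nmBC lerNl opprB !nm_sub.
  rewrite /g (_ : _ - _ = (nm (E t) - nm (E a)) + eps * ((nm t - nm a) * (nm t + nm a))); last by ring.
  apply: le_lt_trans (ler_normD _ _) _; rewrite !normrM (gtr0_norm eps0).
  have s1 : `|nm t + nm a| <= 2 * nm a + 1.
    rewrite ger0_norm ?addr_ge0 ?nm_ge0//; have := nm_sub t a; lra.
  have : `|nm t - nm a| * `|nm t + nm a| <= nm (t - a) * (2 * nm a + 1).
    by apply: ler_pM.
  have : nm (t - a) * (2 * nm a + 1) * eps < d / 2.
    rewrite -ltr_pdivlMr// -ltr_pdivlMr//; apply: lt_le_trans tq _.
    by rewrite le_eqVlt; apply/orP; left; apply/eqP; field; rewrite !gt_eqF.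
  have := nm_ge0 (t - a); nra.
have [a a2 ga] := square_max (ltW rho_gt0) gc.
have gae : e <= g a.
  apply: le_trans (ga z1 _); last by rewrite /rho; have := normr_ge0 rho0; lra.
  have := sqr_ge0 (nm z1); rewrite /g -/e; nra.
have a4 : eps * nm a ^+ 2 <= e / 4.
  by rewrite -epsE ler_pM2l// lerXn2r ?nnegrE ?nm_ge0//; lra.
have alt : nm a < rho.
  by rewrite ltNge; apply/negP => /hrho; rewrite /g in gae; lra.
have aS : a \notin S.
  by apply/negP => /ES E0; move: gae; rewrite /g E0 nm0; lra.
have [d d0 hd] := four_point (ET _ aS) eps0.
pose r := Num.min (d / 2) (rho - nm a).
have r0 : 0 < r by rewrite lt_min; apply/andP; split; lra.
have rd : 0 < r < d by rewrite r0 gt_min; apply/orP; left; lra.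
have ra : nm a + r <= rho by have : r <= rho - nm a by [rewrite ge_min lexx orbT]; lra.
have H := hd r rd.
have nmr (u : C) : nm u = 1 -> nm (u * rc r) = r.
  by move=> u1; rewrite nmM u1 mul1r nm_rc gtr0_norm.
have nmi : nm ('i : C) = 1 by apply: rc_inj; rewrite -normE normCi.
have rr := nmr 1 (nm1 R); have ri := nmr 'i nmi; rewrite mul1r in rr.
have gle (w : C) : nm w = r -> g (a + w) <= g a /\ g (a - w) <= g a.
  by move=> wr; split; apply: ga; apply: le_trans (nmD _ _) _; rewrite ?nmN wr.
have [g1 g2] := gle _ rr; have [g3 g4] := gle _ ri.
have P1 := parallelogram a (rc r); have P2 := parallelogram a ('i * rc r).
rewrite rr in P1; rewrite ri in P2.
move: g1 g2 g3 g4 H P1 P2; rewrite /g.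
have := exprn_gt0 2 r0; have : 0 < eps * r ^+ 2 by rewrite mulr_gt0// exprn_gt0.
rewrite !mulr2n; nra.
Qed.

End Liouville.

(** * Functions of polynomial growth in one variable *)

Section OneVariable.
Variable R : realType.
Local Notation C := (Cplx R).

(** [E = D * h ^+ N], where [D] vanishes on [S], is continuous on [S] because [h] is locally
    bounded, and it still tends to zero at infinity; the maximum principle applies to it. *)
Lemma vanishing_at_infinity_eq0 (h : C -> C) (S : seq C) :
  (forall z, z \notin S -> taylor 2 z h) ->
  (forall rho : R, exists K : R, forall z, z \notin S -> nm z <= rho -> nm (h z) <= K) ->
  (exists K rho : R, forall z, z \notin S -> rho <= nm z -> nm (h z) * nm z <= K) ->
  forall z, z \notin S -> h z = 0.
Proof.
move=> hT hB [K0 [rho0 hG]].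
have [K K_ge0 leK] : exists2 K, 0 <= K & K0 <= K by exists `|K0|; rewrite ?ler_norm.
have {}hG z : z \notin S -> rho0 <= nm z -> nm (h z) * nm z <= K.
  by move=> zS /(hG _ zS) /le_trans; exact.
pose D := \prod_(s <- S) ('X - s%:P) : {poly C}.
have DE z : D.[z] = \prod_(s <- S) (z - s).
  by rewrite horner_prod; apply: eq_bigr => s _; rewrite hornerXsubC.
have D0 z : (D.[z] == 0) = (z \in S) by rewrite -root_prod_XsubC.
(* [D] has degree [size S] and [h] decays like [1 / z], so one power more than [size S] makes [E]
   decay. *)
pose N := (size S).+1; pose E z := D.[z] * h z ^+ N.
suff E0 : forall z, E z = 0.
  move=> z zS; have /eqP := E0 z.
  by rewrite mulf_eq0 D0 (negbTE zS) expf_eq0 /= => /eqP.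
have ES z : z \in S -> E z = 0 by rewrite -D0 /E => /eqP->; rewrite mul0r.
have ET z : z \notin S -> taylor 2 z E.
  by move=> zS; apply: taylorM; [exact: taylor_poly|apply: taylorX; exact: hT].
apply: (max_principle (S := S)) => //.
- move=> z; have [zS|zS] := boolP (z \in S); last exact: taylor_cont (ET _ zS).
  apply/cont_nmP => e e0; rewrite ES//.
  have [B hB1] := hB (nm z + 1).
  have B1 : 0 < `|B| ^+ N + 1 by rewrite ltr_wpDl// exprn_ge0.
  have e1 : 0 < e / (`|B| ^+ N + 1) by rewrite divr_gt0.
  have [d d0 hd] := (cont_nmP _ _).1 (taylor_cont (taylor_poly D 0 z)) _ e1.
  exists (Num.min d 1); first by rewrite lt_min d0 ltr01.
  move=> t; rewrite lt_min subr0 => /andP[/hd + t1].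
  have /eqP -> : D.[z] == 0 by rewrite D0.
  rewrite subr0 => hDt.
  have [/ES ->|tS] := boolP (t \in S); first by rewrite nm0.
  rewrite /E nmM nmX.
  have ht : nm (h t) <= `|B|.
    apply: le_trans (ler_norm _); apply: hB1 => //.
    by have := nm_sub t z; lra.
  have hN : nm (h t) ^+ N <= `|B| ^+ N by rewrite lerXn2r ?nnegrE ?nm_ge0.
  move: hDt; rewrite ltr_pdivlMr// mulrDr mulr1.
  have : nm D.[t] * nm (h t) ^+ N <= nm D.[t] * `|B| ^+ N by rewrite ler_wpM2l ?nm_ge0.
  by have := nm_ge0 D.[t]; lra.
- move=> e e0; pose sg := \sum_(s <- S) nm s.
  have sg0 : 0 <= sg by apply: sumr_ge0 => s _; exact: nm_ge0.
  have sgS s : s \in S -> nm s <= sg.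
    move=> sS; rewrite /sg (perm_big _ (perm_to_rem sS)) /= big_cons.
    by rewrite lerDl; apply: sumr_ge0 => ? _; exact: nm_ge0.
  pose Q := 2 ^+ size S * K ^+ N.
  have Q0 : 0 <= Q by rewrite mulr_ge0 ?exprn_ge0.
  exists (1 + sg + `|rho0| + Q / e) => z hz.
  have Qe : 0 <= Q / e by rewrite divr_ge0// ltW.
  have z1 : 0 < nm z by have := normr_ge0 rho0; lra.
  have zS : z \notin S by apply/negP => /sgS; have := normr_ge0 rho0; lra.
  have hK : nm (h z) * nm z <= K.
    by apply: hG => //; have := ler_norm rho0; lra.
  have DB : nm D.[z] <= (2 * nm z) ^+ size S.
    rewrite DE nm_prod; have := sgS; have zsg : sg <= nm z.
      by have := normr_ge0 rho0; lra.
    elim: (S) => [|s r IH] hS; first by rewrite big_nil expr0.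
    rewrite big_cons exprS ler_pM ?nm_ge0//.
    - by rewrite prodr_ge0// => i _; exact: nm_ge0.
    - have := nmD z (- s); rewrite nmN; have := hS s (mem_head _ _); lra.
    - by apply: IH => u ur; apply: hS; rewrite in_cons ur orbT.
  rewrite /E nmM nmX -(ltr_pM2r z1).
  have : nm D.[z] * nm (h z) ^+ N * nm z <= Q.
    apply: (@le_trans _ _ ((2 * nm z) ^+ size S * nm (h z) ^+ N * nm z)).
      by rewrite ler_wpM2r ?nm_ge0// ler_wpM2r// exprn_ge0 ?nm_ge0.
    rewrite /Q exprMn -!mulrA ler_wpM2l ?exprn_ge0// mulrCA -exprSr -exprMn.
    by rewrite lerXn2r// nnegrE ?mulr_ge0 ?nm_ge0.
  have : Q < e * nm z by rewrite mulrC -ltr_pdivrMr//; have := normr_ge0 rho0; lra.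
  lra.
Qed.

(** The divided difference at a point [a] lowers the growth by one degree. Its value at [a] is
    arbitrary, so [a] joins the exceptional set, near which boundedness is all that is asked. The
    factor [nm z] replaces the exponent [M - 1], which would be negative in the base case. *)
Lemma polynomial_growth_poly (M : nat) (h : C -> C) (S : seq C) :
  (forall z, z \notin S -> taylor 2 z h) ->
  (forall rho : R, exists K : R, forall z, z \notin S -> nm z <= rho -> nm (h z) <= K) ->
  (exists K rho : R, forall z, z \notin S -> rho <= nm z -> nm (h z) * nm z <= K * nm z ^+ M) ->
  exists2 p : {poly C}, (size p <= M)%N & forall z, z \notin S -> h z = p.[z].
Proof.
elim: M h S => [|M IH] h S hT hB [K [rho hG]].
  exists 0; first by rewrite size_poly0.
  move=> z zS; rewrite horner0; apply: (vanishing_at_infinity_eq0 hT hB _ zS).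
  by exists K, rho => t tS /(hG _ tS); rewrite expr0 mulr1.
have [a aS] := exists_notin S.
pose h1 z := (h z - h a) * (z - a)^-1.
have [|||p sp hp] := IH h1 (a :: S).
- move=> z; rewrite inE negb_or => /andP[za zS].
  apply: taylorM; first by apply: taylorB; [exact: hT|exact: taylor_cst].
  by apply: taylorV; [rewrite subr_eq0|exact: taylor_sub].
(* Near [a] the quotient is the coefficient [w] of the expansion of [h], which is continuous at [a];
   at distance at least [d] the divisor is bounded below. *)
- move=> r; have [B hB1] := hB r.
  have [c [w [tw nw]]] := taylorW (hT a aS).
  have cE := taylor_value (k := 0) nw tw.
  have [d1 d10 hd1] := (nearCP _ _).1 nw.
  have [d2 d20 hd2] := (cont_nmP _ _).1 tw 1 ltr01.
  pose d := Num.min d1 d2; have d0 : 0 < d by rewrite lt_min d10.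
  exists ((1 + nm (w a)) + (`|B| + nm (h a)) / d) => z.
  rewrite inE negb_or => /andP[za zS] zr.
  have za0 : z - a != 0 by rewrite subr_eq0.
  have q1 : 0 <= (`|B| + nm (h a)) / d by rewrite divr_ge0 ?addr_ge0 ?nm_ge0// ltW.
  have [zd|zd] := ltP (nm (z - a)) d.
    move: zd; rewrite lt_min => /andP[/hd1 E /hd2 F].
    rewrite /h1 E cE addrAC subrr add0r mulrAC divff// mul1r.
    by have := nm_sub (w z) (w a); lra.
  have hz : nm (h z) <= `|B| by apply: le_trans (ler_norm _); exact: hB1.
  rewrite /h1 nmM nmV ler_wpDl ?addr_ge0 ?nm_ge0//.
  rewrite ler_pM ?invr_ge0 ?nm_ge0//.
    by apply: le_trans (nmD _ _) _; rewrite nmN lerD2r.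
  by rewrite lef_pV2// posrE nm_gt0.
- exists (2 * (`|K| + nm (h a))), (1 + `|rho| + 2 * nm a) => z.
  rewrite inE negb_or => /andP[za zS] zr.
  have na := nm_ge0 a.
  have z1 : 1 <= nm z by have := normr_ge0 rho; lra.
  have zp : 0 < nm z by lra.
  have hz : nm (h z) <= `|K| * nm z ^+ M.
    rewrite -(ler_pM2r zp) -mulrA -exprSr.
    apply: le_trans (hG _ zS _) _; first by have := ler_norm rho; lra.
    by rewrite ler_wpM2r ?exprn_ge0 ?nm_ge0// ler_norm.
  have zM : 1 <= nm z ^+ M by rewrite exprn_ege1.
  have zap : 0 < nm (z - a) by rewrite nm_gt0 subr_eq0.
  have zah : nm z <= 2 * nm (z - a) by have := nm_sub z a; have := normr_ge0 rho; lra.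
  rewrite /h1 nmM nmV mulrAC ler_pdivrMr//.
  have hh : nm (h z - h a) <= (`|K| + nm (h a)) * nm z ^+ M.
    apply: le_trans (nmD _ _) _; rewrite nmN mulrDl lerD//.
    by rewrite ler_peMr ?nm_ge0.
  apply: (le_trans (ler_wpM2r (nm_ge0 z) hh)).
  rewrite (_ : 2 * _ * _ * _ = (`|K| + nm (h a)) * nm z ^+ M * (2 * nm (z - a))); last by ring.
  by rewrite ler_wpM2l// mulr_ge0 ?exprn_ge0 ?nm_ge0// addr_ge0 ?nm_ge0.
- exists (p * ('X - a%:P) + (h a)%:P).
    apply: leq_trans (size_polyD _ _) _; rewrite geq_max; apply/andP; split.
      by apply: leq_trans (size_polyMleq _ _) _; rewrite size_XsubC addn2.
    exact: leq_trans (size_polyC_leq1 _) _.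
  move=> z zS; rewrite !hornerE.
  have [->|za] := eqVneq z a; first by rewrite subrr mulr0 add0r.
  rewrite -hp; last by rewrite inE negb_or za.
  by rewrite /h1 mulfVK ?subr_eq0// subrK.
Qed.

End OneVariable.

(** * Polynomials in several variables *)

(** The locks keep unification from unfolding the evaluation morphisms. *)
HB.lock Definition pv (R : realType) n (p : mpoly n (Cplx R)) (x : 'rV[Cplx R]_n) : Cplx R :=
  peval p x.

HB.lock Definition psub (R : realType) m n (h : 'I_m -> mpoly n (Cplx R))
    (p : mpoly m (Cplx R)) : mpoly n (Cplx R) :=
  mmap (@mpolyC n (Cplx R)) h p.

(** The restriction of [p] to the line [z + t v], as a polynomial in [t]. *)
HB.lock Definition lin (R : realType) n (z v : 'rV[Cplx R]_n) (p : mpoly n (Cplx R)) :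
    {poly Cplx R} :=
  mmap (@polyC (Cplx R)) (fun i => (z ord0 i)%:P + v ord0 i *: 'X) p.

(** Specialization at a base point: a polynomial over [C[z]] becomes one over [C]. *)
HB.lock Definition spz (R : realType) n (z : 'rV[Cplx R]_n) (P : {poly mpoly n (Cplx R)}) :
    {poly Cplx R} :=
  map_poly (meval (fun i => z ord0 i)) P.

HB.lock Definition last_var (R : realType) n (p : mpoly n.+1 (Cplx R)) : {poly mpoly n (Cplx R)} :=
  mmap (@polyC (mpoly n (Cplx R)) \o @mpolyC n (Cplx R))
    (fun i => if unlift ord_max i is Some j then (mpolyX (Cplx R) (mnm1 j))%:P else 'X) p.

Section PolynomialFunctions.
Variable R : realType.
Local Notation C := (Cplx R).

Lemma mpoly_ring_ind n (P : mpoly n C -> Prop) :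
  (forall c, P (mpolyC n c)) -> (forall i, P (mpolyX C (mnm1 i))) ->
  (forall p q, P p -> P q -> P (p + q)) -> (forall p q, P p -> P q -> P (p * q)) ->
  forall p, P p.
Proof.
move=> hC hX hD hM; have P1 : P 1 by exact: hC.
elim/mpolyind => [|c m p _ _ IH]; first exact: hC 0.
apply: hD => //; rewrite -mul_mpolyC; apply: (hM); first exact: hC.
rewrite mpolyXE_id; apply: big_ind; [exact: P1|exact: (hM)|move=> i _].
by elim: (m i) => [|k IHk]; [rewrite expr0|rewrite exprS; apply: (hM)].
Qed.

Lemma pvD n (p q : mpoly n C) x : pv (p + q) x = pv p x + pv q x.
Proof. rewrite pv.unlock; exact: mevalD. Qed.
Lemma pvB n (p q : mpoly n C) x : pv (p - q) x = pv p x - pv q x.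
Proof. rewrite pv.unlock; exact: mevalB. Qed.
Lemma pvM n (p q : mpoly n C) x : pv (p * q) x = pv p x * pv q x.
Proof. rewrite pv.unlock; exact: mevalM. Qed.
Lemma pvXn n (p : mpoly n C) k x : pv (p ^+ k) x = pv p x ^+ k.
Proof. rewrite pv.unlock; exact: rmorphXn. Qed.
Lemma pv0 n (x : 'rV[C]_n) : pv 0 x = 0. Proof. rewrite pv.unlock; exact: meval0. Qed.
Lemma pv1 n (x : 'rV[C]_n) : pv 1 x = 1. Proof. rewrite pv.unlock; exact: meval1. Qed.
Lemma pvC n c (x : 'rV[C]_n) : pv (mpolyC n c) x = c. Proof. rewrite pv.unlock; exact: mevalC. Qed.
Lemma pvX n i (x : 'rV[C]_n) : pv (mpolyX C (mnm1 i)) x = x ord0 i.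
Proof. rewrite pv.unlock; exact: mevalXU. Qed.
Lemma pv_sum n (I : Type) (r : seq I) (F : I -> mpoly n C) x :
  pv (\sum_(i <- r) F i) x = \sum_(i <- r) pv (F i) x.
Proof. rewrite pv.unlock; exact: (rmorph_sum (meval _)). Qed.
Lemma pv_prod n (I : Type) (r : seq I) (F : I -> mpoly n C) x :
  pv (\prod_(i <- r) F i) x = \prod_(i <- r) pv (F i) x.
Proof. rewrite pv.unlock; exact: (rmorph_prod (meval _)). Qed.

Lemma psub_is_zmod m n (h : 'I_m -> mpoly n C) : additive (psub h).
Proof. by rewrite psub.unlock; exact: rmorphB. Qed.

Lemma psub_is_monoid m n (h : 'I_m -> mpoly n C) : multiplicative (psub h).
Proof. by rewrite psub.unlock; split; [exact: rmorphM|exact: rmorph1]. Qed.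

HB.instance Definition _ m n h :=
  GRing.isAdditive.Build (mpoly m C) (mpoly n C) (@psub R m n h) (psub_is_zmod h).
HB.instance Definition _ m n h :=
  GRing.isMultiplicative.Build (mpoly m C) (mpoly n C) (@psub R m n h) (psub_is_monoid h).

Definition pmap m n (h : 'I_m -> mpoly n C) (x : 'rV[C]_n) : 'rV[C]_m :=
  \row_i pv (h i) x.

Lemma psubC m n (h : 'I_m -> mpoly n C) c : psub h (mpolyC m c) = mpolyC n c.
Proof. by rewrite psub.unlock mmapC. Qed.

Lemma psubX m n (h : 'I_m -> mpoly n C) i : psub h (mpolyX C (mnm1 i)) = h i.
Proof. by rewrite psub.unlock mmapX mmap1U. Qed.

Lemma pv_psub m n (h : 'I_m -> mpoly n C) p x :
  pv (psub h p) x = pv p (pmap h x).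
Proof.
elim/mpoly_ring_ind: p => [c|i|p q hp hq|p q hp hq].
- by rewrite psubC !pvC.
- by rewrite psubX pvX mxE.
- by rewrite rmorphD !pvD hp hq.
- by rewrite rmorphM !pvM hp hq.
Qed.

Lemma lin_is_zmod n (z v : 'rV[C]_n) : additive (lin z v).
Proof. by rewrite lin.unlock; exact: rmorphB. Qed.

Lemma lin_is_monoid n (z v : 'rV[C]_n) : multiplicative (lin z v).
Proof. by rewrite lin.unlock; split; [exact: rmorphM|exact: rmorph1]. Qed.

HB.instance Definition _ n z v :=
  GRing.isAdditive.Build (mpoly n C) {poly C} (@lin R n z v) (lin_is_zmod z v).
HB.instance Definition _ n z v :=
  GRing.isMultiplicative.Build (mpoly n C) {poly C} (@lin R n z v) (lin_is_monoid z v).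

Lemma linC n (z v : 'rV[C]_n) c : lin z v (mpolyC n c) = c%:P.
Proof. by rewrite lin.unlock mmapC. Qed.

Lemma linX n (z v : 'rV[C]_n) i :
  lin z v (mpolyX C (mnm1 i)) = (z ord0 i)%:P + v ord0 i *: 'X.
Proof. by rewrite lin.unlock mmapX mmap1U. Qed.

Lemma lin_horner n (z v : 'rV[C]_n) p t : (lin z v p).[t] = pv p (z + t *: v).
Proof.
elim/mpoly_ring_ind: p => [c|i|p q hp hq|p q hp hq].
- by rewrite linC hornerC pvC.
- by rewrite linX pvX !hornerE !mxE mulrC.
- by rewrite rmorphD hornerD hp hq pvD.
- by rewrite rmorphM hornerM hp hq pvM.
Qed.

Lemma spz_is_zmod n (z : 'rV[C]_n) : additive (spz z).
Proof. by rewrite spz.unlock; exact: rmorphB. Qed.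

Lemma spz_is_monoid n (z : 'rV[C]_n) : multiplicative (spz z).
Proof. by rewrite spz.unlock; split; [exact: rmorphM|exact: rmorph1]. Qed.

HB.instance Definition _ n z :=
  GRing.isAdditive.Build {poly mpoly n C} {poly C} (@spz R n z) (spz_is_zmod z).
HB.instance Definition _ n z :=
  GRing.isMultiplicative.Build {poly mpoly n C} {poly C} (@spz R n z) (spz_is_monoid z).

Lemma spzD n (z : 'rV[C]_n) P Q : spz z (P + Q) = spz z P + spz z Q.
Proof. exact: rmorphD. Qed.
Lemma spzB n (z : 'rV[C]_n) P Q : spz z (P - Q) = spz z P - spz z Q.
Proof. exact: rmorphB. Qed.
Lemma spzN n (z : 'rV[C]_n) P : spz z (- P) = - spz z P.
Proof. exact: rmorphN. Qed.
Lemma spzM n (z : 'rV[C]_n) P Q : spz z (P * Q) = spz z P * spz z Q.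
Proof. exact: rmorphM. Qed.
Lemma spzC n (z : 'rV[C]_n) a : spz z a%:P = (pv a z)%:P.
Proof. rewrite spz.unlock ?pv.unlock; exact: map_polyC. Qed.
Lemma spzX n (z : 'rV[C]_n) : spz z 'X = 'X.
Proof. rewrite spz.unlock ?pv.unlock; exact: map_polyX. Qed.
Lemma spzZ n (z : 'rV[C]_n) a P : spz z (a *: P) = pv a z *: spz z P.
Proof. rewrite spz.unlock ?pv.unlock; exact: map_polyZ. Qed.
Lemma coef_spz n (z : 'rV[C]_n) P i : (spz z P)`_i = pv P`_i z.
Proof. rewrite spz.unlock ?pv.unlock; exact: coef_map. Qed.
Lemma deriv_spz n (z : 'rV[C]_n) P : (spz z P)^`() = spz z P^`().
Proof. rewrite spz.unlock ?pv.unlock; exact: deriv_map. Qed.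

Lemma lead_coef_spz n (z : 'rV[C]_n) P : pv (lead_coef P) z != 0 ->
  lead_coef (spz z P) = pv (lead_coef P) z.
Proof. rewrite spz.unlock ?pv.unlock; exact: lead_coef_map_eq. Qed.

Lemma size_spz n (z : 'rV[C]_n) P : pv (lead_coef P) z != 0 ->
  size (spz z P) = size P.
Proof. rewrite spz.unlock ?pv.unlock; exact: size_map_poly_id0. Qed.

Lemma size_spz_leq n (z : 'rV[C]_n) P : (size (spz z P) <= size P)%N.
Proof. rewrite spz.unlock ?pv.unlock; exact: size_poly. Qed.

Lemma monic_spz n (z : 'rV[C]_n) P : P \is monic -> spz z P \is monic.
Proof. rewrite spz.unlock ?pv.unlock; exact: monic_map. Qed.

(** Along a line, a polynomial over [C[z]] becomes one of the two-variable polynomials to which the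
    Taylor lemmas apply. *)
Lemma horner_lin2 n (z v : 'rV[C]_n) (P : {poly mpoly n C}) (s : {poly C}) t :
  (map_poly (lin z v) P).[s].[t] = (spz (z + t *: v) P).[s.[t]].
Proof.
elim/poly_ind: P => [|P c IH]; first by rewrite !rmorph0 !horner0.
rewrite !rmorphD !rmorphM /= map_polyX spzX map_polyC spzC !hornerE IH.
by rewrite lin_horner.
Qed.

Lemma last_varC n (c : C) : last_var (mpolyC n.+1 c) = (mpolyC n c)%:P.
Proof. by rewrite last_var.unlock mmapC. Qed.

Lemma last_varX n (i : 'I_n.+1) : last_var (mpolyX C (mnm1 i)) =
  (if unlift ord_max i is Some j then (mpolyX C (mnm1 j))%:P else 'X).
Proof. by rewrite last_var.unlock mmapX mmap1U. Qed.

Lemma last_varD n (p q : mpoly n.+1 C) : last_var (p + q) = last_var p + last_var q.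
Proof. by rewrite last_var.unlock; exact: rmorphD. Qed.

Lemma last_varM n (p q : mpoly n.+1 C) : last_var (p * q) = last_var p * last_var q.
Proof. by rewrite last_var.unlock; exact: rmorphM. Qed.

Lemma last_var_eq0 n (p : mpoly n.+1 C) : last_var p = 0 -> p = 0.
Proof.
pose h j : mpoly n.+1 C := mpolyX C (mnm1 (lift ord_max j)).
suff K q : (map_poly (psub h) (last_var q)).[mpolyX C (mnm1 ord_max)] = q.
  by move=> u0; rewrite -[p]K u0 rmorph0 horner0.
elim/mpoly_ring_ind: q => [c|i|q r hq hr|q r hq hr].
- by rewrite last_varC map_polyC hornerC /= psubC.
- rewrite last_varX; case: unliftP => [j ->|->].
    by rewrite map_polyC hornerC /= psubX.
  by rewrite map_polyX hornerX.
- by rewrite last_varD rmorphD hornerD hq hr.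
- by rewrite last_varM rmorphM hornerM hq hr.
Qed.

(** The last coordinate is chosen after the others, which avoid the zeros of the leading coefficient
    in the last variable. *)
Lemma pv_nonzero n (p : mpoly n C) : p != 0 -> exists x, pv p x != 0.
Proof.
elim: n p => [|n IH] p p0.
  exists 0; have [c E] : exists c, p = mpolyC 0 c.
    elim/mpoly_ring_ind: (p) => [c|[]//|q r [a ->] [b ->]|q r [a ->] [b ->]]; first by exists c.
      by exists (a + b); rewrite mpolyCD.
    by exists (a * b); rewrite mpolyCM.
  by move: p0; rewrite E pvC; apply: contra => /eqP->; rewrite mpolyC0.
have u0 : last_var p != 0 by apply: contra p0 => /eqP/last_var_eq0->.
have lc0 : lead_coef (last_var p) != 0 by rewrite lead_coef_eq0.
have [x hx] := IH _ lc0.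
have s0 : spz x (last_var p) != 0 by rewrite -lead_coef_eq0 lead_coef_spz.
have [c hc _] := poly_nonroot [::] s0.
pose y : 'rV[C]_n.+1 := \row_i if unlift ord_max i is Some j then x ord0 j else c.
exists y; suff <- : (spz x (last_var p)).[c] = pv p y by [].
elim/mpoly_ring_ind: (p) => [a|i|q r hq hr|q r hq hr].
- by rewrite last_varC spzC hornerC !pvC.
- rewrite last_varX pvX mxE; case: unliftP => [j _|_].
    by rewrite spzC hornerC pvX.
  by rewrite spzX hornerX.
- by rewrite last_varD rmorphD hornerD pvD hq hr.
- by rewrite last_varM rmorphM hornerM pvM hq hr.
Qed.

Definition nv n (z : 'rV[C]_n) : R := \sum_i nm (z ord0 i).

Lemma nv_ge0 n (z : 'rV[C]_n) : 0 <= nv z.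
Proof. by apply: sumr_ge0 => i _; exact: nm_ge0. Qed.

Lemma nm_le_nv n (z : 'rV[C]_n) i : nm (z ord0 i) <= nv z.
Proof.
rewrite /nv (bigD1 i)//= lerDl; apply: sumr_ge0 => j _; exact: nm_ge0.
Qed.

Lemma nv_line n (z v : 'rV[C]_n) t : nv (z + t *: v) <= nv z + nm t * nv v.
Proof.
rewrite /nv mulr_sumr -big_split /=; apply: ler_sum => i _.
by rewrite !mxE -nmM; exact: nmD.
Qed.

Lemma pv_growth n (p : mpoly n C) :
  exists2 K : R, 0 <= K & exists N, forall z, nm (pv p z) <= K * (1 + nv z) ^+ N.
Proof.
have ge1 (z : 'rV[C]_n) N : 1 <= (1 + nv z) ^+ N.
  by rewrite exprn_ege1// lerDl nv_ge0.
elim/mpoly_ring_ind: p => [c|i|p q [K K0 [N h]] [K' K'0 [N' h']]|p q [K K0 [N h]] [K' K'0 [N' h']]].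
- by exists (nm c); [exact: nm_ge0|exists 0%N => z; rewrite pvC expr0 mulr1].
- exists 1 => //; exists 1%N => z; rewrite pvX mul1r expr1.
  by have := nm_le_nv z i; lra.
- exists (K + K'); first exact: addr_ge0.
  exists (N + N')%N => z; rewrite pvD; apply: le_trans (nmD _ _) _.
  rewrite mulrDl lerD//.
    by apply: le_trans (h z) _; rewrite ler_wpM2l// exprD ler_peMr// exprn_ge0// addr_ge0// nv_ge0.
  by apply: le_trans (h' z) _; rewrite ler_wpM2l// exprD ler_peMl// exprn_ge0// addr_ge0// nv_ge0.
- exists (K * K'); first exact: mulr_ge0.
  exists (N + N')%N => z; rewrite pvM nmM exprD mulrACA.
  by rewrite ler_pM ?nm_ge0.
Qed.

Definition near_row n (d : R) (x y : 'rV[C]_n) := forall i, nm (y ord0 i - x ord0 i) < d.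

(** Functions are total on the ambient space and only continuity is relative to [X], so that passing
    to a closed subset of [X] changes no type. *)
Definition cont_on n (X : set 'rV[C]_n) (f : 'rV[C]_n -> C) :=
  forall x, X x -> forall e : R, 0 < e -> exists2 d : R, 0 < d &
    forall y, X y -> near_row d x y -> nm (f y - f x) < e.

Lemma near_row_min n (d d' : R) (x y : 'rV[C]_n) :
  near_row (Num.min d d') x y -> near_row d x y /\ near_row d' x y.
Proof. by move=> h; split=> i; have := h i; rewrite lt_min => /andP[]. Qed.

Lemma cont_onD n (X : set 'rV[C]_n) f g : cont_on X f -> cont_on X g ->
  cont_on X (fun x => f x + g x).
Proof.
move=> hf hg x Xx e e0.
have e20 : 0 < e / 2 by lra.
have [d d0 h] := hf x Xx _ e20; have [d' d'0 h'] := hg x Xx _ e20.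
exists (Num.min d d'); first by rewrite lt_min d0.
move=> y Xy /near_row_min[yd yd'].
rewrite (_ : _ - _ = (f y - f x) + (g y - g x)); last by ring.
have := nmD (f y - f x) (g y - g x); have := h y Xy yd; have := h' y Xy yd'.
by lra.
Qed.

Lemma cont_onM n (X : set 'rV[C]_n) f g : cont_on X f -> cont_on X g ->
  cont_on X (fun x => f x * g x).
Proof.
move=> hf hg x Xx e e0; pose A := nm (f x) + nm (g x) + 1.
have A1 : 1 <= A by rewrite /A; have := nm_ge0 (f x); have := nm_ge0 (g x); lra.
have eA : 0 < Num.min 1 (e / (2 * A)) by rewrite lt_min ltr01/= divr_gt0//; lra.
have [d d0 h] := hf x Xx _ eA; have [d' d'0 h'] := hg x Xx _ eA.
exists (Num.min d d'); first by rewrite lt_min d0.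
move=> y Xy /near_row_min[yd yd'].
rewrite (_ : _ - _ = (f y - f x) * (g y - g x) +
  ((f y - f x) * g x + f x * (g y - g x))); last by ring.
set u := f y - f x; set w := g y - g x.
have := h y Xy yd; have := h' y Xy yd'; rewrite -/u -/w !lt_min => /andP[w1 w2] /andP[u1 u2].
have := nmD (u * w) (u * g x + f x * w).
have := nmD (u * g x) (f x * w).
rewrite !nmM; have A0 : 0 < 2 * A by lra.
move: w2 u2; rewrite !ltr_pdivlMr// /A.
have := nm_ge0 u; have := nm_ge0 w; have := nm_ge0 (f x); have := nm_ge0 (g x).
by nra.
Qed.

Lemma cont_on_pv n (X : set 'rV[C]_n) (p : mpoly n C) : cont_on X (pv p).
Proof.
elim/mpoly_ring_ind: p => [c|i|p q hp hq|p q hp hq].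
- by move=> x _ e e0; exists 1 => // y _ _; rewrite !pvC subrr nm0.
- by move=> x _ e e0; exists e => // y _ /(_ i); rewrite !pvX.
- by have := cont_onD hp hq; congr (cont_on _ _); apply/funext => x; rewrite pvD.
- by have := cont_onM hp hq; congr (cont_on _ _); apply/funext => x; rewrite pvM.
Qed.

Lemma pv_cont n (p : mpoly n C) x (e : R) : 0 < e -> exists2 d, 0 < d &
  forall y, near_row d x y -> nm (pv p y - pv p x) < e.
Proof.
by move=> e0; have [d d0 h] := @cont_on_pv n setT p x I e e0; exists d => // y; exact: h.
Qed.

(** On the line joining [z] to a point where [p] is nonzero, [p] has finitely many zeros. *)
Lemma pv_dense n (p : mpoly n C) z (d : R) : p != 0 -> 0 < d ->
  exists2 y, near_row d z y & pv p y != 0.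
Proof.
move=> /pv_nonzero[z1 pz1] d0.
have l0 : lin z (z1 - z) p != 0.
  apply: contra pz1 => /eqP l0; have := lin_horner z (z1 - z) p 1.
  by rewrite l0 horner0 scale1r addrC subrK => <-.
have n0 : 0 < 1 + nv (z1 - z) by have := nv_ge0 (z1 - z); lra.
have [t ht pt] := poly_small_nonroot l0 (divr_gt0 d0 n0).
exists (z + t *: (z1 - z)); last by rewrite -lin_horner.
move=> i; rewrite 2!mxE addrAC subrr add0r nmM.
move: ht; rewrite ltr_pdivlMr//.
rewrite mulrDr mulr1; have := ler_wpM2l (nm_ge0 t) (nm_le_nv (z1 - z) i).
by have := nm_ge0 t; lra.
Qed.

End PolynomialFunctions.

(** * From polynomials on lines to polynomials in several variables *)

Section SeveralVariables.
Variable R : realType.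
Local Notation C := (Cplx R).

Lemma nonroot_sequence (p : {poly C}) : p != 0 ->
  exists2 x : nat -> C, injective x & forall k, p.[x k] != 0.
Proof.
move=> /poly_large[c c0 [rho h]]; exists (fun k => rc (`|rho| + k%:R)).
  by move=> i j /rc_inj/addrI/eqP; rewrite eqr_nat => /eqP.
move=> k; rewrite -nm_gt0; apply: lt_le_trans c0 (h _ _).
rewrite nm_rc ger0_norm ?addr_ge0//; apply: le_trans (ler_norm _) _.
by rewrite lerDl.
Qed.

Definition generic_poly d (g : 'rV[C]_d -> C) :=
  exists H q : mpoly d C, q != 0 /\ forall z, pv q z != 0 -> g z = pv H z.

Lemma generic_polyD d (f g : 'rV[C]_d -> C) : generic_poly f -> generic_poly g ->
  generic_poly (fun z => f z + g z).
Proof.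
move=> [F [p [p0 hF]]] [G [q [q0 hG]]]; exists (F + G), (p * q).
rewrite mulf_neq0//; split => // z; rewrite pvM mulf_eq0 negb_or => /andP[pz qz].
by rewrite pvD hF// hG.
Qed.

Lemma generic_polyM d (f : 'rV[C]_d -> C) (G : mpoly d C) : generic_poly f ->
  generic_poly (fun z => f z * pv G z).
Proof.
by move=> [F [p [p0 hF]]]; exists (F * G), p; split => // z pz; rewrite pvM hF.
Qed.

Lemma generic_poly_sum d (I : Type) (r : seq I) (F : I -> 'rV[C]_d -> C) :
  (forall i, generic_poly (F i)) -> generic_poly (fun z => \sum_(i <- r) F i z).
Proof.
move=> h; elim: r => [|i r IH].
  by exists 0, 1; rewrite oner_neq0; split => // z _; rewrite big_nil pv0.
have [H [q [q0 hH]]] := generic_polyD (h i) IH.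
by exists H, q; split => // z qz; rewrite big_cons; exact: hH.
Qed.

Lemma generic_poly_eq d (f g : 'rV[C]_d -> C) (q : mpoly d C) : q != 0 ->
  (forall z, pv q z != 0 -> f z = g z) -> generic_poly g -> generic_poly f.
Proof.
move=> q0 fg [H [p [p0 hH]]]; exists H, (p * q); rewrite mulf_neq0//; split => // z.
by rewrite pvM mulf_eq0 negb_or => /andP[pz qz]; rewrite fg// hH.
Qed.

Definition coord_poly d (k : 'I_d) (L : {poly C}) : mpoly d C :=
  \sum_(i < size L) mpolyC d L`_i * mpolyX C (mnm1 k) ^+ i.

Lemma pv_coord_poly d (k : 'I_d) L z : pv (coord_poly k L) z = L.[z ord0 k].
Proof.
rewrite /coord_poly pv_sum horner_coef; apply: eq_bigr => i _.
by rewrite pvM pvC pvXn pvX.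
Qed.

Definition freeze d (k : nat) (c : 'rV[C]_d) (i : 'I_d) : mpoly d C :=
  if (i < k)%N then mpolyX C (mnm1 i) else mpolyC d (c ord0 i).

Lemma pmap_freeze d k (c : 'rV[C]_d) z :
  pmap (freeze k c) z = \row_i (if (i < k)%N then z ord0 i else c ord0 i).
Proof. by apply/rowP => i; rewrite !mxE /freeze; case: ifP; rewrite ?pvX ?pvC. Qed.

(* The variables are released one at a time, by interpolation along coordinate lines *)
Lemma generic_poly_lines d (h : 'rV[C]_d -> C) (q : mpoly d C) (M : nat) : q != 0 ->
  (forall z v, exists2 p : {poly C}, (size p <= M)%N &
     forall t, pv q (z + t *: v) != 0 -> h (z + t *: v) = p.[t]) ->
  generic_poly h.
Proof.
move=> q0 hline.
suff claim k (c : 'rV[C]_d) : (k <= d)%N -> psub (freeze k c) q != 0 ->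
    generic_poly (fun z => h (pmap (freeze k c) z)).
  have E (z : 'rV[C]_d) : pmap (freeze d 0) z = z.
    by rewrite pmap_freeze; apply/rowP => i; rewrite mxE ltn_ord.
  have [|H [p [p0 hp]]] := claim d 0 (leqnn d).
    by have [z hz] := pv_nonzero q0; apply: contra hz => /eqP s0; rewrite -[z]E -pv_psub s0 pv0.
  by exists H, p; split => // z /hp; rewrite E.
elim: k c => [|k IH] c kd.
  move=> _; exists (mpolyC d (h c)), 1; rewrite oner_neq0; split => // z _.
  by rewrite pvC pmap_freeze; congr h; apply/rowP => i; rewrite mxE.
pose K : 'I_d := Ordinal kd.
pose sub (t : C) : 'rV[C]_d := \row_i (if i == K then t else c ord0 i).
pose e : 'rV[C]_d := delta_mx ord0 K.
have moveE z t : pmap (freeze k.+1 c) z + (t - z ord0 K) *: e = pmap (freeze k (sub t)) z.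
  rewrite !pmap_freeze; apply/rowP => i; rewrite !mxE eqxx /= ltnS.
  have [iK|iK] := eqVneq i K.
    by rewrite iK /= leqnn ltnn mulr1 addrC subrK.
  have -> : (i <= k)%N = (i < k)%N.
    by rewrite leq_eqVlt; case: eqVneq => // E; case/eqP: iK; exact/val_inj.
  by rewrite mulr0 addr0.
move=> /pv_nonzero[zs]; rewrite pv_psub => hzs.
(* [l] is [q] as a function of the coordinate [K] alone, the earlier coordinates being those of [zs]
   and the later ones those of [c]. At a nonroot of [l], freezing [K] leaves [q] a nonzero
   polynomial. *)
pose l := lin (pmap (freeze k.+1 c) zs - zs ord0 K *: e) e q.
have lE t : l.[t] = pv q (pmap (freeze k (sub t)) zs).
  by rewrite lin_horner -moveE scalerBl addrAC -addrA.
have l0 : l != 0.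
  apply: contra hzs => /eqP l0; have := lE (zs ord0 K).
  by rewrite l0 horner0 -moveE subrr scale0r addr0 => <-.
have [x xinj hx] := nonroot_sequence l0.
(* One node more than [M], so that there is a node even when [M = 0]. *)
have Hi (i : 'I_M.+1) : generic_poly (fun z => h (pmap (freeze k (sub (x i))) z)).
  apply: IH; first exact: ltnW.
  by apply: contra (hx i) => /eqP s0; rewrite lE -pv_psub s0 pv0.
apply: (@generic_poly_eq d _
  (fun z => \sum_(i < M.+1) h (pmap (freeze k (sub (x i))) z) *
     pv (coord_poly K (tnth (M.+1.-lagrange x) i)) z)
  (psub (freeze k.+1 c) q * \prod_(i < M.+1) psub (freeze k (sub (x i))) q)).
- rewrite mulf_neq0//.
    by apply: contra hzs => /eqP s0; rewrite -pv_psub s0 pv0.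
  apply/prodf_neq0 => i _.
  by apply: contra (hx i) => /eqP s0; rewrite lE -pv_psub s0 pv0.
- move=> z; rewrite pvM mulf_eq0 negb_or pv_psub => /andP[qz].
  rewrite pv_prod => /prodf_neq0 qi.
  have [p sp hp] := hline (pmap (freeze k.+1 c) z) e.
  pose p' := p \Po ('X - (z ord0 K)%:P).
  have p'E t : p'.[t] = p.[t - z ord0 K] by rewrite horner_comp hornerXsubC.
  have sp' : (size p' <= M.+1)%N.
    by rewrite size_comp_poly2 ?size_XsubC// ltnW.
  have -> : h (pmap (freeze k.+1 c) z) = p'.[z ord0 K].
    by rewrite p'E subrr -hp scale0r addr0.
  rewrite (lagrange_gen (ltn0Sn M) xinj sp') horner_sum; apply: eq_bigr => i _.
  rewrite hornerM hornerC pv_coord_poly p'E -hp moveE//.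
  by rewrite -pv_psub; exact: qi.
- by apply: generic_poly_sum => i; exact: generic_polyM.
Qed.

End SeveralVariables.

(** * Algebraic and integral functions *)

Section MinimalPolynomial.
Variable R : realType.
Local Notation C := (Cplx R).
Variables (d : nat) (T : Type) (z : T -> 'rV[C]_d).
Implicit Types (b : T -> C) (P F : {poly mpoly d C}).

(** [T] is any family of points over the base: [X] itself, or [X] with parameters adjoined. *)
Definition kills b P := forall x, (spz (z x) P).[b x] = 0.

Definition algebraic b := exists2 P, P != 0 & kills b P.

Definition minimal_killer b F :=
  [/\ F != 0, kills b F & forall P, kills b P -> P != 0 -> (size F <= size P)%N].

Lemma killsZ b a P : (forall x, pv a (z x) != 0 -> (spz (z x) P).[b x] = 0) ->
  kills b (a *: P).
Proof.
move=> h x; rewrite spzZ hornerZ; have [->|/h->] := eqVneq (pv a (z x)) 0.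
  by rewrite mul0r.
by rewrite mulr0.
Qed.

Lemma killsMl b P F : kills b F -> kills b (P * F).
Proof. by move=> h x; rewrite spzM hornerM h mulr0. Qed.

Lemma killsB b P F : kills b P -> kills b F -> kills b (P - F).
Proof. by move=> hP hF x; rewrite spzB hornerD hornerN hP hF subrr. Qed.

Lemma minimal_killer_exists b : algebraic b -> exists F, minimal_killer b F.
Proof.
move=> [P0 P00 kP0].
have ex : exists k, `[< exists F, [/\ F != 0, kills b F & size F = k] >].
  by exists (size P0); apply/asboolP; exists P0.
case: (ex_minnP ex) => k /asboolP[F [F0 kF sF]] kmin.
exists F; split => // P kP P0'; rewrite sF; apply: kmin; apply/asboolP.
by exists P.
Qed.

(** Pseudo-division by [F]: [a] times the remainder is killed and shorter than [F], hence zero. The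
    factor [a] serves when [P] is known to vanish only off a hypersurface of the base. *)
Lemma minimal_killer_dvd b F (a : mpoly d C) P : minimal_killer b F ->
  a != 0 -> kills b (a *: P) -> exists k Q, lead_coef F ^+ k *: P = Q * F.
Proof.
move=> [F0 kF Fmin] a0 kP; exists (scalp P F), (P %/ F).
have E := Pdiv.Idomain.divp_eq P F.
suff r0 : P %% F = 0 by rewrite E r0 addr0.
apply/eqP; apply: contraT => r0.
have kr : kills b (a *: (P %% F)).
  have -> : a *: (P %% F) = lead_coef F ^+ scalp P F *: (a *: P) - (a *: (P %/ F)) * F.
    by rewrite scalerA mulrC -scalerA E scalerDr -scalerAl addrC addKr.
  by apply: killsB; [apply: killsZ => x _; exact: kP|exact: killsMl].
have := Fmin _ kr; rewrite scale_poly_eq0 negb_or a0 r0 => /(_ isT).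
by rewrite size_scale// leqNgt ltn_modp F0.
Qed.

(* A multiple root of [F] at [b x] would be a root of the cofactor of [gcd (F, F')],
   which has smaller degree *)
Lemma minimal_killer_separable b F : minimal_killer b F ->
  exists U V (delta : mpoly d C), delta != 0 /\ U * F + V * F^`() = delta%:P.
Proof.
move=> [F0 kF Fmin]; set D := gcdp F F^`().
have D0 : D != 0 by rewrite gcdp_eq0 negb_and F0.
have [sD|sD] := leqP (size D) 1.
  have [[U V]] := Bezoutp F F^`(); rewrite -/D => /eqpP[[c1 c2] /= /andP[c10 c20] E].
  have DE := size1_polyC sD; exists (c1 *: U), (c1 *: V), (c2 * D`_0).
  split; first by rewrite mulf_neq0// -polyC_eq0 -DE.
  by rewrite -!scalerAl -scalerDr E {1}DE -mul_polyC -polyCM.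
have [c [H [c0 cF]]] : exists (c : mpoly d C) (H : {poly mpoly d C}), c != 0 /\ c *: F = H * D.
  by have /Pdiv.Idomain.dvdpP[[c H] c0 cF] := dvdp_gcdl F F^`(); exists c, H.
have [c' [E [c'0 cF']]] : exists (c : mpoly d C) (H : {poly mpoly d C}),
    c != 0 /\ c *: F^`() = H * D.
  by have /Pdiv.Idomain.dvdpP[[c' H'] c0' cF'] := dvdp_gcdr F F^`(); exists c', H'.
have H0 : H != 0.
  apply: contra F0 => /eqP H0; move/eqP: cF; rewrite H0 mul0r scale_poly_eq0 (negbTE c0).
  by [].
have sH : (size H < size F)%N.
  have := f_equal (fun p : {poly mpoly d C} => size p) cF.
  rewrite size_scale// size_mul// => ->.
  by case: (size D) sD => [|[|k]]// _; rewrite !addnS /= ltnS leq_addr.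
pose a := c * c' * lead_coef F.
have a0 : a != 0 by rewrite !mulf_neq0// lead_coef_eq0.
have : (size F <= size (a *: H))%N.
  apply: Fmin; last by rewrite scale_poly_eq0 negb_or a0.
  apply: killsZ => x; rewrite !pvM !mulf_eq0 !negb_or -andbA => /and3P[cx c'x lx].
  set t := b x; apply/eqP; apply: contraT => Ht.
  have e1 : pv c (z x) *: spz (z x) F = spz (z x) H * spz (z x) D.
    by rewrite -spzZ cF spzM.
  have e2 : pv c' (z x) *: (spz (z x) F)^`() = spz (z x) E * spz (z x) D.
    by rewrite deriv_spz -spzZ cF' spzM.
  have Fx : spz (z x) F != 0 by rewrite -lead_coef_eq0 lead_coef_spz.
  have Dx : spz (z x) D != 0.
    apply: contra Fx => /eqP Dx; move/eqP: e1; rewrite Dx mulr0 scale_poly_eq0 (negbTE cx).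
    by [].
  have Dt : (spz (z x) D).[t] = 0.
    have /eqP := congr1 (horner^~ t) e1; rewrite /= hornerZ hornerM kF mulr0 eq_sym.
    by rewrite mulf_eq0 (negbTE Ht) => /eqP.
  (* A root [t] of [D] of multiplicity [m > 0] that is not a root of [H] has multiplicity [m] in
     [F], hence only [m - 1] in its derivative, in characteristic zero; but [D] divides both up to
     nonzero constants. *)
  have [k [D1 /implyP/(_ Dx) D1t DE]] := multiplicity_XsubC (spz (z x) D) t.
  case: k DE => [|k] DE.
    by move: D1t; rewrite /root; move: Dt; rewrite DE expr0 mulr1 => ->; rewrite eqxx.
  set Y := 'X - t%:P in DE.
  have Y0 : Y ^+ k != 0 by rewrite expf_neq0// polyXsubC_eq0.
  have key : pv c (z x) *: (spz (z x) E * spz (z x) D) =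
     pv c' (z x) *: ((spz (z x) H)^`() * spz (z x) D + spz (z x) H * (spz (z x) D)^`()).
    by rewrite -derivM -e1 -e2 derivZ !scalerA mulrC.
  have := key; rewrite DE derivM deriv_exp derivXsubC mul1r /= exprS.
  set Ex := spz (z x) E; set Hx := spz (z x) H => key'.
  have {key'} : Y ^+ k * (Y * (pv c (z x) *: (Ex * D1) - pv c' (z x) *: (Hx^`() * D1)
      - pv c' (z x) *: (Hx * D1^`()))) = Y ^+ k * (pv c' (z x) *: (Hx * D1) *+ k.+1).
    rewrite -!mul_polyC in key' *; rewrite -mulr_natl in key' *.
    by ring: key'.
  move=> /(mulfI Y0)/(congr1 (horner^~ t)).
  rewrite /= hornerM hornerXsubC subrr mul0r hornerMn hornerZ hornerM => /esym/eqP.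
  rewrite mulrn_eq0 /= !mulf_eq0 (negbTE c'x) (negbTE Ht) /=.
  by move: D1t; rewrite /root => /negbTE ->.
by rewrite leqNgt (leq_ltn_trans (size_scale_leq _ _) sH).
Qed.

End MinimalPolynomial.

(** * Integral functions, finite projections and Noether normalization *)

Section Integrality.
Variable R : realType.
Local Notation C := (Cplx R).

Definition integral_on (T : Type) d (X : set T) (z : T -> 'rV[C]_d) (b : T -> C) :=
  exists2 P : {poly mpoly d C}, P \is monic & forall x, X x -> (spz (z x) P).[b x] = 0.

Section Transfer.
Variables (T : pointedType) (d : nat) (X : set T) (x0 : T) (Xx0 : X x0).

(** Retracting [T] onto [X] turns identities on [X] into identities in the ring [T -> C], where the
    closure properties of integral elements are available. *)
Let r x := if `[< X x >] then x else x0.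
Let Xr x : X (r x). Proof. by rewrite /r; case: asboolP. Qed.
Let rX x : X x -> r x = x. Proof. by rewrite /r => /asboolP ->. Qed.

Definition ev_fun (w : T -> 'rV[C]_d) (a : mpoly d C) : T -> C := fun x => pv a (w x).

Lemma ev_fun_is_zmod w : additive (ev_fun w).
Proof. by move=> a b; apply/funext => x; rewrite /ev_fun pvB. Qed.

Lemma ev_fun_is_monoid w : multiplicative (ev_fun w).
Proof.
by split=> [a b|]; apply/funext => x; rewrite /ev_fun ?pvM ?pv1.
Qed.

HB.instance Definition _ w :=
  GRing.isAdditive.Build (mpoly d C) (T -> C) (ev_fun w) (ev_fun_is_zmod w).
HB.instance Definition _ w :=
  GRing.isMultiplicative.Build (mpoly d C) (T -> C) (ev_fun w) (ev_fun_is_monoid w).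

Lemma horner_ev_fun w P (b : T -> C) x : (map_poly (ev_fun w) P).[b] x = (spz (w x) P).[b x].
Proof.
elim/poly_ind: P => [|P c IH]; first by rewrite !rmorph0 !horner0.
rewrite !rmorphD !rmorphM /= map_polyX spzX map_polyC spzC !hornerE.
by rewrite -IH.
Qed.

Lemma integral_onE z b : integral_on X z b <-> integralOver (ev_fun (z \o r)) (b \o r).
Proof.
split=> [[P Pm h]|[P Pm /rootP h]]; exists P => //.
  by apply/rootP/funext => x; rewrite horner_ev_fun h.
move=> x Xx; have := congr1 (@^~ x) h.
by rewrite /= horner_ev_fun /= rX.
Qed.
End Transfer.

Section Closure.
Variables (T : pointedType) (X : set T).

Let trivial_on d (z : T -> 'rV[C]_d) b : X = set0 -> integral_on X z b.
Proof. by move=> ->; exists 1; [exact: monic1|]. Qed.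

Lemma integral_on_add d (z : T -> 'rV[C]_d) f g :
  integral_on X z f -> integral_on X z g -> integral_on X z (fun x => f x + g x).
Proof.
have [/trivial_on h _ _|/set0P[x0 Xx0]] := eqVneq X set0; first exact: h.
by move=> /(integral_onE Xx0) hf /(integral_onE Xx0) hg; apply/(integral_onE Xx0)/integral_add.
Qed.

Lemma integral_on_mul d (z : T -> 'rV[C]_d) f g :
  integral_on X z f -> integral_on X z g -> integral_on X z (fun x => f x * g x).
Proof.
have [/trivial_on h _ _|/set0P[x0 Xx0]] := eqVneq X set0; first exact: h.
by move=> /(integral_onE Xx0) hf /(integral_onE Xx0) hg; apply/(integral_onE Xx0)/integral_mul.
Qed.

Lemma integral_on_base d (z : T -> 'rV[C]_d) (a : mpoly d C) :
  integral_on X z (fun x => pv a (z x)).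
Proof.
exists ('X - a%:P); first exact: monicXsubC.
by move=> x _; rewrite spzB spzX spzC hornerXsubC subrr.
Qed.

Lemma integral_on_cst d (z : T -> 'rV[C]_d) c : integral_on X z (fun=> c).
Proof.
have [P Pm h] := integral_on_base z (mpolyC d c); exists P => // x /h.
by rewrite pvC.
Qed.

Lemma integral_on_eq d (z : T -> 'rV[C]_d) f g : (forall x, X x -> f x = g x) ->
  integral_on X z f -> integral_on X z g.
Proof. by move=> fg [P Pm h]; exists P => // x Xx; rewrite -fg// h. Qed.

Lemma integral_on_sum d (z : T -> 'rV[C]_d) (I : Type) (s : seq I) (F : I -> T -> C) :
  (forall i, integral_on X z (F i)) -> integral_on X z (fun x => \sum_(i <- s) F i x).
Proof.
move=> h; elim: s => [|i s IH].
  by apply: (integral_on_eq (f := fun=> 0)) (integral_on_cst _ _) => x _; rewrite big_nil.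
apply: integral_on_eq (integral_on_add (h i) IH) => x _.
by rewrite big_cons.
Qed.

Lemma integral_on_poly d e (z : T -> 'rV[C]_d) (w : T -> 'rV[C]_e) (p : mpoly e C) :
  (forall i, integral_on X z (fun x => w x ord0 i)) -> integral_on X z (fun x => pv p (w x)).
Proof.
move=> h; elim/mpoly_ring_ind: p => [c|i|p q hp hq|p q hp hq].
- by apply: integral_on_eq (integral_on_cst z c) => x _; rewrite pvC.
- by apply: integral_on_eq (h i) => x _; rewrite pvX.
- by apply: integral_on_eq (integral_on_add hp hq) => x _; rewrite pvD.
- by apply: integral_on_eq (integral_on_mul hp hq) => x _; rewrite pvM.
Qed.

Lemma integral_on_trans d e (z : T -> 'rV[C]_d) (w : T -> 'rV[C]_e) b :
  (forall i, integral_on X z (fun x => w x ord0 i)) -> integral_on X w b ->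
  integral_on X z b.
Proof.
move=> hw; have [/trivial_on h _|/set0P[x0 Xx0]] := eqVneq X set0; first exact: h.
move=> /(integral_onE Xx0)[P Pm Pb]; apply/(integral_onE Xx0).
apply: (integral_root_monic (monic_map _ Pm) Pb) => c /(nthP 0)[i _ <-].
rewrite coef_map; have /(integral_onE Xx0) := integral_on_poly P`_i hw.
by [].
Qed.

End Closure.

Definition finite_over n d (X : set 'rV[C]_n) (zt : 'I_d -> mpoly n C) :=
  forall i, integral_on X (pmap zt) (fun x => x ord0 i).

Lemma finite_over_poly n d X (zt : 'I_d -> mpoly n C) p : finite_over X zt ->
  integral_on X (pmap zt) (fun x => pv p x).
Proof. by move=> h; apply: (integral_on_poly (w := id)). Qed.

Lemma finite_over_sub n d (X Y : set 'rV[C]_n) (zt : 'I_d -> mpoly n C) :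
  Y `<=` X -> finite_over X zt -> finite_over Y zt.
Proof. by move=> YX h i; have [P Pm hP] := h i; exists P => // x /YX/hP. Qed.

(** [be] may vanish, so products and sums of top coefficients raise no question of actual
    degrees. *)
Definition top_coef d k (Q : {poly mpoly d C}) (be : mpoly d C) :=
  exists2 Q1 : {poly mpoly d C}, (size Q1 <= k)%N & Q = be *: 'X^k + Q1.

Lemma top_coefM d k k' (Q Q' : {poly mpoly d C}) be be' :
  top_coef k Q be -> top_coef k' Q' be' -> top_coef (k + k') (Q * Q') (be * be').
Proof.
move=> [Q1 s1 ->] [Q1' s1' ->].
exists (be *: 'X^k * Q1' + Q1 * (be' *: 'X^k' + Q1')).
  have sX (j : nat) (g : mpoly d C) : (size (g *: 'X^j : {poly mpoly d C}) <= j.+1)%N.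
    by apply: leq_trans (size_scale_leq _ _) _; rewrite size_polyXn.
  apply: leq_trans (size_polyD _ _) _; rewrite geq_max; apply/andP; split.
    apply: leq_trans (size_polyMleq _ _) _; rewrite -subn1 leq_subLR add1n -addSn.
    by apply: leq_add.
  apply: leq_trans (size_polyMleq _ _) _; rewrite -subn1 leq_subLR add1n -addnS.
  apply: leq_add => //; apply: leq_trans (size_polyD _ _) _.
  by rewrite geq_max sX ltnW.
by rewrite mulrDl -!mul_polyC exprD polyCM; ring.
Qed.

Lemma top_coefX d k (Q : {poly mpoly d C}) be m : top_coef k Q be ->
  top_coef (k * m) (Q ^+ m) (be ^+ m).
Proof.
move=> h; elim: m => [|m IH].
  by exists 0; rewrite ?size_poly0// !expr0 muln0 expr0 scale1r addr0.
by rewrite mulnS !exprS; exact: top_coefM.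
Qed.

Lemma top_coef_prod d (I : Type) (s : seq I) (k : I -> nat) (Q : I -> {poly mpoly d C}) be :
  (forall i, top_coef (k i) (Q i) (be i)) ->
  top_coef (\sum_(i <- s) k i)%N (\prod_(i <- s) Q i) (\prod_(i <- s) be i).
Proof.
move=> h; elim: s => [|i s IH].
  by exists 0; rewrite ?size_poly0// !big_nil expr0 scale1r addr0.
by rewrite !big_cons; exact: top_coefM.
Qed.

(* Noether normalization: [v] is a direction in which [a] is monic up to a constant,
   and [psi] is the linear projection along [v] *)
Lemma noether_projection d (a : mpoly d.+1 C) : a != 0 ->
  exists psi : 'I_d -> mpoly d.+1 C, forall i,
    integral_on [set y | pv a y = 0] (pmap psi) (fun y => y ord0 i).
Proof.
move=> a0; pose D := mdeg (mlead a).
pose top := \sum_(m <- msupp a | mdeg m == D) mcoeff m a *: mpolyX C m.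
have top0 : top != 0.
  apply: contra_neq (a0) => /(congr1 (mcoeff (mlead a))).
  rewrite mcoeff0 /top raddf_sum /= big_mkcond /= (bigD1_seq (mlead a)) ?msupp_uniq ?mlead_supp//=.
  rewrite eqxx big1 => [|m mn]; last first.
    by case: ifP => // _; rewrite mcoeffZ mcoeffX (negbTE mn) mulr0.
  by rewrite addr0 mcoeffZ mcoeffX eqxx mulr1 => /eqP; rewrite mleadc_eq0 => /eqP.
have X0 : mpolyX C (mnm1 (ord_max : 'I_d.+1)) != 0.
  apply/eqP => /(congr1 (fun p => pv p (const_mx 1))); rewrite pvX pv0 mxE => /eqP.
  by rewrite oner_eq0.
(* [top] at [v] is the coefficient of the highest power of [t] in [a (y + t v)]; the last coordinate
   of [v] is nonzero so that [t] can be read off the last coordinate of a point. *)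
have [v] := pv_nonzero (mulf_neq0 top0 X0); rewrite pvM pvX mulf_eq0 negb_or => /andP[cv vl].
set vm := v ord0 ord_max in vl; set c := pv top v in cv.
pose psi (j : 'I_d) : mpoly d.+1 C := mpolyX C (mnm1 (lift ord_max j)) -
  mpolyC _ (v ord0 (lift ord_max j) / vm) * mpolyX C (mnm1 ord_max).
exists psi.
(* [al] is a section of [psi]: each [y] is [al (psi y) + t v] with [t] the quotient of the last
   coordinates of [y] and [v]. [A] below is [a] expanded in powers of [t] over the image of
   [psi]. *)
pose al (i : 'I_d.+1) : mpoly d C := if unlift ord_max i is Some j then mpolyX C (mnm1 j) else 0.
pose L i : {poly mpoly d C} := (mpolyC d (v ord0 i)) *: 'X + (al i)%:P.
pose A := \sum_(m <- msupp a) (mpolyC d (mcoeff m a))%:P * \prod_i L i ^+ m i.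
have yE (y : 'rV[C]_d.+1) i : y ord0 i = pv (al i) (pmap psi y) + y ord0 ord_max / vm * v ord0 i.
  rewrite /al; case: unliftP => [j ->|->]; last by rewrite pv0 add0r divfK.
  by rewrite pvX mxE /psi pvB pvM pvC !pvX; field.
have AE (y : 'rV[C]_d.+1) : (spz (pmap psi y) A).[y ord0 ord_max / vm] = pv a y.
  rewrite pv.unlock /peval mevalE /A rmorph_sum horner_sum; apply: eq_bigr => m _.
  rewrite rmorphM /= spzC pvC hornerM hornerC rmorph_prod horner_prod; congr (_ * _).
  apply: eq_bigr => i _; rewrite rmorphXn horner_exp; congr (_ ^+ _).
  rewrite rmorphD /= spzZ spzX spzC pvC !hornerE [RHS]yE.
  rewrite addrC; congr (_ + _); rewrite -[LHS]/(v ord0 i * y ord0 ord_max / vm).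
  by ring.
have tA : top_coef D A (mpolyC d c).
  have -> : c = \sum_(m <- msupp a) (if mdeg m == D then
      mcoeff m a * \prod_i v ord0 i ^+ m i else 0).
    rewrite /c /top pv.unlock /peval raddf_sum /= big_mkcond /=; apply: eq_bigr => m _.
    by case: ifP => // _; rewrite mevalZ mevalX.
  have : {in msupp a, forall m, (mdeg m <= D)%N}.
    by move=> m ms; rewrite -ltnS /D mlead_deg// msize_mdeg_lt.
  rewrite /A; elim: (msupp a) => [|m s IH] hs.
    by exists 0; rewrite ?size_poly0// !big_nil mpolyC0 scale0r addr0.
  have [|Q1 sQ1 IHE] := IH; first by move=> m' m's; apply: hs; rewrite in_cons m's orbT.
  have [Q2 sQ2 E] : top_coef (mdeg m) (\prod_i L i ^+ m i) (\prod_i (mpolyC d (v ord0 i)) ^+ m i).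
    rewrite mdegE; have := @top_coef_prod d _ (index_enum 'I_d.+1) (fun i => m i)
      (fun i => L i ^+ m i) (fun i => (mpolyC d (v ord0 i)) ^+ m i); apply => i.
    rewrite -[X in top_coef X]mul1n; apply: top_coefX.
    by exists (al i)%:P; [exact: size_polyC_leq1|rewrite expr1].
  rewrite !big_cons IHE; set g := (\sum_(j <- s) _ : C).
  have vE : mpolyC d (\prod_i v ord0 i ^+ m i) = \prod_i (mpolyC d (v ord0 i)) ^+ m i.
    by rewrite rmorph_prod; apply: eq_bigr => i _; rewrite rmorphXn.
  have sc (Q : {poly mpoly d C}) : (size ((mpolyC d (mcoeff m a))%:P * Q)%R <= size Q)%N.
    by rewrite mul_polyC size_scale_leq.
  case: eqP => [mD|mD].
    exists ((mpolyC d (mcoeff m a))%:P * Q2 + Q1).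
      apply: leq_trans (size_polyD _ _) _; rewrite geq_max sQ1 andbT.
      by apply: leq_trans (sc _) _; rewrite -mD.
    rewrite E mD mpolyCD mpolyCM vE -!mul_polyC polyCD polyCM.
    by rewrite mulrDr mulrA mulrDl addrACA.
  exists ((mpolyC d (mcoeff m a))%:P * \prod_i L i ^+ m i + Q1); last first.
    by rewrite add0r -/g addrCA.
  apply: leq_trans (size_polyD _ _) _; rewrite geq_max sQ1 andbT.
  apply: leq_trans (sc _) _; rewrite E; apply: leq_trans (size_polyD _ _) _.
  have mlt : (mdeg m < D)%N.
    by rewrite ltn_neqAle hs ?mem_head// andbT; apply/eqP.
  rewrite geq_max (leq_trans sQ2 (ltnW mlt)) andbT.
  by apply: leq_trans (size_scale_leq _ _) _; rewrite size_polyXn.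
have [Q1 sQ1 AE1] := tA.
pose P := (mpolyC d c^-1) *: A.
have cc : mpolyC d c^-1 * mpolyC d c = 1 by rewrite -mpolyCM mulVf.
have Pm : P \is monic.
  rewrite /P AE1 scalerDr scalerA cc scale1r monicE lead_coefDl ?lead_coefXn//.
  by rewrite size_polyXn ltnS; apply: leq_trans (size_scale_leq _ _) _.
have ht : integral_on [set y | pv a y = 0] (pmap psi) (fun y => y ord0 ord_max / vm).
  by exists P => // y /= ay; rewrite spzZ hornerZ AE ay mulr0.
move=> i; apply: (integral_on_eq (f := fun y => pv (al i) (pmap psi y) + y ord0 ord_max / vm * v ord0 i)).
  by move=> y _; rewrite -yE.
apply: integral_on_add; first exact: integral_on_base.
by apply: integral_on_mul => //; exact: integral_on_cst.
Qed.

(** The step by which the inductions on [d] descend: [X] lies over the hypersurface [a = 0], which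
    is itself finite over a space of one dimension less. *)
Lemma noether_step n d (X : set 'rV[C]_n) (zt : 'I_d.+1 -> mpoly n C) (a : mpoly d.+1 C) :
  a != 0 -> (forall x, X x -> pv a (pmap zt x) = 0) -> finite_over X zt ->
  exists zt' : 'I_d -> mpoly n C, finite_over X zt'.
Proof.
move=> a0 ha fX; have [psi hpsi] := noether_projection a0.
exists (fun j => psub zt (psi j)) => i.
have E x : pmap (fun j => psub zt (psi j)) x = pmap psi (pmap zt x).
  by apply/rowP => j; rewrite !mxE pv_psub.
apply: integral_on_trans (fX i) => j.
have [P Pm hP] := hpsi j; exists P => // x Xx.
by rewrite E hP//=; exact: ha.
Qed.

End Integrality.

(** * The primitive element *)

Section PrimitiveElement.
Variable R : realType.
Local Notation C := (Cplx R).

Definition respec d n (c : 'rV[C]_n) : mpoly (d + n) C -> mpoly d C :=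
  psub (fun i : 'I_(d + n) => match fintype.split i with
    | inl j => mpolyX C (mnm1 j)
    | inr k => mpolyC d (c ord0 k) end).

Lemma pmap_respec d n (c : 'rV[C]_n) (z : 'rV[C]_d) :
  pmap (fun i : 'I_(d + n) => match fintype.split i with
    | inl j => mpolyX C (mnm1 j)
    | inr k => mpolyC d (c ord0 k) end) z = row_mx z c.
Proof.
by apply/rowP => i; rewrite !mxE; case: (fintype.split i) => j; rewrite ?pvX ?pvC.
Qed.

Lemma pv_respec d n (c : 'rV[C]_n) (a : mpoly (d + n) C) z :
  pv (respec c a) z = pv a (row_mx z c).
Proof. by rewrite /respec pv_psub pmap_respec. Qed.

Lemma spz_respec d n (c : 'rV[C]_n) (P : {poly mpoly (d + n) C}) z :
  spz z (map_poly (respec c) P) = spz (row_mx z c) P.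
Proof.
by apply/polyP => i; rewrite !coef_spz coef_map /= -/(respec c _) pv_respec.
Qed.

Lemma deriv_lin n (w : 'rV[C]_n) k (a : mpoly n C) :
  (lin w (delta_mx ord0 k) a)^`().[0] = pv (mderiv k a) w.
Proof.
have l0 p : (lin w (delta_mx ord0 k) p).[0] = pv p w.
  by rewrite lin_horner scale0r addr0.
elim/mpoly_ring_ind: a => [c|i|p q hp hq|p q hp hq].
- by rewrite linC derivC horner0 mderivC pv0.
- rewrite linX mxE eqxx derivD derivC add0r derivZ derivX hornerZ hornerC mulr1.
  rewrite mderivX mnm1E; have [->|ik] := eqVneq i k.
    have -> : mnm_sub (mnm1 k) (mnm1 k) = mnm0 by apply/mnmP => j; rewrite mnmBE subnn mnm0E.
    by rewrite mpolyX0 scale1r pv1.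
  by rewrite scale0r pv0.
- by rewrite rmorphD /= derivD hornerD hp hq mderivD pvD.
- by rewrite rmorphM /= derivM hornerD !hornerM hp hq !l0 mderivM pvD !pvM.
Qed.

(** The chain rule at [t = 0] for [P] evaluated at [w + t e_k] and [s t]. *)
Lemma deriv_lin2 n (w : 'rV[C]_n) k (P : {poly mpoly n C}) (s : {poly C}) :
  (map_poly (lin w (delta_mx ord0 k)) P).[s]^`().[0] =
  (spz w (map_poly (mderiv k) P)).[s.[0]] + (spz w P^`()).[s.[0]] * s^`().[0].
Proof.
elim/poly_ind: P => [|P c IH].
  by rewrite deriv0 !(map_poly0, rmorph0, horner0, deriv0) mul0r addr0.
have -> : map_poly (mderiv k) (P * 'X + c%:P) = map_poly (mderiv k) P * 'X + (mderiv k c)%:P.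
  have cm (Q : {poly mpoly n C}) i : (map_poly (mderiv k) Q)`_i = mderiv k Q`_i.
    by apply: coef_map_id0; exact: mderiv0.
  apply/polyP => i; rewrite [LHS]cm.
  move: (map_poly (mderiv k) P) (cm P) => Q QE.
  rewrite [RHS]coefD (coefD (P * 'X)) (coefMX P) (coefMX Q).
  rewrite [in LHS]coefC [in RHS]coefC mderivD.
  by case: i => [|i] /=; rewrite ?QE mderiv0.
rewrite !rmorphD !rmorphM /= map_polyX map_polyC hornerD hornerMX hornerC /=.
rewrite derivD derivM !derivD derivM derivC derivX addr0 mulr1 !rmorphD !rmorphM /=.
rewrite !spzX spzC !hornerE IH deriv_lin.
have -> : (map_poly (lin w (delta_mx ord0 k)) P).[s].[0] = (spz w P).[s.[0]].
  by rewrite horner_lin2 scale0r addr0.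
by ring.
Qed.

(* Kronecker: differentiate the equation of a generic linear form [sum_i u_i x_i]
   with respect to the coefficients [u_i] *)
Lemma primitive_element n d (X : set 'rV[C]_n) (zt : 'I_d -> mpoly n C) :
  finite_over X zt ->
  exists (g : mpoly n C) (delta : mpoly d C) (G : 'I_n -> {poly mpoly d C}),
    delta != 0 /\ forall x i, X x ->
      pv delta (pmap zt x) * x ord0 i = (spz (pmap zt x) (G i)).[pv g x].
Proof.
move=> fX.
(* The points of [X] together with the coefficients [u] of a linear form: the [u_i] become variables
   of the base. *)
pose T := ({x | X x} * 'rV[C]_n)%type.
pose zT (x : T) := row_mx (pmap zt (sval x.1)) x.2.
pose b (x : T) : C := \sum_i x.2 ord0 i * sval x.1 ord0 i.
have aT : algebraic zT b.
  pose X' : set ('rV[C]_n * 'rV[C]_n) := [set x | X x.1].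
  pose z' (x : 'rV[C]_n * 'rV[C]_n) := row_mx (pmap zt x.1) x.2.
  have [P Pm hP] : integral_on X' z' (fun x => \sum_i x.2 ord0 i * x.1 ord0 i).
    apply: integral_on_sum => i; apply: integral_on_mul.
      apply: integral_on_eq (integral_on_base _ _ (mpolyX C (mnm1 (rshift d i)))) => x _.
      by rewrite pvX row_mxEr.
    apply: (@integral_on_trans _ _ _ _ _ z' (fun x => pmap zt x.1)) => [j|].
      apply: integral_on_eq (integral_on_base _ _ (mpolyX C (mnm1 (lshift n j)))) => x _.
      by rewrite pvX row_mxEl.
    by have [P Pm hP] := fX i; exists P => // x Xx; exact: hP.
  exists P; first exact: monic_neq0.
  by move=> [[x Xx] u]; exact: (hP (x, u)).
have [F Fmin] := minimal_killer_exists aT.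
have [U [V [delta [delta0 E]]]] := minimal_killer_separable Fmin.
have [_ kF _] := Fmin.
have Vb x : (spz (zT x) V).[b x] * (spz (zT x) F^`()).[b x] = pv delta (zT x).
  have := congr1 (fun P => (spz (zT x) P).[b x]) E.
  by rewrite /= spzD !spzM hornerD !hornerM kF mulr0 add0r spzC hornerC.
(* Moving [u] by [t e_i] moves the value of the form by [t x_i], and [F] vanishes for every [t]; the
   derivative at [0] is the claim. *)
have kron (x : T) i : (spz (zT x) (map_poly (mderiv (rshift d i)) F)).[b x] +
    (spz (zT x) F^`()).[b x] * sval x.1 ord0 i = 0.
  pose s : {poly C} := (b x)%:P + sval x.1 ord0 i *: 'X.
  have s0 : s.[0] = b x by rewrite hornerD hornerC hornerZ hornerX mulr0 addr0.
  have s1 : s^`().[0] = sval x.1 ord0 i.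
    by rewrite derivD derivC add0r derivZ derivX hornerZ hornerC mulr1.
  rewrite -{1 2}s0 -s1 -deriv_lin2.
  suff -> : (map_poly (lin (zT x) (delta_mx ord0 (rshift d i))) F).[s] = 0.
    by rewrite deriv0 horner0.
  apply: poly_eq0 => t; rewrite horner_lin2.
  pose x' : T := (x.1, x.2 + t *: delta_mx ord0 i).
  have -> : zT x + t *: delta_mx ord0 (rshift d i) = zT x'.
    apply/rowP => j; rewrite !mxE; case: (splitP j) => l jl; rewrite !mxE eqxx /=.
      suff -> : (j == rshift d i) = false by rewrite mulr0 addr0.
      by apply/eqP => ji; have := ltn_ord l; rewrite -jl ji /= ltnNge leq_addr.
    suff -> : (j == rshift d i) = (l == i) by [].
    by rewrite -!val_eqE /= jl eqn_add2l.
  have -> : s.[t] = b x'.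
    rewrite hornerD hornerC hornerZ hornerX /b /=.
    have -> : sval x.1 ord0 i * t = \sum_j (if j == i then sval x.1 ord0 i * t else 0).
      by rewrite -big_mkcond big_pred1_eq.
    rewrite -big_split /=; apply: eq_bigr.
    move=> j _; rewrite !mxE eqxx /=; case: eqP => [->|_].
      by rewrite mulr1; ring.
    by rewrite mulr0 !addr0.
  exact: kF.
(* The form is finally fixed at coefficients [c] for which [delta] remains a nonzero polynomial of
   the base variables. *)
have [w dw] := pv_nonzero delta0.
pose c := rsubmx w.
exists (\sum_i mpolyC n (c ord0 i) * mpolyX C (mnm1 i)), (respec c delta),
  (fun i => map_poly (respec c) (- (V * map_poly (mderiv (rshift d i)) F))).
split; first by apply: contra dw => /eqP a0; rewrite -[w]hsubmxK -pv_respec a0 pv0.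
move=> x i Xx; rewrite pv_respec spz_respec.
pose xT : T := (exist _ x Xx, c).
have -> : pv (\sum_i mpolyC n (c ord0 i) * mpolyX C (mnm1 i)) x = b xT.
  by rewrite pv_sum; apply: eq_bigr => j _; rewrite pvM pvC pvX.
have -> : row_mx (pmap zt x) c = zT xT by [].
rewrite -(Vb xT) spzN spzM hornerN hornerM.
have /eqP := kron xT i; rewrite addr_eq0 => /eqP ->.
by rewrite /=; ring.
Qed.

End PrimitiveElement.

(** * The generic covering *)

Section Covering.
Variable R : realType.
Local Notation C := (Cplx R).
Variables (n d : nat) (X : set 'rV[C]_n) (zt : 'I_d -> mpoly n C).

Definition base_pt (x : {x | X x}) : 'rV[C]_d := pmap zt (sval x).

Definition sheet (q : mpoly d C) (G : 'I_n -> {poly mpoly d C}) (z : 'rV[C]_d) (t : C) :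
  'rV[C]_n := \row_i ((spz z (G i)).[t] / pv q z).

(* Away from [q = 0] the set [X] is the covering [F z t = 0] of the base, through
   [x |-> (z, g x)] and its inverse [sheet] *)
Record covering (g : mpoly n C) (F : {poly mpoly d C}) (q : mpoly d C)
    (G : 'I_n -> {poly mpoly d C}) : Prop := Covering {
  cov_minimal : minimal_killer base_pt (fun x => pv g (sval x)) F;
  cov_q : q != 0;
  cov_lead : forall z, pv q z != 0 -> pv (lead_coef F) z != 0;
  cov_simple : forall z t, pv q z != 0 -> (spz z F).[t] = 0 -> (spz z F)^`().[t] != 0;
  cov_coord : forall x i, X x ->
    pv q (pmap zt x) * x ord0 i = (spz (pmap zt x) (G i)).[pv g x];
  cov_sheet : forall z t, pv q z != 0 -> (spz z F).[t] = 0 ->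
    [/\ X (sheet q G z t), pmap zt (sheet q G z t) = z & pv g (sheet q G z t) = t];
  cov_bezout : exists U V (k : mpoly d C), k != 0 /\ U * F + V * F^`() = k%:P
}.

(** Clearing denominators makes [p] on the sheet a polynomial in [z] and [t], to which divisibility
    by [F] can be applied. *)
Lemma sheet_homogenize q G p : exists N P, forall z t, pv q z != 0 ->
  (spz z P).[t] = pv q z ^+ N * pv p (sheet q G z t).
Proof.
elim/mpoly_ring_ind: p => [c|i|p1 p2 [N1 [P1 h1]] [N2 [P2 h2]]|p1 p2 [N1 [P1 h1]] [N2 [P2 h2]]].
- by exists 0%N, (mpolyC d c)%:P => z t _; rewrite spzC hornerC !pvC mul1r.
- by exists 1%N, (G i) => z t qz; rewrite pvX mxE expr1 mulrC divfK.
- exists (N1 + N2)%N, ((q ^+ N2)%:P * P1 + (q ^+ N1)%:P * P2) => z t qz.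
  rewrite rmorphD !rmorphM /= !spzC !hornerE !pvXn h1// h2// pvD exprD.
  by ring.
- exists (N1 + N2)%N, (P1 * P2) => z t qz.
  by rewrite spzM hornerM h1// h2// pvM exprD mulrACA.
Qed.

Lemma algebraic_pv p : finite_over X zt -> algebraic base_pt (fun x => pv p (sval x)).
Proof.
move=> fX; have [P Pm hP] := finite_over_poly p fX.
exists P; first exact: monic_neq0.
by move=> [x Xx]; exact: hP.
Qed.

(** Minimality of [F] transports identities: if [p = Q (z, g)] on [X] off [q = 0], the cleared
    difference is a multiple of [F] up to factors that are nonzero off [q = 0], so the identity
    holds at the formal point [sheet q G z t] for every root [t]. Applied to the equations of [X],
    to [zt] and to [g], this places the sheets in [X]. *)
Lemma covering_exists : zariski_closed X -> finite_over X zt ->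
  exists g F q G, covering g F q G.
Proof.
move=> [I XI] fX.
have [g [dk [G0 [dk0 hG0]]]] := primitive_element fX.
have [F Fmin] := minimal_killer_exists (algebraic_pv g fX).
have [U [V [df [df0 E]]]] := minimal_killer_separable Fmin.
(* [dk] is the denominator of the coordinates, [df] comes from the Bezout relation and keeps the
   roots of [F] simple, [lead_coef F] keeps its degree. *)
pose q := dk * (df * lead_coef F); pose G i := (df * lead_coef F)%:P * G0 i.
have [F0 kF _] := Fmin.
have q0 : q != 0 by rewrite !mulf_neq0// lead_coef_eq0.
have hcoord x i : X x -> pv q (pmap zt x) * x ord0 i = (spz (pmap zt x) (G i)).[pv g x].
  move=> Xx; rewrite spzM spzC hornerM hornerC -hG0// /q !pvM.
  by ring.
have hlead z : pv q z != 0 -> pv (lead_coef F) z != 0.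
  by rewrite !pvM !mulf_eq0 !negb_or => /and3P[].
have sheetE x : X x -> pv q (pmap zt x) != 0 -> sheet q G (pmap zt x) (pv g x) = x.
  move=> Xx qx; apply/rowP => i; rewrite mxE -hcoord// mulrC mulKf//.
have transport p Q : (forall x, X x -> pv q (pmap zt x) != 0 ->
      pv p x = (spz (pmap zt x) Q).[pv g x]) ->
    forall z t, pv q z != 0 -> (spz z F).[t] = 0 -> pv p (sheet q G z t) = (spz z Q).[t].
  move=> hp z t qz Ft.
  have [N [P hP]] := sheet_homogenize q G p.
  have kP : kills base_pt (fun x => pv g (sval x)) (q *: (P - (q ^+ N)%:P * Q)).
    apply: killsZ => -[x Xx] /= qx; rewrite spzB spzM spzC.
    rewrite hornerD hornerN hornerM hornerC pvXn hP// sheetE// -hp//.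
    by rewrite subrr.
  have [k [Q' hQ']] := minimal_killer_dvd Fmin q0 kP.
  have := congr1 (fun P => (spz z P).[t]) hQ'.
  rewrite /= spzZ hornerZ spzM hornerM Ft mulr0 => /eqP.
  rewrite mulf_eq0 pvXn expf_eq0 (negbTE (hlead _ qz)) andbF /=.
  rewrite spzB spzM spzC hornerD hornerN hornerM hornerC pvXn hP// -mulrBr.
  rewrite mulf_eq0 expf_eq0 (negbTE qz) andbF /= subr_eq0.
  by move=> /eqP.
exists g, F, q, G; split => //.
- move=> z t; rewrite !pvM !mulf_eq0 !negb_or => /and3P[_ dfz _] Ft.
  apply: contra dfz => /eqP F't; have := congr1 (fun P => (spz z P).[t]) E.
  rewrite /= spzD !spzM hornerD !hornerM Ft -deriv_spz F't !mulr0 addr0.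
  by rewrite spzC hornerC => <-.
- move=> z t qz Ft; split.
  + rewrite XI => p Ip; rewrite -[peval _ _]/(peval p _).
    have := transport p 0 _ z t qz Ft; rewrite rmorph0 horner0 pv.unlock; apply=> x Xx _.
    by rewrite rmorph0 horner0; move: Xx; rewrite XI; apply.
  + apply/rowP => j; rewrite mxE (transport _ (mpolyX C (mnm1 j))%:P) ?spzC ?hornerC ?pvX//.
    by move=> x Xx _; rewrite spzC hornerC pvX mxE.
  + rewrite (transport _ 'X) ?spzX ?hornerX// => x Xx _.
    by rewrite spzX hornerX.
- by exists U, V, df.
Qed.

End Covering.

(** * Size and position of the roots of a polynomial *)

Section RootBranches.
Variable R : realType.
Local Notation C := (Cplx R).

Definition rts (p : {poly C}) : seq C := sval (closed_field_poly_normal p).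

Lemma rtsE (p : {poly C}) : p = lead_coef p *: \prod_(r <- rts p) ('X - r%:P).
Proof. exact: svalP (closed_field_poly_normal p). Qed.

Lemma size_rts (p : {poly C}) : p != 0 -> size p = (size (rts p)).+1.
Proof.
by move=> p0; rewrite {1}[p]rtsE size_scale ?lead_coef_eq0// size_prod_XsubC.
Qed.

Lemma mem_rts (p : {poly C}) t : p != 0 -> (t \in rts p) = (p.[t] == 0).
Proof.
move=> p0; rewrite {2}[p]rtsE hornerZ mulf_eq0 lead_coef_eq0 (negbTE p0) /=.
by rewrite -root_prod_XsubC.
Qed.

Lemma uniq_rts (p : {poly C}) : p != 0 -> (forall t, p.[t] = 0 -> p^`().[t] != 0) -> uniq (rts p).
Proof.
move=> p0 simple; apply/negPn/negP => /(uniqPn 0)[i [j [ij js e]]].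
set s := rts p in js e.
have [x [s1 [s2 [s3 E]]]] : exists x s1 s2 s3, s = s1 ++ x :: s2 ++ x :: s3.
  exists s`_i, (take i s), (take (j - i.+1) (drop i.+1 s)), (drop j.+1 s).
  rewrite -{1}[s](cat_take_drop i) (drop_nth 0) ?(ltn_trans ij)//; congr (_ ++ _ :: _).
  rewrite -{1}[drop i.+1 s](cat_take_drop (j - i.+1)) drop_drop subnK//.
  by rewrite (drop_nth 0 js) -e.
have pE : p = lead_coef p *: (\prod_(r <- s1 ++ s2 ++ s3) ('X - r%:P)) * ('X - (x)%:P) ^+ 2.
  rewrite {1}[p]rtsE -/s E -scalerAl; congr (_ *: _).
  by rewrite !big_cat /= !big_cons !big_cat /= !big_cons; ring.
have /simple/negP : p.[x] = 0 by rewrite pE hornerM horner_exp hornerXsubC subrr expr0n mulr0.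
apply; rewrite {1}pE derivM deriv_exp derivXsubC expr1 mul1r hornerD !hornerM hornerMn.
by rewrite hornerXsubC subrr mul0rn !mulr0 addr0.
Qed.

(** Cauchy's bound, with the leading coefficient left as a factor because the equation of [f] need
    not be monic. *)
Lemma root_bound (p : {poly C}) t (A : R) : p != 0 -> p.[t] = 0 ->
  \sum_(i < size p) nm p`_i <= A -> nm (lead_coef p) * nm t <= A.
Proof.
move=> p0 pt hA.
have sp : size p = (size p).-1.+1 by rewrite prednK// size_poly_gt0.
have S0 : 0 <= \sum_(i < (size p).-1) nm p`_i by apply: sumr_ge0 => i _; exact: nm_ge0.
rewrite sp big_ord_recr /= -/(lead_coef p) in hA.
have lc0 := nm_ge0 (lead_coef p).
have [t1|t1] := leP (nm t) 1.
  by apply: le_trans (_ : nm (lead_coef p) <= _); [rewrite ler_piMr|lra].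
have : lead_coef p * t ^+ (size p).-1 = - \sum_(i < (size p).-1) p`_i * t ^+ i.
  have := horner_coef p t; rewrite pt sp big_ord_recr /= => /esym/eqP.
  by rewrite addrC addr_eq0 => /eqP.
case: (size p).-1 S0 hA => [|k] S0 hA.
  rewrite big_ord0 oppr0 expr0 mulr1 => /eqP.
  by rewrite lead_coef_eq0 (negbTE p0).
move=> /(congr1 (@nm R)); rewrite nmN nmM nmX => e.
have tk : 0 < nm t ^+ k by rewrite exprn_gt0//; lra.
rewrite -(ler_pM2r tk) -mulrA -exprS e; apply: le_trans (nm_sum _ _) _.
apply: le_trans (_ : (\sum_(i < k.+1) nm p`_i) * nm t ^+ k <= _); last first.
  by rewrite ler_pM2r//; lra.
rewrite mulr_suml; apply: ler_sum => i _; rewrite nmM nmX ler_wpM2l ?nm_ge0//.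
by rewrite ler_eXn2l ?(ltW t1)// -ltnS.
Qed.

Lemma coef_growth d (P : {poly mpoly d C}) : exists2 K : R, 0 <= K & exists N, forall z,
  \sum_(i < size (spz z P)) nm (spz z P)`_i <= K * (1 + nv z) ^+ N.
Proof.
have [K K0 [N h]] : exists2 K : R, 0 <= K & exists N, forall z : 'rV[C]_d,
    \sum_(i < size P) nm (pv P`_i z) <= K * (1 + nv z) ^+ N.
  elim: (size P) => [|k [K K0 [N h]]].
    by exists 0 => //; exists 0%N => z; rewrite big_ord0 mul0r.
  have [K' K'0 [N' h']] := pv_growth P`_k.
  exists (K + K'); first exact: addr_ge0.
  exists (N + N')%N => z; rewrite big_ord_recr /= mulrDl lerD//.
    apply: le_trans (h z) _; rewrite ler_wpM2l// exprD ler_peMr//.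
      by rewrite exprn_ge0// addr_ge0// nv_ge0.
    by rewrite exprn_ege1// lerDl nv_ge0.
  apply: le_trans (h' z) _; rewrite ler_wpM2l// exprD ler_peMl//.
    by rewrite exprn_ge0// addr_ge0// nv_ge0.
  by rewrite exprn_ege1// lerDl nv_ge0.
exists K => //; exists N => z; apply: le_trans (h z).
rewrite (big_ord_widen (size P) (fun i => nm (spz z P)`_i)) ?size_spz_leq//.
rewrite big_mkcond /=; apply: ler_sum => i _.
by case: ifP => _; rewrite ?coef_spz// nm_ge0.
Qed.

Lemma near_seq (I : eqType) (s : seq I) (a : C) (P : I -> C -> Prop) :
  (forall i, i \in s -> \forall t \near a, P i t) ->
  \forall t \near a, forall i, i \in s -> P i t.
Proof.
elim: s => [|j s IH] h; first by apply/nearCP; exists 1.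
have /nearCP[d1 d10 h1] := h j (mem_head _ _).
have /nearCP[d2 d20 h2] : \forall t \near a, forall i, i \in s -> P i t.
  by apply: IH => i si; apply: h; rewrite in_cons si orbT.
apply/nearCP; exists (Num.min d1 d2); first by rewrite lt_min d10.
move=> t; rewrite lt_min => /andP[t1 t2] i; rewrite in_cons => /orP[/eqP->|si].
  exact: h1.
exact: h2.
Qed.

(** The product of the distances from [r] to the roots is [nm p.[r] / nm (lead_coef p)], and the
    least distance is bounded by their geometric mean: a quantitative continuity of roots. *)
Lemma nearest_root (p : {poly C}) (r : C) : (1 < size p)%N -> exists2 s, p.[s] = 0 &
  nm (s - r) ^+ (size p).-1 * nm (lead_coef p) <= nm p.[r].
Proof.
move=> sp; have p0 : p != 0 by rewrite -size_poly_gt0 ltnW.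
rewrite size_rts//= in sp *.
have mono (l : seq C) : l != [::] -> exists2 s, s \in l &
    nm (s - r) ^+ size l <= \prod_(s' <- l) nm (s' - r).
  elim: l => [//|s l IH] _; have [->|/IH[s1 s1l h]] := eqVneq l [::].
    by exists s; rewrite ?mem_head// big_seq1 expr1.
  have [ss1|ss1] := leP (nm (s - r)) (nm (s1 - r)).
    exists s; first exact: mem_head.
    rewrite big_cons /= exprS ler_wpM2l ?nm_ge0//; apply: le_trans h.
    by rewrite lerXn2r ?nnegrE ?nm_ge0.
  exists s1; first by rewrite in_cons s1l orbT.
  by rewrite big_cons /= exprS ler_pM ?exprn_ge0 ?nm_ge0// ltW.
have [|s sr h] := mono (rts p); first by case: (rts p) sp.
exists s; first by apply/eqP; rewrite -mem_rts.
have -> : nm p.[r] = nm (lead_coef p) * \prod_(s' <- rts p) nm (s' - r).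
  rewrite {1}[p]rtsE hornerZ nmM horner_prod nm_prod; congr (_ * _).
  by apply: eq_bigr => i _; rewrite hornerXsubC nmBC.
by rewrite mulrC ler_wpM2l ?nm_ge0.
Qed.

End RootBranches.

(** * Branches of the sheets and of the values of [f] *)

Section SheetBranches.
Variable R : realType.
Local Notation C := (Cplx R).

Lemma taylor_line d (z v : 'rV[C]_d) (p : mpoly d C) k a :
  taylor k a (fun t => pv p (z + t *: v)).
Proof.
rewrite (_ : (fun _ => _) = (fun t => (lin z v p).[t])); first exact: taylor_poly.
by apply/funext => t; rewrite lin_horner.
Qed.

Lemma near_line d (z v : 'rV[C]_d) (p : mpoly d C) a : pv p (z + a *: v) != 0 ->
  \forall t \near a, pv p (z + t *: v) != 0.
Proof. exact: near_neq0 (taylor_cont (taylor_line z v p 0 a)). Qed.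

Lemma taylor_spz d (z v : 'rV[C]_d) (P : {poly mpoly d C}) k (a : C) (y : C -> C) :
  taylor k a y -> taylor k a (fun t => (spz (z + t *: v) P).[y t]).
Proof.
move=> hy; have := taylor_horner2 (map_poly (lin z v) P) hy.
by congr (taylor _ _ _); apply/funext => t; rewrite horner_lin2 hornerC.
Qed.

Lemma taylor_root d (z v : 'rV[C]_d) (P : {poly mpoly d C}) k (a : C) (y : C -> C) :
  y t @[t --> a] --> y a -> (\forall t \near a, (spz (z + t *: v) P).[y t] = 0) ->
  (spz (z + a *: v) P)^`().[y a] != 0 -> taylor k a y.
Proof.
move=> yc Py P'y; apply: (@taylor_implicit _ (map_poly (lin z v) P)) => //.
  by apply: filterS Py => t; rewrite horner_lin2 hornerC.
by rewrite deriv_map horner_lin2 hornerC -deriv_spz.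
Qed.

(** [y t] is a root nearest to [r] in the above sense. It tends to [r], because [P] at [r] tends to
    zero while its leading coefficient does not, and simplicity of [r] improves continuity to order
    [k]. *)
Lemma root_branch d (z v : 'rV[C]_d) (P : {poly mpoly d C}) k (a r : C) :
  pv (lead_coef P) (z + a *: v) != 0 -> (spz (z + a *: v) P).[r] = 0 ->
  (spz (z + a *: v) P)^`().[r] != 0 ->
  exists y : C -> C, [/\ y a = r, taylor k a y &
    \forall t \near a, (spz (z + t *: v) P).[y t] = 0].
Proof.
move=> lc Pr P'r; pose Pt t := spz (z + t *: v) P.
have nlc := near_line lc.
have sizeE t : pv (lead_coef P) (z + t *: v) != 0 -> size (Pt t) = size P.
  exact: size_spz.
have s1 : (1 < size P)%N.
  rewrite ltnNge -(sizeE a lc); apply/negP => /size1_polyC E.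
  by move: P'r; rewrite -/(Pt a) E derivC horner0 eqxx.
have ex t : exists s, pv (lead_coef P) (z + t *: v) != 0 -> (Pt t).[s] = 0 /\
    nm (s - r) ^+ (size P).-1 * nm (lead_coef (Pt t)) <= nm (Pt t).[r].
  have [_|lt0] := eqVneq (pv (lead_coef P) (z + t *: v)) 0; first by exists 0.
  have [|s s0 hs] := @nearest_root _ (Pt t) r; first by rewrite sizeE.
  by exists s => _; rewrite sizeE in hs.
have [y hy] := choice ex.
have yn : \forall t \near a, (Pt t).[y t] = 0 by apply: filterS nlc => t /hy[].
have m0 : (0 < (size P).-1)%N by case: (size P) s1 => [|[|]].
have La : 0 < nm (pv (lead_coef P) (z + a *: v)) by rewrite nm_gt0.
have ya : y a = r.
  have [_] := hy a lc; rewrite Pr nm0 => h; apply/eqP; rewrite -subr_eq0 -nm_eq0.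
  have : nm (y a - r) ^+ (size P).-1 <= 0.
    by rewrite -(pmulr_lle0 _ La) -lead_coef_spz.
  by rewrite le_eqVlt ltNge exprn_ge0 ?nm_ge0// orbF expf_eq0 m0.
have yc : y t @[t --> a] --> y a.
  apply/cont_nmP => e e0; set L := nm (pv (lead_coef P) (z + a *: v)) in La.
  have eL : 0 < e ^+ (size P).-1 * (L / 2) by rewrite mulr_gt0 ?exprn_gt0 ?divr_gt0.
  have L2 : 0 < L / 2 by rewrite divr_gt0.
  have [d1 d10 h1] := (cont_nmP _ _).1 (taylor_cont (taylor_line z v (lead_coef P) 0 a)) _ L2.
  have [d2 d20 h2] := (cont_nmP _ _).1 (taylor_cont (taylor_spz z v P (taylor_cst 0 a r))) _ eL.
  have [d3 d30 h3] := (nearCP _ _).1 nlc.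
  exists (Num.min d1 (Num.min d2 d3)); first by rewrite !lt_min d10 d20.
  move=> t; rewrite !lt_min => /and3P[/h1 t1 /h2 t2 /h3 t3].
  rewrite Pr subr0 in t2; rewrite ya.
  have [_ hyt] := hy t t3; rewrite lead_coef_spz// in hyt.
  have Lt : L / 2 < nm (pv (lead_coef P) (z + t *: v)).
    have := nm_sub (pv (lead_coef P) (z + a *: v)) (pv (lead_coef P) (z + t *: v)).
    by rewrite nmBC -/L; lra.
  rewrite ltNge; apply/negP => ley.
  have : e ^+ (size P).-1 <= nm (y t - r) ^+ (size P).-1.
    by rewrite lerXn2r ?nnegrE ?nm_ge0// ltW.
  move=> le1; have := le_lt_trans hyt t2; apply/negP; rewrite -leNgt.
  by apply: ler_pM => //; rewrite ?exprn_ge0// ltW.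
exists y; split => //.
by apply: (@taylor_root d z v P k a y yc yn); rewrite ya.
Qed.

Section Cover.
Variables (n d : nat) (X : set 'rV[C]_n) (zt : 'I_d -> mpoly n C).
Variables (g : mpoly n C) (F : {poly mpoly d C}) (q : mpoly d C) (G : 'I_n -> {poly mpoly d C}).
Hypothesis cov : covering X zt g F q G.

(** Continuity of [f] makes its value along the branch a continuous root of [Ff]; this root is
    simple where [kf] is nonzero, so the implicit expansion applies to it as well. *)
Lemma taylor_value_branch (f : 'rV[C]_n -> C) (Ff U V : {poly mpoly d C}) (kf : mpoly d C)
    (z v : 'rV[C]_d) k (a : C) (y : C -> C) :
  cont_on X f -> kills (@base_pt _ _ _ X zt) (fun x => f (sval x)) Ff ->
  U * Ff + V * Ff^`() = kf%:P -> pv kf (z + a *: v) != 0 -> pv q (z + a *: v) != 0 ->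
  taylor k a y -> (\forall t \near a, (spz (z + t *: v) F).[y t] = 0) ->
  taylor k a (fun t => f (sheet q G (z + t *: v) (y t))).
Proof.
move=> fc kFf E kz qz yT yF.
pose s t := sheet q G (z + t *: v) (y t).
have sT k' i : taylor k' a y -> taylor k' a (fun t => s t ord0 i).
  move=> yT'; rewrite (_ : (fun _ => _) = (fun t => (spz (z + t *: v) (G i)).[y t] *
     (pv q (z + t *: v))^-1)); last by apply/funext => t; rewrite mxE.
  by apply: taylorM; [exact: taylor_spz|apply: taylorV => //; exact: taylor_line].
have qn := near_line qz.
have sX : \forall t \near a, X (s t) /\ pmap zt (s t) = z + t *: v.
  near=> t; have qt : pv q (z + t *: v) != 0 by near: t.
  have Ft : (spz (z + t *: v) F).[y t] = 0 by near: t.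
  by have [] := cov_sheet cov qt Ft.
have [Xs zs] := near_self sX.
have y0 : taylor 0 a y := taylor_cont yT.
have fcont : f (s t) @[t --> a] --> f (s a).
  apply/cont_nmP => e e0; have [d0 d00 hd] := fc _ Xs e e0.
  have : \forall t \near a, forall i, i \in index_enum 'I_n -> nm (s t ord0 i - s a ord0 i) < d0.
    apply: near_seq => i _; apply/nearCP.
    exact: ((cont_nmP _ _).1 (sT 0 i y0) d0 d00).
  move=> sn; apply/nearCP; near=> t.
  have [Xst _] : X (s t) /\ pmap zt (s t) = z + t *: v by near: t.
  have snt : forall i, i \in index_enum 'I_n -> nm (s t ord0 i - s a ord0 i) < d0 by near: t.
  by apply: hd => // i; apply: snt; rewrite mem_index_enum.
have fz t : X (s t) -> pmap zt (s t) = z + t *: v -> (spz (z + t *: v) Ff).[f (s t)] = 0.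
  by move=> Xst <-; exact: (kFf (exist _ (s t) Xst)).
apply: (@taylor_root _ z v Ff) => //.
  by near=> t; apply: fz; have [] : X (s t) /\ pmap zt (s t) = z + t *: v by near: t.
apply: contra kz => /eqP F'0; have := congr1 (fun P => (spz (z + a *: v) P).[f (s a)]) E.
rewrite /= rmorphD !rmorphM /= hornerD !hornerM fz// -deriv_spz F'0 !mulr0 addr0.
by rewrite spzC hornerC => <-.
Unshelve. all: by end_near. Qed.

End Cover.
End SheetBranches.

(** * Symmetric functions of the sheets *)

Section SymmetricFunctions.
Variable R : realType.
Local Notation C := (Cplx R).

Lemma integral_on_growth (T : Type) d (X : set T) (z : T -> 'rV[C]_d) b : integral_on X z b ->
  exists2 K : R, 0 <= K & exists N, forall x, X x -> nm (b x) <= K * (1 + nv (z x)) ^+ N.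
Proof.
move=> [P Pm hP]; have [K K0 [N h]] := coef_growth P.
exists K => //; exists N => x Xx; have Pz := monic_spz (z x) Pm.
by have := root_bound (monic_neq0 Pz) (hP x Xx) (h (z x)); rewrite (monicP Pz) nm1 mul1r.
Qed.

(** What a function of an unordered list of pairs must satisfy to become a polynomial of the base
    point: it preserves expansions along branches and is polynomially bounded in the entries. *)
Record symmetric_function (Psi : seq (C * C) -> C) : Prop := SymmetricFunction {
  sym_perm : forall l l', perm_eq l l' -> Psi l = Psi l';
  sym_taylor : forall (I : eqType) (s : seq I) (u w : I -> C -> C) (a : C),
    (forall i, taylor 2 a (u i)) -> (forall i, taylor 2 a (w i)) ->
    taylor 2 a (fun t => Psi [seq (u i t, w i t) | i <- s]);
  sym_bound : forall m : nat, exists2 K : R, 0 <= K & exists N, forall l (B : R), 1 <= B ->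
    size l = m -> (forall c, c \in l -> nm c.1 <= B /\ nm c.2 <= B) -> nm (Psi l) <= K * B ^+ N
}.

Variables (n d : nat) (X : set 'rV[C]_n) (zt : 'I_d -> mpoly n C).
Variables (g : mpoly n C) (F : {poly mpoly d C}) (q : mpoly d C) (G : 'I_n -> {poly mpoly d C}).
Hypothesis fX : finite_over X zt.
Hypothesis cov : covering X zt g F q G.
Variable f : 'rV[C]_n -> C.
Hypothesis fc : cont_on X f.
Hypothesis fa : algebraic (@base_pt _ _ _ X zt) (fun x => f (sval x)).
Hypothesis fb : forall rho : R, exists B : R, forall x, X x -> nv (pmap zt x) <= rho -> nm (f x) <= B.

(** Entries pair the sheet coordinate with the value of [f]; the list is meaningful where [q] is
    nonzero. *)
Definition fiber (z : 'rV[C]_d) : seq (C * C) :=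
  [seq (t, f (sheet q G z t)) | t <- rts (spz z F)].

Lemma spzF_neq0 z : pv q z != 0 -> spz z F != 0.
Proof. by move=> /(cov_lead cov) lz; rewrite -lead_coef_eq0 lead_coef_spz. Qed.

Lemma size_fiber z : pv q z != 0 -> size (fiber z) = (size F).-1.
Proof.
move=> qz; have := size_rts (spzF_neq0 qz).
by rewrite size_spz ?(cov_lead cov)// size_map => ->.
Qed.

Lemma uniq_rtsF z : pv q z != 0 -> uniq (rts (spz z F)).
Proof.
by move=> qz; apply: uniq_rts => [|t Ft]; [exact: spzF_neq0|exact: (cov_simple cov)].
Qed.

Lemma fiberP z c : pv q z != 0 -> c \in fiber z ->
  exists x, [/\ X x, pmap zt x = z, c.1 = pv g x & c.2 = f x].
Proof.
move=> qz /mapP[t]; rewrite mem_rts ?spzF_neq0// => /eqP Ft ->.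
by have [Xs zs gs] := cov_sheet cov qz Ft; exists (sheet q G z t).
Qed.

(** A branch passes through every root over [a]. Branches distinct at [a] stay distinct nearby and
    are as many as the roots, so they run through the fiber up to order, which [Psi] ignores. *)
Lemma fiber_taylor Psi : symmetric_function Psi ->
  exists2 Q : mpoly d C, Q != 0 & (forall z, pv Q z != 0 -> pv q z != 0) /\
    forall z v a, pv Q (z + a *: v) != 0 -> taylor 2 a (fun t => Psi (fiber (z + t *: v))).
Proof.
move=> sym; have [Ff Fmin] := minimal_killer_exists fa.
have [U [V [kf [kf0 E]]]] := minimal_killer_separable Fmin.
have [_ kFf _] := Fmin.
exists (q * kf); first by rewrite mulf_neq0// (cov_q cov).
split=> [z|z v a]; first by rewrite pvM mulf_eq0 negb_or => /andP[].
rewrite pvM mulf_eq0 negb_or => /andP[qz kz].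
set s := rts (spz (z + a *: v) F).
have ex r : exists y : C -> C, [/\ r \in s -> y a = r, taylor 2 a y &
    r \in s -> \forall t \near a, (spz (z + t *: v) F).[y t] = 0].
  have [rs|rs] := boolP (r \in s); last first.
    by exists (fun=> 0); split => //; exact: taylor_cst.
  have Fr : (spz (z + a *: v) F).[r] = 0 by apply/eqP; rewrite -mem_rts ?spzF_neq0.
  have [y [ya yT yF]] := root_branch 2 (cov_lead cov qz) Fr (cov_simple cov qz Fr).
  by exists y; split.
have [u hu] := choice ex.
have ex2 r : exists w : C -> C, taylor 2 a w /\
    (r \in s -> forall t, w t = f (sheet q G (z + t *: v) (u r t))).
  have [rs|rs] := boolP (r \in s); last by exists (fun=> 0); split => //; exact: taylor_cst.
  exists (fun t => f (sheet q G (z + t *: v) (u r t))); split => //.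
  have [_ uT uF] := hu r.
  exact: (taylor_value_branch cov fc kFf E kz qz uT (uF rs)).
have [w hw] := choice ex2.
have qn := near_line qz.
have F0 : \forall t \near a, forall r, r \in s -> (spz (z + t *: v) F).[u r t] = 0.
  by apply: near_seq => r rs; have [_ _ h] := hu r; exact: h.
have dist : \forall t \near a, forall c, c \in [seq (r, r') | r <- s, r' <- s] ->
    c.1 != c.2 -> u c.1 t != u c.2 t.
  apply: near_seq => -[r r'] /allpairsP[[x x'] /= [xs x's [-> ->]]] {r r'}.
  have [->|xx'] := eqVneq x x'; first by apply/nearCP; exists 1.
  have [uxa uxT _] := hu x; have [ux'a ux'T _] := hu x'.
  have := @near_neq0 _ (fun t => u x t - u x' t) a (taylor_cont (taylorB uxT ux'T)).
  rewrite uxa// ux'a// subr_eq0 => /(_ xx'); apply: filterS => t.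
  by rewrite subr_eq0.
have perm : \forall t \near a, perm_eq [seq (u r t, w r t) | r <- s] (fiber (z + t *: v)).
  near=> t.
  have qt : pv q (z + t *: v) != 0 by near: t.
  have Ft : forall r, r \in s -> (spz (z + t *: v) F).[u r t] = 0 by near: t.
  have dt : forall c, c \in [seq (r, r') | r <- s, r' <- s] -> c.1 != c.2 -> u c.1 t != u c.2 t.
    by near: t.
  have uinj : {in s &, injective (u ^~ t)}.
    move=> r r' rs r's e; apply/eqP; apply: contraT => rr'.
    have /= := dt (r, r') _ rr'; rewrite e eqxx; apply.
    by apply/allpairsP; exists (r, r').
  have us : uniq [seq u r t | r <- s] by rewrite map_inj_in_uniq// uniq_rtsF.
  have sub : {subset [seq u r t | r <- s] <= rts (spz (z + t *: v) F)}.
    by move=> _ /mapP[r rs ->]; rewrite mem_rts ?spzF_neq0//; apply/eqP; exact: Ft.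
  have sz : size (rts (spz (z + t *: v) F)) = size s.
    by have := size_fiber qt; rewrite size_map => ->; have := size_fiber qz; rewrite size_map.
  have le : (size (rts (spz (z + t *: v) F)) <= size [seq u r t | r <- s])%N.
    by rewrite size_map sz.
  have [_ eqi] := uniq_min_size us sub le.
  have pe : perm_eq [seq u r t | r <- s] (rts (spz (z + t *: v) F)).
    by apply: uniq_perm => //; exact: uniq_rtsF.
  rewrite (_ : map _ s = [seq (t', f (sheet q G (z + t *: v) t')) | t' <- [seq u r t | r <- s]]).
    exact: perm_map.
  rewrite -map_comp; apply/eq_in_map => r rs /=.
  by have [_ h] := hw r; rewrite h.
have uT r : taylor 2 a (u r) by have [] := hu r.
have wT r : taylor 2 a (w r) by have [] := hw r.
apply: taylor_near (sym_taylor sym s uT wT).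
by apply: filterS perm => t; exact: sym_perm.
Unshelve. all: by end_near. Qed.

(** On a line the zeros of [Q] form the exceptional set. Near them the fiber is controlled by the
    bounds of [g] and [f] over bounded sets of the base, and at infinity by the equations of [g] and
    [f]. *)
Lemma symmetric_generic Psi : symmetric_function Psi ->
  generic_poly (fun z => Psi (fiber z)).
Proof.
move=> sym; have [Q0 Q00 [Q0q QT]] := fiber_taylor sym.
have [Ff Ff0 kFf] := fa.
pose Q := Q0 * lead_coef Ff.
have QN0 : Q != 0 by rewrite mulf_neq0// lead_coef_eq0.
have Qq z : pv Q z != 0 -> pv q z != 0 /\ pv (lead_coef Ff) z != 0.
  by rewrite pvM mulf_eq0 negb_or => /andP[/Q0q].
have [Kg Kg0 [Ng hg]] := integral_on_growth (finite_over_poly g fX).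
have [Kf Kf0 [Nf hf]] := coef_growth Ff.
have [K K0 [N hPsi]] := sym_bound sym (size F).-1.
(* The same for all lines, as interpolation requires; the successor pays for the factor [nm z] in
   the growth condition. *)
pose M := ((Ng + Nf) * N).+1.
apply: (@generic_poly_lines _ _ _ Q M QN0) => z v.
have [l0|l0] := eqVneq (lin z v Q) 0.
  by exists 0; [rewrite size_poly0|move=> t; rewrite -lin_horner l0 horner0 eqxx].
pose S := rts (lin z v Q).
have SE t : (t \notin S) = (pv Q (z + t *: v) != 0) by rewrite mem_rts// lin_horner.
have [p sp hp] : exists2 p : {poly C}, (size p <= M)%N &
    forall t, t \notin S -> Psi (fiber (z + t *: v)) = p.[t]; last first.
  by exists p => // t; rewrite -SE; exact: hp.
have nz t : nv (z + t *: v) <= nv z + nm t * nv v := nv_line z v t.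
have nz0 := nv_ge0 z; have nv0 := nv_ge0 v.
apply: polynomial_growth_poly.
- move=> t; rewrite SE => Qt; apply: QT.
  by move: Qt; rewrite pvM mulf_eq0 negb_or => /andP[].
- move=> rho; pose r := nv z + `|rho| * nv v.
  have [B hB] := fb r.
  have r0 : 0 <= r by rewrite addr_ge0// mulr_ge0.
  have Bg0 : 0 <= Kg * (1 + r) ^+ Ng by rewrite mulr_ge0// exprn_ge0//; lra.
  exists (K * (1 + Kg * (1 + r) ^+ Ng + `|B|) ^+ N) => t; rewrite SE => /Qq[qt _] tr.
  have zr : nv (z + t *: v) <= r.
    apply: le_trans (nz t) _; rewrite lerD2l ler_wpM2r//.
    by apply: le_trans tr (ler_norm _).
  apply: hPsi; first by have := normr_ge0 B; lra.
    by rewrite size_fiber.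
  move=> c /(fiberP qt)[x [Xx zx -> ->]].
  have g1 : nm (pv g x) <= Kg * (1 + r) ^+ Ng.
    apply: le_trans (hg x Xx) _; rewrite zx ler_wpM2l// lerXn2r ?nnegrE//; try lra.
    by have := nv_ge0 (z + t *: v); lra.
  have f1 : nm (f x) <= `|B|.
    by apply: le_trans (ler_norm _); apply: hB => //; rewrite zx.
  by have := normr_ge0 B; have := nm_ge0 (pv g x); have := nm_ge0 (f x); split; lra.
(* Far out on the line the leading coefficient of the equation of [f] is at least [c] in modulus, so
   that the bound on the roots is polynomial in [t]. *)
- have lf0 : lin z v (lead_coef Ff) != 0.
    by apply: contra l0 => /eqP e; rewrite rmorphM /= e mulr0.
  have [c c0 [rho hrho]] := poly_large lf0.
  pose A := 1 + nv z + nv v.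
  have A1 : 1 <= A by rewrite /A; lra.
  pose D := 1 + Kg + Kf / c.
  have Kfc : 0 <= Kf / c by rewrite divr_ge0// ltW.
  have D1 : 1 <= D by rewrite /D; lra.
  exists (K * (D * A ^+ (Ng + Nf)) ^+ N), (1 + `|rho|) => t; rewrite SE => /Qq[qt lt0] tr.
  have t1 : 1 <= nm t by have := normr_ge0 rho; lra.
  have rt : rho <= nm t by have := ler_norm rho; lra.
  have zA : 1 + nv (z + t *: v) <= A * nm t.
    by have := nz t; rewrite /A; nra.
  have z1 : 1 <= 1 + nv (z + t *: v) by have := nv_ge0 (z + t *: v); lra.
  have At1 : 1 <= A * nm t by rewrite mulr_ege1.
  pose B := D * (A * nm t) ^+ (Ng + Nf).
  have pw N' : (N' <= Ng + Nf)%N -> (1 + nv (z + t *: v)) ^+ N' <= (A * nm t) ^+ (Ng + Nf).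
    move=> le; apply: le_trans (_ : (A * nm t) ^+ N' <= _); last by rewrite ler_weXn2l.
    by rewrite lerXn2r ?nnegrE//; lra.
  have pp : 1 <= (A * nm t) ^+ (Ng + Nf) by rewrite exprn_ege1.
  have hb : nm (Psi (fiber (z + t *: v))) <= K * B ^+ N.
    apply: hPsi; [by rewrite mulr_ege1|by rewrite size_fiber|].
    move=> cc /(fiberP qt)[x [Xx zx -> ->]]; split.
      apply: le_trans (hg x Xx) _; rewrite zx /B ler_pM ?exprn_ge0 ?pw ?leq_addr//; try lra.
      by rewrite /D; lra.
    have := root_bound _ (kFf (exist _ x Xx)) (hf _); rewrite /base_pt /= zx.
    rewrite -lead_coef_eq0 lead_coef_spz// => /(_ lt0).
    have := hrho t rt; rewrite lin_horner => h1 h2.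
    have : c * nm (f x) <= Kf * (A * nm t) ^+ (Ng + Nf).
      apply: le_trans (_ : Kf * (1 + nv (z + t *: v)) ^+ Nf <= _); last first.
        by rewrite ler_wpM2l// pw// leq_addl.
      by apply: le_trans h2; rewrite ler_wpM2r ?nm_ge0.
    rewrite mulrC -ler_pdivlMr// => /le_trans; apply.
    rewrite /B mulrAC ler_wpM2r//; first lra.
    by rewrite /D; lra.
  rewrite /M exprSr mulrA ler_wpM2r ?nm_ge0//; apply: le_trans hb _.
  by rewrite -mulrA ler_wpM2l// exprM -exprMn -mulrA -exprMn.
Qed.

End SymmetricFunctions.

(** * The characteristic polynomial and Lagrange interpolation on a fiber *)

Section FiberPolynomials.
Variable R : realType.
Local Notation C := (Cplx R).

Section Product.
Variables (Phi : C * C -> {poly {poly C}}) (al be ga : nat -> nat -> C).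
Hypothesis PhiE : forall c i k, (Phi c)`_i`_k = al i k + be i k * c.1 + ga i k * c.2.
Hypothesis al1 : forall i k, nm (al i k) <= 1.
Hypothesis be1 : forall i k, nm (be i k) <= 1.
Hypothesis ga1 : forall i k, nm (ga i k) <= 1.

Let prodE c l i k : (\prod_(c <- c :: l) Phi c)`_i`_k =
  \sum_(j < i.+1) \sum_(j' < k.+1) (Phi c)`_j`_j' * (\prod_(c <- l) Phi c)`_(i - j)`_(k - j').
Proof. by rewrite big_cons coefM coef_sum; apply: eq_bigr => j _; rewrite coefM. Qed.

(** A coefficient of one factor is at most [1 + B + B <= 3 * B], and the coefficient of index [i],
    [k] of a product of two is a sum of [i.+1 * k.+1] terms. *)
Let prod_bound l (B : R) i k : 1 <= B -> (forall c, c \in l -> nm c.1 <= B /\ nm c.2 <= B) ->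
  nm ((\prod_(c <- l) Phi c)`_i`_k) <= (i.+1%:R * k.+1%:R * (3 * B)) ^+ size l.
Proof.
move=> B1; elim: l i k => [|c l IH] i k hl.
  rewrite big_nil expr0 coef1; case: eqP => _ /=; last by rewrite coef0 nm0.
  by rewrite coef1 nm_nat; case: eqP.
have hc : nm c.1 <= B /\ nm c.2 <= B by apply: hl; exact: mem_head.
have {}hl c' : c' \in l -> nm c'.1 <= B /\ nm c'.2 <= B.
  by move=> cl; apply: hl; rewrite in_cons cl orbT.
rewrite prodE /= exprS -mulrA.
have ik : 0 <= (i.+1%:R * k.+1%:R * (3 * B)) ^+ size l.
  by rewrite exprn_ge0// !mulr_ge0//; lra.
apply: le_trans (nm_sum _ _) _.
have step (j : 'I_i.+1) (j' : 'I_k.+1) :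
    nm ((Phi c)`_j`_j' * (\prod_(c <- l) Phi c)`_(i - j)`_(k - j')) <=
    3 * B * (i.+1%:R * k.+1%:R * (3 * B)) ^+ size l.
  rewrite nmM ler_pM ?nm_ge0//.
    rewrite PhiE; have := nmD (al j j' + be j j' * c.1) (ga j j' * c.2).
    have := nmD (al j j') (be j j' * c.1); rewrite !nmM.
    have := al1 j j'; have := be1 j j'; have := ga1 j j'.
    have := nm_ge0 (be j j'); have := nm_ge0 (ga j j').
    have := nm_ge0 c.1; have := nm_ge0 c.2; case: hc; nra.
  apply: le_trans (IH _ _ hl) _; rewrite lerXn2r ?nnegrE ?mulr_ge0//; try lra.
  rewrite ler_wpM2r ?mulr_ge0//; try lra.
  by rewrite ler_pM ?ler_nat ?ltnS ?leq_subr.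
apply: le_trans (_ : \sum_(j < i.+1) \sum_(j' < k.+1)
    (3 * B * (i.+1%:R * k.+1%:R * (3 * B)) ^+ size l) <= _).
  apply: ler_sum => j _; apply: le_trans (nm_sum _ _) _.
  by apply: ler_sum => j' _; exact: step.
rewrite !sumr_const !card_ord -mulrnA -[leLHS]mulr_natl natrM.
by rewrite le_eqVlt; apply/orP; left; apply/eqP; ring.
Qed.

(** The shape of [Phi] covers both the factors of the characteristic polynomial and those that
    produce the Lagrange numerator. *)
Lemma product_symmetric i k : symmetric_function (fun l => (\prod_(c <- l) Phi c)`_i`_k).
Proof.
split.
- by move=> l l' ll'; rewrite (perm_big _ ll').
- move=> I s u w a hu hw; elim: s i k => [|j s IH] i k.
    rewrite (_ : (fun _ => _) = (fun=> (1 : {poly {poly C}})`_i`_k)); first exact: taylor_cst.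
    by apply/funext => t; rewrite big_nil.
  rewrite (_ : (fun _ => _) = (fun t => \sum_(b < i.+1) \sum_(b' < k.+1)
     (al b b' + be b b' * u j t + ga b b' * w j t) *
     (\prod_(c <- [seq (u i t, w i t) | i <- s]) Phi c)`_(i - b)`_(k - b'))).
    apply: taylor_bigsum => b; apply: taylor_bigsum => b'; apply: taylorM; last exact: IH.
    by apply: taylorD; [apply: taylorD|]; rewrite ?mulrC;
      [exact: taylor_cst|apply: taylorM; [exact: taylor_cst|exact: hu]|
       apply: taylorM; [exact: taylor_cst|exact: hw]].
  apply/funext => t; rewrite /= prodE; apply: eq_bigr => b _; apply: eq_bigr => b' _.
  by rewrite PhiE.
- move=> m; exists ((i.+1%:R * k.+1%:R * 3) ^+ m).
    by rewrite exprn_ge0// !mulr_ge0.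
  exists m => l B B1 sl hl; rewrite -exprMn -(mulrA _ 3) -sl; exact: prod_bound.
Qed.
End Product.

Lemma generic_family d (h : nat -> 'rV[C]_d -> C) m : (forall k, generic_poly (h k)) ->
  exists (H : nat -> mpoly d C) (q : mpoly d C), q != 0 /\
    forall z, pv q z != 0 -> forall k, (k < m)%N -> h k z = pv (H k) z.
Proof.
move=> hg; elim: m => [|m [H [q [q0 hq]]]].
  by exists (fun=> 0), 1; rewrite oner_neq0.
have [Hm [qm [qm0 hqm]]] := hg m.
exists (fun k => if k == m then Hm else H k), (q * qm); rewrite mulf_neq0//; split => // z.
rewrite pvM mulf_eq0 negb_or => /andP[qz qmz] k; rewrite ltnS leq_eqVlt.
by case: eqP => [->|_ /=] => [_|km]; [exact: hqm|exact: hq].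
Qed.

Definition gcomp n d (zt : 'I_d -> mpoly n C) (g : mpoly n C) (Q : {poly mpoly d C}) :=
  (map_poly (psub zt) Q).[g].

Lemma pv_gcomp n d (zt : 'I_d -> mpoly n C) g Q x :
  pv (gcomp zt g Q) x = (spz (pmap zt x) Q).[pv g x].
Proof.
rewrite /gcomp; elim/poly_ind: Q => [|Q c IH].
  by rewrite !rmorph0 !horner0 pv0.
rewrite !rmorphD !rmorphM /= map_polyX spzX map_polyC spzC hornerMXaddC hornerMXaddC.
by rewrite pvD pvM IH /= pv_psub.
Qed.

Variables (n d : nat) (X : set 'rV[C]_n) (zt : 'I_d -> mpoly n C).
Variables (g : mpoly n C) (F : {poly mpoly d C}) (q : mpoly d C) (G : 'I_n -> {poly mpoly d C}).
Hypothesis fX : finite_over X zt.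
Hypothesis cov : covering X zt g F q G.
Variable f : 'rV[C]_n -> C.
Hypothesis fc : cont_on X f.
Hypothesis fa : algebraic (@base_pt _ _ _ X zt) (fun x => f (sval x)).
Hypothesis fb : forall rho : R, exists B : R, forall x, X x -> nv (pmap zt x) <= rho -> nm (f x) <= B.

Lemma mem_fiber x : X x -> pv q (pmap zt x) != 0 ->
  (pv g x, f x) \in fiber F q G f (pmap zt x).
Proof.
move=> Xx qx; apply/mapP; exists (pv g x).
  rewrite mem_rts ?(spzF_neq0 cov)//; apply/eqP.
  by have [_ kF _] := cov_minimal cov; exact: (kF (exist _ x Xx)).
congr (_, f _); apply/rowP => i; rewrite mxE -(cov_coord cov)//.
by rewrite mulrC mulKf.
Qed.

(** The coefficients of the product are symmetric functions of the fiber. The leading coefficient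
    [1] is imposed, so that [P] is monic everywhere and not only off [q']. *)
Lemma characteristic_polynomial : exists (P : {poly mpoly d C}) (q' : mpoly d C),
  [/\ P \is monic, q' != 0 & forall z, pv q' z != 0 -> pv q z != 0 /\
    spz z P = \prod_(c <- fiber F q G f z) ('X - c.2%:P)].
Proof.
pose Phi (c : C * C) : {poly {poly C}} := ('X - c.2%:P)%:P.
have PhiE c i k : (Phi c)`_i`_k = ((i == 0%N) && (k == 1%N))%:R + 0 * c.1 +
    - ((i == 0%N) && (k == 0%N))%:R * c.2.
  rewrite /Phi coefC; case: eqP => _ /=; last by rewrite coef0 oppr0 !mul0r !addr0.
  rewrite coefB coefX coefC mul0r addr0 mulNr; congr (_ - _).
  by case: eqP; rewrite ?mul1r ?mul0r.
have b1 (b : bool) : nm (b%:R : C) <= 1 by rewrite nm_nat; case: b.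
have [|H [q1 [q10 hH]]] := @generic_family _ (fun k z => (\prod_(c <- fiber F q G f z) Phi c)`_0`_k) (size F).-1.
  move=> k; apply: (symmetric_generic fX cov fc fa fb (Psi := fun l => (\prod_(c <- l) Phi c)`_0`_k)).
  apply: (product_symmetric PhiE) => i j //; first by rewrite nm0.
  by rewrite nmN.
have PhiP l : (\prod_(c <- l) Phi c)`_0 = \prod_(c <- l) ('X - c.2%:P).
  by rewrite -rmorph_prod coefC.
pose P := 'X^((size F).-1) + \poly_(k < (size F).-1) H k.
exists P, (q * q1); split.
- by rewrite monicE lead_coefDl ?lead_coefXn// size_polyXn ltnS size_poly.
- by rewrite mulf_neq0// (cov_q cov).
- move=> z; rewrite pvM mulf_eq0 negb_or => /andP[qz q1z]; split => //.
  set l := fiber F q G f z; have sl : size l = (size F).-1 by exact: (size_fiber cov).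
  have sP : size (\prod_(c <- l) ('X - c.2%:P)) = (size F).-1.+1 by rewrite size_prod_XsubC sl.
  have mP : \prod_(c <- l) ('X - c.2%:P) \is monic by exact: monic_prod_XsubC.
  apply/polyP => k; rewrite coef_spz coefD pvD coefXn coef_poly.
  have [km|km] := ltnP k (size F).-1.
    rewrite ltn_eqF// -[0%:R]/0 pv0 add0r -hH// PhiP.
    by [].
  rewrite pv0 addr0; have [->|kn] := eqVneq k (size F).-1.
    by rewrite pv1; move/monicP: mP; rewrite /lead_coef sP.
  by rewrite pv0 nth_default// sP ltn_neqAle eq_sym kn.
Qed.

(** The coefficient of the outer variable [Y] in the product of the [t - c.1 + c.2 Y] over the fiber
    is the numerator [N] of Lagrange interpolation; at [t = pv g x] it satisfies
    [lead_coef F * N = f x * F']. The Bezout relation turns division by [F'] into multiplication by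
    [V]. *)
Lemma denominator : exists (a : mpoly d C) (p : mpoly n C), a != 0 /\
  forall x, X x -> pv a (pmap zt x) * f x = pv p x.
Proof.
pose Phi (c : C * C) : {poly {poly C}} := ('X - c.1%:P)%:P + (c.2%:P) *: 'X.
have PhiE c i k : (Phi c)`_i`_k = ((i == 0%N) && (k == 1%N))%:R +
    - ((i == 0%N) && (k == 0%N))%:R * c.1 + ((i == 1%N) && (k == 0%N))%:R * c.2.
  rewrite /Phi coefD coefC coefZ coefX coefD; case: i => [|[|i]] /=.
  - rewrite coefB coefX coefC mulr0 coef0 mul0r !addr0 mulNr; congr (_ - _).
    by case: eqP; rewrite ?mul1r ?mul0r.
  - rewrite coef0 mulr1 coefC oppr0 mul0r !add0r.
    by case: eqP; rewrite ?mul1r ?mul0r.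
  - by rewrite coef0 mulr0 coef0 oppr0 !mul0r !addr0.
have b1 (b : bool) : nm (b%:R : C) <= 1 by rewrite nm_nat; case: b.
have [|H [q1 [q10 hH]]] := @generic_family _ (fun k z => (\prod_(c <- fiber F q G f z) Phi c)`_1`_k) (size F).-1.+1.
  move=> k; apply: (symmetric_generic fX cov fc fa fb (Psi := fun l => (\prod_(c <- l) Phi c)`_1`_k)).
  by apply: (product_symmetric PhiE) => i j //; rewrite nmN.
have sPhi (l : seq (C * C)) i : (size ((\prod_(c <- l) Phi c)`_i)%R <= (size l).+1)%N.
  elim: l i => [|c l IH] i /=.
    by rewrite big_nil coef1; case: eqP => _; rewrite ?size_poly1 ?size_poly0.
  have -> : (\prod_(c0 <- c :: l) Phi c0)`_i = ('X - c.1%:P) * (\prod_(c <- l) Phi c)`_i +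
     c.2 *: (if i is i'.+1 then (\prod_(c <- l) Phi c)`_i' else 0).
    rewrite big_cons mulrDl coefD -scalerAl coefZ mulrC coefMC mulrC mul_polyC coefXM.
    by case: i.
  apply: leq_trans (size_polyD _ _) _; rewrite geq_max; apply/andP; split.
    by apply: leq_trans (size_polyMleq _ _) _; rewrite size_XsubC addSn /= add1n ltnS.
  apply: leq_trans (size_scale_leq _ _) _.
  by case: i => [|i]; rewrite ?size_poly0// (leq_trans (IH i)).
pose P := \poly_(k < (size F).-1.+1) H k.
have PE z : pv (q * q1) z != 0 -> spz z P = (\prod_(c <- fiber F q G f z) Phi c)`_1.
  rewrite pvM mulf_eq0 negb_or => /andP[qz q1z].
  apply/polyP => k; rewrite coef_spz coef_poly; case: ltnP => km; first by rewrite -hH.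
  rewrite pv0 nth_default//; apply: leq_trans (sPhi _ _) _.
  by rewrite (size_fiber cov).
have [U [V [k0 [k00 E]]]] := cov_bezout cov.
(* The factor [q * q1] makes both sides vanish at the points where [P] and the fiber are not under
   control. *)
exists (q * q1 * k0), (psub zt (q * q1 * lead_coef F) * gcomp zt g (V * P)).
split; first by rewrite !mulf_neq0// (cov_q cov).
move=> x Xx; rewrite [RHS]pvM pv_psub pv_gcomp spzM hornerM.
set z := pmap zt x; rewrite [pv (q * q1 * k0) z]pvM [pv (q * q1 * lead_coef F) z]pvM.
have [->|qq] := eqVneq (pv (q * q1) z) 0; first by rewrite !mul0r.
rewrite -!mulrA; congr (_ * _); rewrite PE//.
have qz : pv q z != 0 by move: qq; rewrite pvM mulf_eq0 negb_or => /andP[].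
set t := pv g x; set l := fiber F q G f z.
have tl : (t, f x) \in l by exact: mem_fiber.
have pl := perm_to_rem tl; set l' := rem _ _ in pl.
have Ft : (spz z F).[t] = 0.
  by have [_ kF _] := cov_minimal cov; exact: (kF (exist _ x Xx)).
have FE : spz z F = pv (lead_coef F) z *: \prod_(c <- (t, f x) :: l') ('X - c.1%:P).
  rewrite -(perm_big _ pl) /= /l /fiber big_map {1}[spz z F]rtsE lead_coef_spz//.
  exact: (cov_lead cov).
have F't : (spz z F)^`().[t] = pv (lead_coef F) z * \prod_(c <- l') (t - c.1).
  rewrite FE big_cons /= derivZ derivM derivXsubC mul1r hornerZ hornerD hornerM hornerXsubC.
  rewrite subrr mul0r addr0 horner_prod; congr (_ * _); apply: eq_bigr => c _.
  by rewrite hornerXsubC.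
have NE : ((\prod_(c <- l) Phi c)`_1).[t] = f x * \prod_(c <- l') (t - c.1).
  have Q0 : ((\prod_(c <- l') Phi c)`_0).[t] = \prod_(c <- l') (t - c.1).
    elim: (l') => [|c s IH]; first by rewrite !big_nil coef1 hornerC.
    rewrite !big_cons coef0M hornerM IH; congr (_ * _).
    by rewrite /Phi coefD coefC coefZ coefX mulr0 addr0 hornerXsubC.
  rewrite (perm_big _ pl) /= big_cons coefM big_ord_recl big_ord1 /= hornerD !hornerM.
  rewrite /Phi /= !coefD !coefC !coefZ !coefX /= mulr0 addr0 hornerXsubC subrr mul0r add0r.
  by rewrite mulr1 add0r hornerC Q0.
have Vk : (spz z V).[t] * (spz z F)^`().[t] = pv k0 z.
  have := congr1 (fun P => (spz z P).[t]) E.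
  by rewrite /= spzD !spzM hornerD !hornerM Ft mulr0 add0r spzC hornerC -deriv_spz.
by rewrite NE -Vk F't; ring.
Qed.

End FiberPolynomials.

(** * Rationality and integrality *)

Section Compactness.
Variable R : realType.
Local Notation C := (Cplx R).

Lemma near_rowP n (x : 'rV[C]_n) (P : 'rV[C]_n -> Prop) :
  (\forall y \near x, P y) <-> exists2 d : R, 0 < d & forall y, near_row d x y -> P y.
Proof.
split=> [/nbhs_ballP[e /= /gt0_rc[eE e0] h]|[d d0 h]].
  exists (nm e) => // y hy; apply: h; split; first by rewrite eE -[0]/(rc 0) ltr_rc.
  move=> i j; rewrite ord1; have := hy j.
  by rewrite /ball /= distrC normE eE ltr_rc.
apply/nbhs_ballP; exists (rc d) => /=; first by rewrite -[0]/(rc 0) ltr_rc.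
move=> y [_ hy]; apply: h => i; have := hy ord0 i.
by rewrite /ball /= distrC normE ltr_rc.
Qed.

Lemma compact_disc (K : R) : compact [set c : C | exists2 p, c = mkC p & `|p.1| <= K /\ `|p.2| <= K].
Proof.
have cpt : compact (`[- K, K]%classic `*` `[- K, K]%classic : set (R * R)).
  by apply: compact_setX; exact: segment_compact.
have mkc : continuous (@mkC R : R * R -> C).
  move=> p; apply/(@cvg_nmP _ _ (nbhs p)) => e e0.
  have e20 : 0 < e / 2 by lra.
  have := nbhsx_ballx p (e / 2) e20; apply: filterS => y [/= k1 k2].
  rewrite /ball /= in k1 k2; change (nm (mkC y - mkC p) < e); rewrite mkCB; apply: le_lt_trans (nm_mkC_le _) _ => /=.
  by rewrite distrC [`|y.2 - _|]distrC; lra.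
have := continuous_compact (continuous_subspaceT mkc) cpt.
congr compact; apply/seteqP; split=> [c [p [/= + +] <-]|c [p -> [p1 p2]]].
  by rewrite !in_itv /= -!ler_norml => p1 p2; exists p.
by exists p => //; split => /=; rewrite in_itv /= -ler_norml.
Qed.

(** Compactness of the box in covering form. The hypothesis is a local bound rather than continuity,
    because one of the functions it serves is discontinuous. *)
Lemma locally_bounded_box n (X : set 'rV[C]_n) (phi : 'rV[C]_n -> R) (K : R) :
  (forall x, exists2 d : R, 0 < d & exists B, forall y, near_row d x y -> X y -> phi y <= B) ->
  exists B, forall y, X y -> (forall i, nm (y ord0 i) <= K) -> phi y <= B.
Proof.
move=> loc.
have := @rV_compact C n (fun=> [set c : C | exists2 p, c = mkC p & `|p.1| <= K /\ `|p.2| <= K])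
  (fun=> @compact_disc K).
move=> /compact_near_coveringP cov.
have near_bound (x : 'rV[C]_n) :
    \forall x' \near x & B \near pinfty_nbhs R, X x' -> phi x' <= B.
  have [d d0 [B hB]] := loc x.
  exists ([set y | near_row d x y], [set B' | B < B']).
    split => /=; first by apply/near_rowP; exists d.
    by exists B; split; [exact: num_real|].
  by move=> [y B'] [/= hy BB'] Xy; apply: le_trans (ltW BB'); exact: hB.
have /filter_ex[B hB] := cov R (pinfty_nbhs R) (fun B y => X y -> phi y <= B)
  proper_pinfty_nbhs (fun x _ => near_bound x).
exists B => y Xy yK; apply: hB => //= i.
have [p yE] := mkC_surj (y ord0 i); exists p => //.
by have := yK i; rewrite yE; have [] := nm_mkC_ge p; split; lra.
Qed.

Lemma pv_near0 n (p : mpoly n C) x : pv p x != 0 ->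
  exists2 d : R, 0 < d & forall y, near_row d x y -> pv p y != 0.
Proof.
rewrite -nm_gt0 => px; have [d d0 h] := pv_cont p x px; exists d => // y /h.
by apply: contraTneq => ->; rewrite sub0r nmN ltxx.
Qed.

Lemma zariski_closed_complement n (X : set 'rV[C]_n) x : zariski_closed X -> ~ X x ->
  exists2 d : R, 0 < d & forall y, near_row d x y -> ~ X y.
Proof.
move=> [I XI] nXx.
have [p Ip px] : exists2 p, I p & pv p x != 0.
  apply: contrapT => h; apply: nXx; rewrite XI => p Ip; apply/eqP; apply: contraT => px.
  by case: h; exists p => //; rewrite pv.unlock.
have [d d0 h] := pv_near0 px; exists d => // y /h py Xy.
by move: py; rewrite pv.unlock; move: Xy; rewrite XI => /(_ p Ip) ->; rewrite eqxx.
Qed.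

(** Finite maps are proper: coordinates are roots of monic equations whose coefficients are bounded
    over bounded sets. *)
Lemma finite_over_box n d (X : set 'rV[C]_n) (zt : 'I_d -> mpoly n C) (rho : R) :
  finite_over X zt ->
  exists K : R, forall x, X x -> nv (pmap zt x) <= rho -> forall i, nm (x ord0 i) <= K.
Proof.
move=> fX.
have ex i : exists k : R, 0 <= k /\
    forall x, X x -> nv (pmap zt x) <= rho -> nm (x ord0 i) <= k.
  have [K K0 [N h]] := integral_on_growth (fX i).
  exists (K * (1 + `|rho|) ^+ N); split; first by rewrite mulr_ge0 ?exprn_ge0 ?addr_ge0.
  move=> x Xx hx; apply: le_trans (h x Xx) _; rewrite ler_wpM2l// lerXn2r ?nnegrE ?addr_ge0 ?nv_ge0//.
  by rewrite lerD2l (le_trans hx) ?ler_norm.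
have [Kf hK] := choice ex.
exists (\sum_i Kf i) => x Xx hx i; have [_ /(_ x Xx hx) h] := hK i.
apply: le_trans h _; rewrite (bigD1 i)//= lerDl; apply: sumr_ge0 => j _.
by have [] := hK j.
Qed.

Lemma bounded_over n d (X : set 'rV[C]_n) (zt : 'I_d -> mpoly n C) f :
  zariski_closed X -> finite_over X zt -> cont_on X f ->
  forall rho : R, exists B : R, forall x, X x -> nv (pmap zt x) <= rho -> nm (f x) <= B.
Proof.
move=> cX fX fc rho; have [K hK] := finite_over_box rho fX.
have [|B hB] := @locally_bounded_box n X (fun x => nm (f x)) K.
  move=> x; have [Xx|nXx] := pselect (X x).
    have [d0 d00 h] := fc x Xx 1 ltr01; exists d0 => //; exists (nm (f x) + 1) => y hy Xy.
    by have := nm_sub (f y) (f x); have := h y Xy hy; lra.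
  have [d0 d00 h] := zariski_closed_complement cX nXx.
  by exists d0 => //; exists 0 => y /h.
by exists B => x Xx hx; apply: hB => //; exact: hK.
Qed.

Lemma cont_on_sub n (X Y : set 'rV[C]_n) f : Y `<=` X -> cont_on X f -> cont_on Y f.
Proof.
move=> YX fc x /YX Xx e /(fc x Xx)[d d0 h]; exists d => // y /YX; exact: h.
Qed.

Lemma continuous_cont_on n (X : set 'rV[C]_n) (f : X -> C) (f' : 'rV[C]_n -> C) :
  continuous f -> (forall x : X, f' (set_val x) = f x) -> cont_on X f'.
Proof.
move=> fc ff' x Xx e e0.
have := fc (exist _ x (mem_set Xx)) => /(@cvg_nmP _ _ (nbhs _) f) /(_ e e0).
rewrite /nbhs /= => -[_ /= [[W oW <-] /= Wx sWU]].
have /near_rowP[d d0 h] : \forall y \near x, W y by apply: open_nbhs_nbhs; split.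
exists d => // y Xy /h Wy; have := sWU (exist _ y (mem_set Xy)) Wy.
by rewrite /= -!ff'.
Qed.

End Compactness.

(** * Integral functions are rational; denominators in the base *)

Section RationalFunctions.
Variable R : realType.
Local Notation C := (Cplx R).

(* The ideal of denominators of [f] vanishes on no nonempty Zariski open subset of [X] *)
Definition has_dense_denominators n (X : set 'rV[C]_n) (f : 'rV[C]_n -> C) :=
  forall r : mpoly n C, (exists2 x, X x & pv r x != 0) ->
  exists x, [/\ X x, pv r x != 0 &
    exists b p : mpoly n C, (forall y, X y -> pv b y * f y = pv p y) /\ pv b x != 0].

Lemma integral_on_algebraic n d (X : set 'rV[C]_n) (zt : 'I_d -> mpoly n C) f :
  integral_on X (pmap zt) f -> algebraic (@base_pt _ _ _ X zt) (fun x => f (sval x)).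
Proof.
move=> [P Pm hP]; exists P; first exact: monic_neq0.
by move=> [x Xx]; exact: hP.
Qed.

Lemma zariski_closedI n (X : set 'rV[C]_n) (p : mpoly n C) : zariski_closed X ->
  zariski_closed (X `&` [set x | pv p x = 0]).
Proof.
move=> [I XI]; exists (I `|` [set p]); apply/seteqP; split=> [x [Xx px] p' [Ip'|->]|x h].
- by move: Xx; rewrite XI; apply.
- by move: px; rewrite /= pv.unlock.
- split; last by rewrite /= pv.unlock; apply: h; right.
  by rewrite XI => p' Ip'; apply: h; left.
Qed.

Lemma pv0_var (a : mpoly 0 C) z : a != 0 -> pv a z != 0.
Proof. by move=> /pv_nonzero[x]; rewrite (_ : x = z)//; apply/rowP => -[]. Qed.

(** Either the denominator [a] is nonzero somewhere on the open set [r != 0] of [X], or this set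
    lies in the part [Y] over [a = 0], finite over a smaller space. A denominator on [Y] becomes one
    on [X] after multiplication by [r], which vanishes on the rest of [X]. *)
Lemma integral_dense_denominators d : forall n (X : set 'rV[C]_n) (zt : 'I_d -> mpoly n C) f,
  zariski_closed X -> finite_over X zt -> cont_on X f -> integral_on X id f ->
  has_dense_denominators X f.
Proof.
elim: d => [|d IH] n X zt f cX fX fc fi r [x Xx rx];
  have [g [F [q [G cov]]]] := covering_exists cX fX;
  have fa := integral_on_algebraic (integral_on_trans fX fi);
  have [a [p [a0 hp]]] := denominator fX cov fc fa (bounded_over cX fX fc).
  exists x; split => //; exists (psub zt a), p; split; last by rewrite pv_psub pv0_var.
  by move=> y Xy; rewrite pv_psub hp.
have [[x' Xx' rax']|rax] := pselect (exists2 x', X x' & pv (r * psub zt a) x' != 0).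
  move: rax'; rewrite pvM mulf_eq0 negb_or => /andP[rx' ax'].
  exists x'; split => //; exists (psub zt a), p; split => // y Xy.
  by rewrite pv_psub hp.
pose Y := X `&` [set y | pv (psub zt a) y = 0].
have YX : Y `<=` X by move=> y [].
have hrY y : X y -> pv r y != 0 -> Y y.
  move=> Xy ry; split => //=; apply/eqP; apply: contraT => ay; case: rax.
  by exists y => //; rewrite pvM mulf_neq0.
have [zt' fY] : exists zt' : 'I_d -> mpoly n C, finite_over Y zt'.
  apply: noether_step a0 _ (finite_over_sub YX fX) => y [_ /=].
  by rewrite pv_psub.
have fiY : integral_on Y id f by have [P Pm hP] := fi; exists P => // y /YX/hP.
have [|x' [Yx' rx' [b [p' [hb bx']]]]] :=
    IH n Y zt' f (zariski_closedI _ cX) fY (cont_on_sub YX fc) fiY r.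
  by exists x => //; exact: hrY.
exists x'; split=> //; first exact: YX.
exists (r * b), (r * p'); split; last by rewrite pvM mulf_neq0.
move=> y Xy; rewrite !pvM -mulrA; have [->|ry] := eqVneq (pv r y) 0.
  by rewrite !mul0r.
by rewrite hb//; exact: hrY.
Qed.

(** The [Q] for which [Q (z, g) f] is a polynomial on [X] form an ideal [J] containing [F]; let [D]
    have least degree in it. If [D] had positive degree, then [F = E D] up to a base factor, [E]
    could not kill [g], and [D] would vanish at the points where [E] does not. Density provides a
    denominator that is nonzero at such a point, yet [D] divides it up to base factors. *)
Lemma dense_denominators_base n d (X : set 'rV[C]_n) (zt : 'I_d -> mpoly n C) g F q G f :
  covering X zt g F q G -> has_dense_denominators X f ->
  exists (a : mpoly d C) (p : mpoly n C), a != 0 /\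
    forall x, X x -> pv a (pmap zt x) * f x = pv p x.
Proof.
move=> cov rf; have [F0 kF Fmin] := cov_minimal cov.
pose J (Q : {poly mpoly d C}) := exists p : mpoly n C, forall x, X x ->
  (spz (pmap zt x) Q).[pv g x] * f x = pv p x.
have JF : J F.
  by exists 0 => x Xx; rewrite pv0 [X in X * _](kF (exist _ x Xx)) mul0r.
have JM Q Q' : J Q -> J (Q' * Q).
  move=> [p hp]; exists (gcomp zt g Q' * p) => x Xx.
  by rewrite pvM pv_gcomp -hp// spzM hornerM mulrA.
have JB Q Q' : J Q -> J Q' -> J (Q - Q').
  move=> [p hp] [p' hp']; exists (p - p') => x Xx.
  by rewrite pvB -hp// -hp'// spzB hornerD hornerN mulrBl.
have ex : exists k, `[< exists D, [/\ D != 0, J D & size D = k] >].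
  by exists (size F); apply/asboolP; exists F.
case: (ex_minnP ex) => k /asboolP[D [D0 JD sD]] kmin.
have Dmin Q : J Q -> exists k Q', lead_coef D ^+ k *: Q = Q' * D.
  move=> JQ; exists (scalp Q D), (Q %/ D).
  have E := Pdiv.Idomain.divp_eq Q D; suff r0 : Q %% D = 0 by rewrite E r0 addr0.
  apply/eqP; apply: contraT => r0.
  have Jr : J (Q %% D).
    have -> : Q %% D = (lead_coef D ^+ scalp Q D)%:P * Q - Q %/ D * D.
      by rewrite mul_polyC E addrC addKr.
    by apply: (JB); [exact: (JM)|exact: (JM)].
  have := kmin (size (Q %% D)); rewrite -sD leqNgt ltn_modp D0; apply.
  by apply/asboolP; exists (Q %% D).
have [sD1|sD1] := leqP (size D) 1.
  have DE := size1_polyC sD1; have [p hp] := JD; exists D`_0, p; split.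
    by rewrite -polyC_eq0 -DE.
  by move=> x Xx; rewrite -hp// [in RHS]DE spzC hornerC.
exfalso; have [k' [E hE]] := Dmin F JF.
set c := lead_coef D ^+ k' in hE.
have c0 : c != 0 by rewrite expf_neq0// lead_coef_eq0.
have E0 : E != 0.
  apply: contra F0 => /eqP E0; move/eqP: hE; rewrite E0 mul0r scale_poly_eq0 (negbTE c0).
  by [].
have sE : (size E < size F)%N.
  have := f_equal (fun p : {poly mpoly d C} => size p) hE.
  rewrite size_scale// size_mul// => ->.
  by case: (size D) sD1 => [|[|j]]// _; rewrite !addnS /= ltnS leq_addr.
pose a := q * lead_coef D.
have a0 : a != 0 by rewrite mulf_neq0 ?lead_coef_eq0// (cov_q cov).
have [[x Xx] hx] : exists x : {x | X x}, (spz (base_pt zt x) (a *: E)).[pv g (sval x)] != 0.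
  apply: contrapT => h; have := Fmin (a *: E) _ _; rewrite size_scale// leqNgt sE => h'.
  suff : false by [].
  apply: h'; last by rewrite scale_poly_eq0 negb_or a0.
  by move=> x; apply/eqP; apply: contraT => hx; case: h; exists x.
have [|x' [Xx' rx' [b [p [hb bx']]]]] := rf (gcomp zt g (a *: E)).
  by exists x => //; rewrite pv_gcomp.
rewrite pv_gcomp spzZ hornerZ pvM !mulf_eq0 !negb_or -andbA in rx'.
move/and3P: rx' => [qx' lx' Ex'].
have [N [P hP]] := sheet_homogenize q G b.
have sheetE y : X y -> pv q (pmap zt y) != 0 ->
    (spz (pmap zt y) P).[pv g y] = pv q (pmap zt y) ^+ N * pv b y.
  move=> Xy qy; rewrite hP//; congr (_ * pv _ _); apply/rowP => i.
  by rewrite mxE -(cov_coord cov)// mulrC mulKf.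
(* Up to powers of [q] the denominator [b] is a polynomial in [z] and [g], hence yields an element
   of [J]. *)
have JP : J (q%:P * P).
  exists (psub zt (q ^+ N.+1) * p) => y Xy.
  rewrite pvM pv_psub spzM hornerM spzC hornerC -hb// pvXn.
  have [->|qy] := eqVneq (pv q (pmap zt y)) 0; first by rewrite exprS !mul0r.
  by rewrite sheetE// exprS !mulrA.
have [k2 [Q hQ]] := Dmin _ JP.
have D0x : (spz (pmap zt x') D).[pv g x'] = 0.
  have /eqP := congr1 (fun P => (spz (pmap zt x') P).[pv g x']) hE.
  rewrite /= spzZ hornerZ [X in _ * X == _](kF (exist _ x' Xx')) mulr0 eq_sym.
  by rewrite spzM hornerM mulf_eq0 (negbTE Ex') => /eqP.
have /eqP := congr1 (fun P => (spz (pmap zt x') P).[pv g x']) hQ.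
rewrite /= spzZ hornerZ !spzM !hornerM D0x mulr0 spzC hornerC sheetE// !pvXn.
rewrite !mulf_eq0 !expf_eq0 (negbTE lx') (negbTE qx') (negbTE bx') !andbF.
by [].
Qed.

End RationalFunctions.

(** * Euclidean density in the generic part of [X] *)

Section IntegralClosure.
Variable R : realType.
Local Notation C := (Cplx R).

(** The fiber of a finite map is finite, and the linear form in [y - x0] with coefficients [c ^+ i]
    vanishes at a given point other than [x0] for finitely many [c] only. *)
Lemma separating_form n d (X : set 'rV[C]_n) (zt : 'I_d -> mpoly n C) x0 :
  finite_over X zt -> X x0 -> exists2 h : mpoly n C, pv h x0 = 0 &
    forall y, X y -> pmap zt y = pmap zt x0 -> pv h y = 0 -> y = x0.
Proof.
move=> fX Xx0; set z := pmap zt x0.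
have ex i : exists l : seq C, forall y, X y -> pmap zt y = z -> y ord0 i \in l.
  have [P Pm hP] := fX i; exists (rts (spz z P)) => y Xy yz.
  by rewrite mem_rts ?monic_neq0 ?monic_spz// -yz hP.
have [l hl] := choice ex.
pose M := \max_i size (l i).
(* The fiber sits in the grid of all listed coordinates; lists shorter than [M] are padded with
   [0]. *)
pose w (k : {ffun 'I_n -> 'I_M}) : 'rV[C]_n := \row_i nth 0 (l i) (k i).
have hw y : X y -> pmap zt y = z -> exists k, y = w k.
  move=> Xy yz.
  have lt i : (index (y ord0 i) (l i) < M)%N.
    apply: leq_trans (leq_bigmax i); rewrite index_mem; exact: hl.
  exists [ffun i => Ordinal (lt i)]; apply/rowP => i.
  by rewrite mxE ffunE /= nth_index// hl.
pose p (y : 'rV[C]_n) : {poly C} := \sum_i (y ord0 i - x0 ord0 i) *: 'X^i.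
have p0 y : y != x0 -> p y != 0.
  apply: contra => /eqP py; apply/eqP/rowP => i; apply/eqP; rewrite -subr_eq0.
  have := congr1 (fun q : {poly C} => q`_i) py.
  rewrite /p coef_sum (bigD1 i)//= coefZ coefXn eqxx mulr1 coef0 big1 ?addr0 => [->//|j ji].
  rewrite coefZ coefXn; case: eqP => [ij|_]; last by rewrite mulr0.
  by case/eqP: ji; exact/val_inj.
have [|c hc _] := @poly_nonroot _ (\prod_(k | w k != x0) p (w k)) [::].
  by apply/prodf_neq0 => k; exact: p0.
exists (\sum_(i < n) mpolyC n (c ^+ i) * (mpolyX C (mnm1 i) - mpolyC n (x0 ord0 i))).
  by rewrite pv_sum big1// => i _; rewrite pvM pvB pvX !pvC subrr mulr0.
move=> y Xy yz hy; have [k yk] := hw y Xy yz.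
apply/eqP; apply: contraT => yx0.
have : (p (w k)).[c] != 0.
  move: hc; rewrite horner_prod => /prodf_neq0; apply; by rewrite -yk.
rewrite -yk /p horner_sum => /eqP; case; apply: etrans hy; rewrite pv_sum.
by apply: eq_bigr => i _; rewrite pvM pvB pvX !pvC hornerZ hornerXn mulrC.
Qed.

(* Points of [X] over a small neighbourhood of [zt x0] and away from [x0] stay away
   from [h = 0] *)
Lemma separation_gap n d (X : set 'rV[C]_n) (zt : 'I_d -> mpoly n C) x0 h (de : R) :
  zariski_closed X -> finite_over X zt -> 0 < de ->
  (forall y, X y -> pmap zt y = pmap zt x0 -> pv h y = 0 -> y = x0) ->
  exists2 eta : R, 0 < eta & forall y, X y -> ~ near_row de x0 y ->
    nv (pmap zt y - pmap zt x0) < eta -> eta <= nm (pv h y).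
Proof.
move=> cX fX de0 hsep; set z0 := pmap zt x0.
have [K hK] := finite_over_box (nv z0 + 1) fX.
pose psi y := nm (pv h y) + nv (pmap zt y - z0).
have psi0 y : 0 <= psi y by rewrite addr_ge0 ?nm_ge0 ?nv_ge0.
(* The inverse of [psi], cut to [0] around [x0], the only possible zero of [psi] on [X]. A bound for
   [phi] is a lower bound for [psi]. *)
pose phi y : R := if `[< near_row de x0 y >] then 0 else (psi y)^-1.
have phi_le (u : R) y : 0 < u -> u <= psi y -> phi y <= u^-1.
  move=> u0 uy; rewrite /phi; case: asboolP => _; first by rewrite invr_ge0 ltW.
  by rewrite lef_pV2// posrE (lt_le_trans u0).
have half (p : mpoly n C) c x : pv p x - c != 0 -> exists2 d0 : R, 0 < d0 &
    forall y, near_row d0 x y -> nm (pv p x - c) / 2 <= nm (pv p y - c).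
  rewrite -nm_gt0 => px; have p2 : 0 < nm (pv p x - c) / 2 by lra.
  have [d0 d00 hd] := pv_cont p x p2; exists d0 => // y /hd.
  have := nm_sub (pv p x - c) (pv p y - c).
  rewrite (_ : _ - _ - _ = pv p x - pv p y); last by ring.
  by rewrite (nmBC (pv p x) (pv p y)); lra.
have [|B hB] := @locally_bounded_box _ n X phi K.
  move=> x; have [Xx|nXx] := pselect (X x); last first.
    have [d0 d00 hd] := zariski_closed_complement cX nXx.
    by exists d0 => //; exists 0 => y /hd.
  have [hx|hx] := eqVneq (pv h x) 0; last first.
    have [|d0 d00 hd] := @half h 0 x; first by rewrite subr0.
    exists d0 => //; exists (nm (pv h x - 0) / 2)^-1 => y /hd hy _; apply: phi_le.
      by rewrite divr_gt0// nm_gt0 subr0.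
    apply: le_trans hy _; rewrite subr0 lerDl; exact: nv_ge0.
  have [zx|zx] := eqVneq (pmap zt x) z0.
    exists de => //; exists 0 => y hy _; rewrite /phi; case: asboolP => //; case.
    by rewrite -(hsep x Xx zx hx).
  have [j zj] : exists j, pv (zt j) x - z0 ord0 j != 0.
    apply: contrapT => nz; move/eqP: zx; apply; apply/rowP => j; rewrite mxE.
    apply/eqP; rewrite -subr_eq0; apply: contraT => zj; case: nz; by exists j.
  have [d0 d00 hd] := half _ _ _ zj.
  exists d0 => //; exists (nm (pv (zt j) x - z0 ord0 j) / 2)^-1 => y /hd hy _; apply: phi_le.
    by rewrite divr_gt0// nm_gt0.
  apply: le_trans hy _; apply: le_trans (_ : nv (pmap zt y - z0) <= _).
    by have := nm_le_nv (pmap zt y - z0) j; rewrite !mxE.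
  by rewrite lerDr nm_ge0.
pose B' := `|B| + 1; have B'0 : 0 < B' by rewrite ltr_wpDl.
have i0 : 0 < (2 * B')^-1 by rewrite invr_gt0 mulr_gt0.
(* The [1] confines [y] to the box given by [K]. The bound on [phi] yields [psi y >= 1 / B'], and
   the distance in the base accounts for less than half of [1 / B']. *)
exists (Num.min 1 (2 * B')^-1); first by rewrite lt_min ltr01.
move=> y Xy ny; rewrite lt_min => /andP[z1 zB]; rewrite ge_min; apply/orP; right.
have yz : nv (pmap zt y) <= nv z0 + 1.
  have := nv_line z0 (pmap zt y - z0) 1; rewrite scale1r addrC subrK nm1 mul1r.
  by lra.
have := hB y Xy (hK y Xy yz); rewrite /phi; case: asboolP => // _ hy.
(* As [0^-1 = 0], the bound on [phi y] says something about [psi y] only once this is known to be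
   nonzero. *)
have psip : 0 < psi y.
  rewrite lt_neqAle psi0 andbT eq_sym; apply/negP => /eqP e0; apply: ny.
  have h0 : nm (pv h y) = 0 by move: e0; rewrite /psi; have := nm_ge0 (pv h y); have := nv_ge0 (pmap zt y - z0); lra.
  have n0 : nv (pmap zt y - z0) = 0 by move: e0; rewrite /psi h0 add0r.
  have -> : y = x0.
    apply: hsep => //; last by apply/eqP; rewrite -nm_eq0 h0.
    apply/rowP => j; apply/eqP; rewrite -subr_eq0 -nm_eq0 eq_le nm_ge0 andbT -n0.
    by have := nm_le_nv (pmap zt y - z0) j; rewrite !mxE.
  by move=> i; rewrite subrr nm0.
have : 1 <= B' * psi y.
  rewrite -ler_pdivrMr// div1r; apply: le_trans hy _; rewrite /B'.
  by have := ler_norm B; lra.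
have : (2 * B')^-1 * B' = 2^-1 by field; rewrite gt_eqF.
have e2 : (2 * B')^-1 * (2 * B') = 1 by rewrite mulVf// gt_eqF// mulr_gt0.
rewrite /psi => e1 hp.
have : (2 * B')^-1 * 2 * 1 <= (2 * B')^-1 * 2 * (B' * (nm (pv h y) + nv (pmap zt y - z0))).
  by rewrite ler_wpM2l// mulr_ge0// ltW.
rewrite (_ : _ * (B' * _) = (2 * B')^-1 * (2 * B') * (nm (pv h y) + nv (pmap zt y - z0))); last by ring.
by rewrite e2; lra.
Qed.

(** The Zariski closure of the part of [X] over [q != 0]. *)
Definition generic_closure n d (X : set 'rV[C]_n) (zt : 'I_d -> mpoly n C) (q : mpoly d C) :=
  [set x | forall b : mpoly n C,
    (forall y, X y -> pv q (pmap zt y) != 0 -> pv b y = 0) -> pv b x = 0].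

Section Density.
Variables (n d : nat) (X : set 'rV[C]_n) (zt : 'I_d -> mpoly n C).
Variables (g : mpoly n C) (F : {poly mpoly d C}) (q : mpoly d C) (G : 'I_n -> {poly mpoly d C}).
Hypothesis cX : zariski_closed X.
Hypothesis fX : finite_over X zt.
Hypothesis cov : covering X zt g F q G.

(** The generic part of [X] has no component over a hypersurface of the base: once its denominators
    are cleared, [b] is a multiple of [F] up to factors that are nonzero off [q = 0]. *)
Lemma torsion_free (a : mpoly d C) (b : mpoly n C) : a != 0 ->
  (forall x, X x -> pv a (pmap zt x) != 0 -> pv b x = 0) ->
  forall x, X x -> pv q (pmap zt x) != 0 -> pv b x = 0.
Proof.
move=> a0 hb x Xx qx.
have [N [P hP]] := sheet_homogenize q G b.
have sheetE y : X y -> pv q (pmap zt y) != 0 ->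
    (spz (pmap zt y) P).[pv g y] = pv q (pmap zt y) ^+ N * pv b y.
  move=> Xy qy; rewrite hP//; congr (_ * pv _ _); apply/rowP => i.
  by rewrite mxE -(cov_coord cov)// mulrC mulKf.
have kP : kills (@base_pt _ _ _ X zt) (fun x => pv g (sval x)) ((q * a) *: P).
  apply: killsZ => -[y Xy] /=; rewrite pvM mulf_eq0 negb_or => /andP[qy ay].
  by rewrite sheetE// hb// mulr0.
have qa0 : q * a != 0 by rewrite mulf_neq0// (cov_q cov).
have [k [Q hQ]] := minimal_killer_dvd (cov_minimal cov) qa0 kP.
have [_ kF _] := cov_minimal cov.
have /eqP := congr1 (fun P => (spz (pmap zt x) P).[pv g x]) hQ.
rewrite /= spzZ hornerZ spzM hornerM [X in _ == _ * X](kF (exist _ x Xx)) mulr0 sheetE// pvXn.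
rewrite !mulf_eq0 !expf_eq0 (negbTE (cov_lead cov qx)) (negbTE qx) !andbF /=.
by move=> /eqP.
Qed.

(* The constant term of the characteristic polynomial of [h] vanishes at [zt x0], but if
   no point of [X] over [a != 0] were close to [x0] it would be bounded below *)
Lemma generic_dense x0 (a : mpoly d C) (de : R) : generic_closure X zt q x0 -> X x0 ->
  a != 0 -> 0 < de -> exists x, [/\ X x, near_row de x0 x & pv a (pmap zt x) != 0].
Proof.
move=> gx0 Xx0 a0 de0; apply: contrapT => hno.
have [h hx0 hsep] := separating_form fX Xx0.
have [eta eta0 heta] := separation_gap cX fX de0 hsep.
have hc : cont_on X (pv h) := @cont_on_pv _ _ X h.
have ha := algebraic_pv h fX.
have [P [q' [Pm q'0 hP]]] := characteristic_polynomial fX cov hc ha (bounded_over cX fX hc).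
have P0 : pv P`_0 (pmap zt x0) = 0.
  have := gx0 (gcomp zt h P); rewrite pv_gcomp hx0 -coef_spz horner_coef0; apply.
  apply: (torsion_free q'0) => x Xx q'x; rewrite pv_gcomp.
  have [qx ->] := hP _ q'x.
  have hm := @mem_fiber _ _ _ _ _ _ _ _ _ cov (pv h) x Xx qx.
  by rewrite (perm_big _ (perm_to_rem hm)) /= big_cons hornerM hornerXsubC subrr mul0r.
(* There are [(size F).-1] sheets, each contributing a factor of modulus at least [eta] to the
   constant term. *)
have e0 : 0 < eta ^+ (size F).-1 by rewrite exprn_gt0.
have [d1 d10 hd1] := pv_cont P`_0 (pmap zt x0) e0.
(* Dividing by [d%:R + 1] keeps the sum over the [d] coordinates strictly below [eta]. *)
have dd : 0 < Num.min d1 (eta / (d%:R + 1)).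
  by rewrite lt_min d10 divr_gt0// ltr_wpDl.
have [z hz aq'z] := pv_dense (pmap zt x0) (mulf_neq0 a0 q'0) dd.
move: aq'z; rewrite pvM mulf_eq0 negb_or => /andP[az q'z].
have [z1 z2] := near_row_min hz.
have [qz Pz] := hP z q'z.
have zv : nv (z - pmap zt x0) < eta.
  apply: le_lt_trans (_ : \sum_(i < d) eta / (d%:R + 1) < _).
    by apply: ler_sum => i _; rewrite !mxE; apply: ltW; have := z2 i; rewrite mxE.
  have d1p : 0 < d%:R + 1 :> R by rewrite ltr_wpDl.
  rewrite sumr_const card_ord -[(eta / _) *+ _]mulr_natl mulrCA gtr_pMr// ltr_pdivrMr//.
  by rewrite mul1r ltrDl.
have := hd1 z z1; rewrite P0 subr0 -coef_spz Pz -horner_coef0 horner_prod nm_prod.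
apply/negP; rewrite -leNgt -(size_fiber cov (pv h) qz).
have : forall c, c \in fiber F q G (pv h) z -> eta <= nm c.2.
  move=> c /(fiberP cov qz)[x [Xx zx _ ->]]; apply: heta => //; last by rewrite zx.
  by move=> nx; apply: hno; exists x; split => //; rewrite zx.
elim: (fiber F q G (pv h) z) => [|c l IH] hl /=; first by rewrite big_nil expr0.
rewrite big_cons exprS ler_pM ?exprn_ge0 ?(ltW eta0)//.
  rewrite hornerXsubC sub0r nmN; apply: hl; exact: mem_head.
by apply: IH => c' c'l; apply: hl; rewrite in_cons c'l orbT.
Qed.

End Density.
End IntegralClosure.

(** * Rational functions are integral; the two inclusions *)

Section MainTheorem.
Variable R : realType.
Local Notation C := (Cplx R).

(** [pv p] is integral over the base, and composing its equation with [a *: 'X] gives one for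
    [f]. *)
Lemma denominator_algebraic n d (X : set 'rV[C]_n) (zt : 'I_d -> mpoly n C) a p f :
  finite_over X zt -> a != 0 -> (forall x, X x -> pv a (pmap zt x) * f x = pv p x) ->
  algebraic (@base_pt _ _ _ X zt) (fun x => f (sval x)).
Proof.
move=> fX a0 hp; have [P Pm hP] := finite_over_poly p fX.
exists (P \Po (a *: 'X)).
  rewrite -size_poly_eq0 size_comp_poly2 ?size_poly_eq0 ?monic_neq0//.
  by rewrite size_scale// size_polyX.
move=> [x Xx]; rewrite /base_pt /=.
have -> : (spz (pmap zt x) (P \Po (a *: 'X))).[f x] =
    (spz (pmap zt x) P).[pv a (pmap zt x) * f x].
  elim/poly_ind: (P) => [|Q c IH]; first by rewrite comp_poly0 !rmorph0 !horner0.
  rewrite comp_polyD comp_polyM comp_polyX comp_polyC !rmorphD !rmorphM /= !spzC spzX.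
  by rewrite spzZ spzX !hornerD !hornerM IH !hornerC hornerZ !hornerX.
by rewrite hp//; exact: hP.
Qed.

Lemma cont_on_spz n d (X : set 'rV[C]_n) (zt : 'I_d -> mpoly n C) P f :
  cont_on X f -> cont_on X (fun x => (spz (pmap zt x) P).[f x]).
Proof.
move=> fc; elim/poly_ind: P => [|P c IH].
  have := @cont_on_pv _ _ X 0; congr cont_on; apply/funext => x.
  by rewrite pv0 rmorph0 horner0.
have := cont_onD (cont_onM IH fc) (@cont_on_pv _ _ X (psub zt c)).
congr cont_on; apply/funext => x.
by rewrite rmorphD rmorphM /= spzX spzC hornerMXaddC pv_psub.
Qed.

(** [X] is covered by the generic closure [X1], where the characteristic polynomial kills [f] by
    continuity and density, and by the Zariski closure [Y] of the rest, which lies over [q = 0] and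
    falls to the induction. The product of the two monic polynomials kills [f] on all of [X]. *)
Lemma dense_denominators_integral d : forall n (X : set 'rV[C]_n) (zt : 'I_d -> mpoly n C) f,
  zariski_closed X -> finite_over X zt -> cont_on X f -> has_dense_denominators X f ->
  integral_on X id f.
Proof.
elim: d => [|d IH] n X zt f cX fX fc rf;
  have [g [F [q [G cov]]]] := covering_exists cX fX;
  have [a [p [a0 hp]]] := dense_denominators_base cov rf;
  have fa := denominator_algebraic fX a0 hp;
  have [P [q' [Pm q'0 hP]]] := characteristic_polynomial fX cov fc fa (bounded_over cX fX fc);
  have Pgen : forall x, X x -> pv q' (pmap zt x) != 0 -> (spz (pmap zt x) P).[f x] = 0.
1,3: move=> x Xx q'x; have [qx ->] := hP _ q'x; have hm := mem_fiber cov f Xx qx;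
  by rewrite (perm_big _ (perm_to_rem hm)) /= big_cons hornerM hornerXsubC subrr mul0r.
all: pose P1 := map_poly (psub zt) P;
  have P1m : P1 \is monic by exact: monic_map.
all: have P1E x : spz x P1 = spz (pmap zt x) P by
  apply/polyP => i; rewrite !coef_spz coef_map /= pv_psub.
  by exists P1 => // x Xx; rewrite P1E; apply: Pgen => //; exact: pv0_var.
set X1 := generic_closure X zt q.
have PX1 x : X x -> X1 x -> (spz (pmap zt x) P).[f x] = 0.
  move=> Xx X1x; apply/eqP; apply: contraT; rewrite -nm_gt0 => Px.
  have [d0 d00 hd] := cont_on_spz zt P fc Xx Px.
  have [y [Xy xy q'y]] := generic_dense cX fX cov X1x Xx q'0 d00.
  by have := hd y Xy xy; rewrite Pgen// sub0r nmN ltxx.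
pose Y := [set y | forall b : mpoly n C, (forall x, X x -> ~ X1 x -> pv b x = 0) -> pv b y = 0].
have XY x : X x -> ~ X1 x -> Y x by move=> Xx nX1 b; apply.
have YX : Y `<=` X.
  have [I XI] := cX; move=> y Yy; rewrite XI => b Ib; rewrite -[LHS]/(peval b y).
  have := Yy b; rewrite pv.unlock; apply=> x Xx _; move: Xx; rewrite XI; exact.
have cY : zariski_closed Y.
  exists [set b | forall x, X x -> ~ X1 x -> pv b x = 0]; apply/seteqP; split=> y h b hb.
    by have := h b hb; rewrite pv.unlock.
  by rewrite pv.unlock; exact: h.
have [zt' fY] : exists zt' : 'I_d -> mpoly n C, finite_over Y zt'.
  apply: noether_step (cov_q cov) _ (finite_over_sub YX fX) => y Yy.
  rewrite -pv_psub; apply: Yy => x Xx nX1; apply/eqP; apply: contraT => qx; case: nX1 => b hb.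
  by apply: hb; rewrite -?pv_psub.
have rY : has_dense_denominators Y f.
  move=> r [y Yy ry].
  have [x [Xx nX1 rx]] : exists x, [/\ X x, ~ X1 x & pv r x != 0].
    apply: contrapT => h; move/eqP: ry; apply; apply: Yy => x Xx nX1.
    by apply/eqP; apply: contraT => rx; case: h; exists x.
  (* [b] vanishes on [X1] but not at [x]; testing density with [r * b] forces the point found out of
     [X1], hence into [Y]. *)
  have [b hb bx] : exists2 b : mpoly n C,
      (forall y, X y -> pv q (pmap zt y) != 0 -> pv b y = 0) & pv b x != 0.
    apply: contrapT => h; apply: nX1 => b hb; apply/eqP; apply: contraT => bx.
    by case: h; exists b.
  have [|x' [Xx' rx' [b' [p' [hb' bx']]]]] := rf (r * b).
    by exists x => //; rewrite pvM mulf_neq0.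
  move: rx'; rewrite pvM mulf_eq0 negb_or => /andP[rx' bx''].
  exists x'; split => //.
    by apply: XY => // X1x'; move: bx''; rewrite X1x'// eqxx.
  by exists b', p'; split => // u /YX; exact: hb'.
have [P2 P2m hP2] := IH n Y zt' f cY fY (cont_on_sub YX fc) rY.
exists (P1 * P2); first by rewrite monicMl.
move=> x Xx; rewrite spzM hornerM; have [X1x|nX1] := pselect (X1 x).
  by rewrite P1E PX1// mul0r.
by rewrite (hP2 x (XY x Xx nX1)) mulr0.
Qed.

End MainTheorem.

Theorem corollary4p18 (R : realType) (n : nat) (X : set 'rV[Cplx R]_n)
    (HX : zariski_closed X) :
  continuous_rational_functions (X := X) =
    integral_closure (coordinate_ring (X := X)) (continuous_functions (X := X)).
Proof.
pose id_n (i : 'I_n) : mpoly n (Cplx R) := mpolyX (Cplx R) (mnm1 i).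
(* The identity of the ambient space is the finite projection from which both inductions on
   dimension start. *)
have fX : finite_over X id_n.
  move=> i; apply: integral_on_eq (integral_on_base _ _ (mpolyX _ (mnm1 i))) => x _.
  by rewrite pvX mxE pvX.
pose ext (f : X -> Cplx R) (x : 'rV[Cplx R]_n) : Cplx R :=
  if pselect (X x) is left Xx then f (exist _ x (mem_set Xx)) else 0.
have extE f (x : X) : ext f (set_val x) = f x.
  rewrite /ext; case: pselect => [Xx|[]]; last exact: set_valP.
  by congr f; apply: val_inj.
have extE' f x (Xx : X x) : ext f x = f (exist _ x (mem_set Xx)).
  by rewrite -extE.
apply/seteqP; split=> f.
- move=> [[U [[I UI] Udense Ureg]] fc]; split => //.
  have ec := continuous_cont_on fc (extE f).
  have rf : has_dense_denominators X (ext f).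
    move=> r [x Xx rx].
    pose V : set X := ~` (set_val @^-1` zero_locus [set r]).
    have [|v [Uv Vv]] := Udense V (ex_intro _ _ erefl).
      exists (exist _ x (mem_set Xx)) => /(_ r erefl) /= r0.
      by move: rx; rewrite pv.unlock r0 eqxx.
    have [W [[J WJ] Wv WU [p [q hpq]]]] := Ureg v Uv.
    (* [s] vanishes off [W], so multiplying by it makes the local fraction [p / q] an identity on
       all of [X]. *)
    have [s Js sv] : exists2 s, J s & peval s (set_val v) != 0.
      apply: contrapT => h; move: Wv; rewrite WJ; apply => s Js.
      by apply/eqP; apply: contraT => sv; case: h; exists s.
    exists (set_val v); split; first exact: set_valP.
      rewrite pv.unlock; apply/eqP => r0; apply: Vv => _ /= -> //.
    exists (s * q), (s * p); split.
      move=> y Xy; rewrite extE' !pvM -mulrA; set yX := exist _ y _.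
      have [->|sy] := eqVneq (pv s y) 0; first by rewrite !mul0r.
      have Wy : W yX.
        by rewrite WJ => /(_ s Js) /= s0; move: sy; rewrite pv.unlock s0 eqxx.
      have [qy ->] := hpq yX Wy; congr (_ * _).
      by rewrite pv.unlock /= mulrC divfK.
    rewrite pvM mulf_neq0//; first by rewrite pv.unlock.
    by have [qv _] := hpq v Wv; rewrite pv.unlock.
  have [P Pm hP] := dense_denominators_integral HX fX ec rf.
  exists (size P).-1, (fun i x => pv P`_i (set_val x)); split.
    by move=> i; exists P`_i => x; rewrite pv.unlock.
  apply/funext => x.
  have := hP (set_val x) (set_valP x); rewrite extE horner_coef.
  rewrite size_spz; last by rewrite (monicP Pm) pv1 oner_neq0.
  have P0 : (0 < size P)%N by rewrite size_poly_gt0 monic_neq0.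
  rewrite -(prednK P0) big_ord_recr /= coef_spz -/(lead_coef P) (monicP Pm) pv1 mul1r.
  move=> e; rewrite -[RHS]e [RHS]addrC addrfctE exprfctE fct_sumE; congr (_ + _).
  by apply: eq_bigr => i _; rewrite coef_spz mulrfctE exprfctE.
- move=> [fc [m [a [ha e]]]]; split => //.
  have ec := continuous_cont_on fc (extE f).
  have [b hb] := choice ha.
  have fi : integral_on X id (ext f).
    exists ('X^m + \poly_(i < m) (if insub i is Some j then b j else 0)).
      by rewrite monicE lead_coefDl ?lead_coefXn// size_polyXn ltnS size_poly.
    move=> x Xx; rewrite extE'; set xX := exist _ x _.
    have := congr1 (@^~ xX) e; rewrite /= addrfctE exprfctE fct_sumE => e'.
    rewrite rmorphD rmorphXn /= spzX hornerD hornerXn -[RHS]e'; congr (_ + _).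
    rewrite poly_def rmorph_sum horner_sum; apply: eq_bigr => i _.
    rewrite /= spzZ rmorphXn /= spzX hornerZ hornerXn mulrfctE exprfctE (hb i xX).
    by rewrite insubT //= => ?; rewrite pv.unlock; congr (peval (b _) _ * _); apply: val_inj.
  have rf := integral_dense_denominators HX fX ec fi.
  (* All denominators of [f] at once; the complement of their common zeros is the domain on which
     [f] is regular. *)
  pose I : set (mpoly n (Cplx R)) := [set b |
    exists p, forall x : X, pv b (set_val x) * f x = pv p (set_val x)].
  exists (~` (set_val @^-1` zero_locus I)); split; first by exists I.
  + move=> V [J VJ] [v Vv].
    have [s Js sv] : exists2 s, J s & peval s (set_val v) != 0.
      apply: contrapT => h; move: Vv; rewrite VJ; apply => s Js.
      by apply/eqP; apply: contraT => sv; case: h; exists s.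
    have [|x [Xx sx [b' [p [hp bx]]]]] := rf s.
      by exists (set_val v); [exact: set_valP|rewrite pv.unlock].
    exists (exist _ x (mem_set Xx)); split.
      move=> /(_ b') /= h; move: bx; rewrite pv.unlock h ?eqxx//.
      by exists p => y; rewrite -extE hp//; exact: set_valP.
    rewrite VJ => /(_ s Js) /= s0; by move: sx; rewrite pv.unlock s0 eqxx.
  + move=> x Ux.
    have [b' [p hp] bx] : exists2 b', I b' & peval b' (set_val x) != 0.
      apply: contrapT => h; apply: Ux => s Js.
      by apply/eqP; apply: contraT => sv; case: h; exists s.
    exists (~` (set_val @^-1` zero_locus [set b'])); split.
    * by exists [set b'].
    * by move=> /(_ b' erefl) b0; move: bx; rewrite b0 eqxx.
    * move=> y Vy Uy; apply: Vy => _ ->; apply: Uy; by exists p.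
    * exists p, b' => y Vy.
      have by0 : peval b' (set_val y) != 0.
        by apply/eqP => b0; apply: Vy => _ ->.
      split => //; have := hp y; rewrite pv.unlock => <-.
      by rewrite mulrC mulKf.
Qed.
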